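(* Let $0<\eta_\star<\eta^\star$ and $\lambda^\star\ge0$ be constants and let $\eta,\lambda$ be progressively measurable real processes such that a.s. for all $t\in[0,T]$: $\eta_\star\le\eta_t\le\eta^\star$ and $0\le\lambda_t\le\lambda^\star$. Let $f:\mathbb R\to\mathbb R$ be continuous and non-increasing with $f(0)=0$, and concave and of class $C^2$ on $[0,\infty)$. Let $\xi$ be a bounded, non-negative, $\mathcal F_T$-measurable random variable, let $(Y,Z)$ be the solution of the BSDE and let $(\overline Y_i)_{i=0,\dots,N}$ be the implicit Euler scheme, both described in the context. Let $K=\|\xi\|_\infty+T\lambda^\star$. Then for all $i\in\{0,\dots,N\}$, a.s., $$\begin{aligned}|Y_{t_i}-\overline Y_i|\le{}&\mathbb E_{t_i}\bigg[|\xi-\overline\xi|+|f(K)|\int_{t_i}^T|a_s-\overline a_s|\,ds+\int_{t_i}^T|\lambda_s-\overline\lambda_s|\,ds\bigg]\\&+\bigg[\frac{|f'(K)|T}{2\eta_\star}\Big(\frac{1}{\eta_\star}|f(K)|+\lambda^\star\Big)+\frac{\sup_{y\in[0,K]}|f''(y)|}{2\eta_\star}\big(\|\xi\|_\infty^2+2(T-t_i)K\lambda^\star\big)\bigg]h,\end{aligned}$$ where $\overline a_s=\overline a_k$ and $\overline\lambda_s=\overline\lambda_k$ for $s\in[t_k,t_{k+1})$.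
   Context: $T\in(0,\infty)$ is fixed and $W$ is a $d$-dimensional Brownian motion on a filtered probability space $(\Omega,\mathcal F_T,(\mathcal F_t)_{t\in[0,T]},\mathbb P)$ satisfying the usual conditions, where $(\mathcal F_t)$ is the filtration generated by $W$. $\mathbb E_t[\cdot]$ denotes conditional expectation given $\mathcal F_t$. Put $a_t=1/\eta_t$. BSDE: $(Y,Z)$ is the unique solution of $dY_t=-(a_tf(Y_t)+\lambda_t)\,dt+Z_t\,dW_t$, $t\in[0,T]$, $Y_T=\xi$, with $Y$ adapted càdlàg, $\mathbb E[\sup_{t\in[0,T]}|Y_t|^2]<\infty$, $Z$ predictable and $\mathbb E[\int_0^T|Z_t|^2dt]<\infty$ (existence and uniqueness hold under the stated assumptions). Implicit Euler scheme: let $N\in\mathbb N$, $h=T/N$, $t_i=ih$ for $i=0,\dots,N$. Let $(\overline a_i)_{i=0,\dots,N}$ and $(\overline\lambda_i)_{i=0,\dots,N}$ be $(\mathcal F_{t_i})$-adapted processes with $0\le\overline a_i\le1/\eta_\star$ and $0\le\overline\lambda_i\le\lambda^\star$, and let $\overline\xi$ be an $\mathcal F_T$-measurable random variable with $0\le\overline\xi\le\|\xi\|_\infty$. Then $(\overline Y_i)_{i=0,\dots,N}$ is the unique non-negative $(\mathcal F_{t_i})$-adapted process with $\overline Y_N=\overline\xi$ and $\overline Y_i=\mathbb E_{t_i}[\overline Y_{i+1}]+h\overline a_if(\overline Y_i)+h\overline\lambda_i$ for $i=0,\dots,N-1$. *)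

(* Defs.v *)
From mathcomp Require Export all_boot all_order all_algebra.
From mathcomp Require Export all_classical all_reals all_analysis.

#[export] Set Implicit Arguments.
#[export] Unset Strict Implicit.
#[export] Unset Printing Implicit Defensive.
Export Order.TTheory GRing.Theory Num.Theory.
Export numFieldNormedType.Exports.

Local Open Scope classical_set_scope.
Local Open Scope ring_scope.

Section Derivatives.
Context {R : realType}.
Implicit Types (A : set R) (f : R -> R) (x : R).

(* Derivative of [f] relative to [A]: difference quotients are only taken along
   points of [A], so at an endpoint of an interval this is the one-sided
   derivative and the values of [f] outside [A] play no role. *)
Definition derivable_in A f x : Prop :=
  cvg ((f y - f x) / (y - x) @[y --> within A x^']).

Definition derive_in A f x : R :=
  lim ((f y - f x) / (y - x) @[y --> within A x^']).

Definition C2_on A f : Prop :=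
  [/\ forall x, A x -> derivable_in A f x,
      forall x, A x -> derivable_in A (derive_in A f) x &
      {within A, continuous (derive_in A (derive_in A f))}].

End Derivatives.

Section ConditionalExpectation.
Context {R : realType} {d : measure_display} {Omega : measurableType d}.
Implicit Types (G : set (set Omega)) (X Y : Omega -> R).

(* Sub-sigma-algebras of Omega are sets of sets; [g_sigma_algebraType G] is
   Omega equipped with the sigma-algebra <<s G >>, which is [G] itself when [G]
   is already a sigma-algebra. *)
Definition measurable_wrt G X : Prop :=
  measurable_fun [set: g_sigma_algebraType G] (X : g_sigma_algebraType G -> R).

Definition is_cond_exp (P : probability Omega R) G X Y : Prop :=
  [/\ P.-integrable [set: Omega] (EFin \o X),
      measurable_wrt G Y,
      P.-integrable [set: Omega] (EFin \o Y) &
      forall A, G A ->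
        (\int[P]_(w in A) (Y w)%:E = \int[P]_(w in A) (X w)%:E)%E].

(* A version of E[X | G]; it is only determined P-almost surely, and is 0 by
   convention if X has no conditional expectation (X not integrable). *)
Definition cond_exp (P : probability Omega R) G X : Omega -> R :=
  xget (fun=> 0) [set Y | is_cond_exp P G X Y].

End ConditionalExpectation.

Section Processes.
Context {R : realType} {d : measure_display} {Omega : measurableType d}.
Variables (P : probability Omega R) (T : R) (F : R -> set (set Omega)).
Implicit Types (X : R -> Omega -> R).

(* Processes and filtrations are indexed by R; only the times in [0, T] are
   constrained. *)

Record usual_conditions : Prop := UsualConditions {
  uc_sigma_algebra : forall t : R, 0 <= t <= T -> sigma_algebra [set: Omega] (F t) ;
  uc_measurable : forall t : R, 0 <= t <= T -> F t `<=` measurable ;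
  uc_nondecreasing : forall s t : R, 0 <= s -> s <= t -> t <= T -> F s `<=` F t ;
  uc_complete : P.-negligible `<=` F 0 ;
  uc_right_continuous : forall t : R, 0 <= t < T ->
    \bigcap_(s in `]t, T]) F s `<=` F t }.

Definition adapted X : Prop :=
  forall t : R, 0 <= t <= T -> measurable_wrt (F t) (X t).

Definition progressively_measurable X : Prop :=
  forall t : R, 0 <= t <= T ->
    measurable_fun (`[0, t]%classic `*` [set: g_sigma_algebraType (F t)])
      (fun p : measurableTypeR R * g_sigma_algebraType (F t) => X p.1 p.2).

Definition predictable_rectangle : set (set (R * Omega)) :=
  [set C | (exists (s t : R) A, [/\ 0 <= s, s < t, t <= T, F s A &
                              C = `]s, t]%classic `*` A])
        \/ (exists2 A, F 0 A & C = [set 0] `*` A)].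

Definition predictable X : Prop :=
  measurable_fun
    (`[0, T]%classic `*` setT : set (g_sigma_algebraType predictable_rectangle))
    ((fun p : R * Omega => X p.1 p.2)
       : g_sigma_algebraType predictable_rectangle -> R).

Definition cadlag_path (x : R -> R) : Prop :=
  (forall t : R, 0 <= t < T -> x s @[s --> t^'+] --> x t) /\
  (forall t : R, 0 < t <= T -> cvg (x s @[s --> t^'-])).

End Processes.

Section BrownianMotion.
Context {R : realType} {d : measure_display} {Omega : measurableType d} {n : nat}.
Variables (P : probability Omega R) (T : R) (W : 'I_n -> R -> Omega -> R).

(* The sets {W^j_s \in B} with s <= t. *)
Definition past_events (t : R) : set (set Omega) :=
  [set A | exists j (s : R) (B : set (measurableTypeR R)),
     [/\ 0 <= s <= t, measurable B & A = W j s @^-1` B]].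

(* The increment condition says at once that W_t - W_s is independent of
   sigma(W_u, u <= s) and has law N(0, (t - s) I_n), whose values on boxes are
   products of one-dimensional normal probabilities. The second parameter of
   [normal_prob] is the standard deviation. *)
Record brownian_motion : Prop := BrownianMotion {
  bm_measurable : forall j (t : R), 0 <= t <= T ->
    measurable_fun [set: Omega] (W j t) ;
  bm_start : \forall w \ae P, forall j, W j 0 w = 0 ;
  bm_continuous : \forall w \ae P, forall j,
    {within `[0, T], continuous (fun t => W j t w)} ;
  bm_increments : forall s t : R, 0 <= s -> s < t -> t <= T ->
    forall (A : set Omega) (B : 'I_n -> set (measurableTypeR R)),
    <<s past_events s >> A -> (forall j, measurable (B j)) ->
    (P (A `&` [set w | forall j, B j (W j t w - W j s w)%R])
     = P A * \prod_(j < n) normal_prob 0%R (Num.sqrt (t - s)%R) (B j))%E }.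

(* The filtration generated by W, augmented by the P-null sets. *)
Definition brownian_filtration (t : R) : set (set Omega) :=
  <<s past_events t `|` P.-negligible >>.

End BrownianMotion.

Section StochasticIntegral.
Context {R : realType} {d : measure_display} {Omega : measurableType d} {n : nat}.

(* The process \sum_(k < size) val_k 1_]time_k, time_{k+1}]. *)
Record simple_process := SimpleProcess {
  sp_size : nat ;
  sp_time : nat -> R ;
  sp_val : nat -> 'I_n -> Omega -> R }.

Definition sp_fun (H : simple_process) (j : 'I_n) (t : R) (w : Omega) : R :=
  \sum_(k < sp_size H)
    sp_val H k j w * \1_`]sp_time H k, sp_time H k.+1] t.

Definition sp_integral (W : 'I_n -> R -> Omega -> R) (H : simple_process)
    (t : R) (w : Omega) : R :=
  \sum_(k < sp_size H) \sum_(j < n)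
    sp_val H k j w * (W j (Num.min (sp_time H k.+1) t) w
                      - W j (Num.min (sp_time H k) t) w).

Variables (P : probability Omega R) (T : R) (F : R -> set (set Omega)).
Variable W : 'I_n -> R -> Omega -> R.

Record simple_predictable (H : simple_process) : Prop := SimplePredictable {
  sp_time_range : forall k, (k <= sp_size H)%N -> 0 <= sp_time H k <= T ;
  sp_time_mono : forall k, (k < sp_size H)%N -> sp_time H k <= sp_time H k.+1 ;
  sp_adapted : forall k j, (k < sp_size H)%N ->
    measurable_wrt (F (sp_time H k)) (sp_val H k j) ;
  sp_bounded : exists C, forall k j w, (k < sp_size H)%N ->
    `|sp_val H k j w| <= C }.

(* M is (the continuous version of) the Ito integral \int_0^. Z_s dW_s, where
   Z is square integrable: the L^2 limit of integrals of simple processes that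
   approximate Z in L^2(dt x P). *)
Record is_ito_integral (Z : 'I_n -> R -> Omega -> R) (M : R -> Omega -> R) :
    Prop := IsItoIntegral {
  ito_adapted : adapted T F M ;
  ito_continuous :
    \forall w \ae P, {within `[0, T], continuous (fun t => M t w)} ;
  ito_approx : exists H : nat -> simple_process,
    [/\ forall m, simple_predictable (H m),
        (\int[P]_w \int[lebesgue_measure]_(t in `[0%R, T])
           (\sum_(j < n) (sp_fun (H m) j t w - Z j t w) ^+ 2)%:E)%E
           @[m --> \oo] --> 0%E &
        forall t : R, 0 <= t <= T ->
          (\int[P]_w ((sp_integral W (H m) t w - M t w) ^+ 2)%:E)%E
             @[m --> \oo] --> 0%E] }.

End StochasticIntegral.

Section BSDE.
Context {R : realType} {d : measure_display} {Omega : measurableType d} {n : nat}.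
Variables (P : probability Omega R) (T : R) (F : R -> set (set Omega)).
Variable W : 'I_n -> R -> Omega -> R.
Variables (f : R -> R) (a lambda : R -> Omega -> R) (xi : Omega -> R).

(* dY_t = - (a_t f(Y_t) + lambda_t) dt + Z_t dW_t on [0, T], with Y_T = xi. *)
Record bsde_solution (Y : R -> Omega -> R) (Z : 'I_n -> R -> Omega -> R) :
    Prop := BsdeSolution {
  bsde_adapted : adapted T F Y ;
  bsde_cadlag : \forall w \ae P, cadlag_path T (fun t => Y t w) ;
  bsde_sup : (\int[P]_w ereal_sup [set (`|Y t w| ^+ 2)%:E | t in `[0%R, T]]
                < +oo)%E ;
  bsde_predictable : forall j, predictable T F (Z j) ;
  bsde_square_integrable :
    (\int[P]_w \int[lebesgue_measure]_(t in `[0%R, T])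
        (\sum_(j < n) (Z j t w) ^+ 2)%:E < +oo)%E ;
  bsde_dynamics : exists2 M, is_ito_integral P T F W Z M &
    \forall w \ae P, forall t : R, 0 <= t <= T ->
      Y t w = Y 0 w
              - \int[lebesgue_measure]_(s in `[0, t])
                  (a s w * f (Y s w) + lambda s w)
              + M t w ;
  bsde_terminal : \forall w \ae P, Y T w = xi w }.

End BSDE.

Section EulerScheme.
Context {R : realType} {d : measure_display} {Omega : measurableType d}.
Variables (P : probability Omega R) (T : R) (F : R -> set (set Omega)).
Variable N : nat.

Definition step : R := T / N%:R.

Definition grid (i : nat) : R := i%:R * step.

Definition grid_adapted (X : nat -> Omega -> R) : Prop :=
  forall i, (i <= N)%N -> measurable_wrt (F (grid i)) (X i).

(* The piecewise constant process equal to X_k on [t_k, t_{k+1}). *)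
Definition grid_interp (X : nat -> Omega -> R) (s : R) (w : Omega) : R :=
  \sum_(k < N) X k w * \1_`[grid k, grid k.+1[ s.

Record implicit_euler (f : R -> R) (abar lbar : nat -> Omega -> R)
    (xibar : Omega -> R) (Ybar : nat -> Omega -> R) : Prop := ImplicitEuler {
  euler_adapted : grid_adapted Ybar ;
  euler_ge0 : forall i, (i <= N)%N -> \forall w \ae P, 0 <= Ybar i w ;
  euler_terminal : \forall w \ae P, Ybar N w = xibar w ;
  euler_step : forall i, (i < N)%N -> \forall w \ae P,
    Ybar i w = cond_exp P (F (grid i)) (Ybar i.+1) w
               + step * abar i w * f (Ybar i w) + step * lbar i w }.

End EulerScheme.

Definition Linfty_norm {R : realType} {d : measure_display}
    {Omega : measurableType d} (P : probability Omega R) (X : Omega -> R) : R :=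
  fine ('N[P]_+oo[EFin \o X])%E.

(* Main.v *)
(** Write e_i = Y_{t_i} - Ybar_i. All estimates are tested against bounded
    F_{t_i}-measurable weights V >= 0, so that no Ito formula is needed: of the
    stochastic integral M only its square integrability and the orthogonality of
    its increments to the past are used. Comparing Y with 0 and with
    ||xi||_oo + (T - t) lambda^* gives 0 <= Y <= K.

    Over one step, multiply by the sign of e_i. Since f is non-increasing, the
    implicit term f(Y_{t_i}) - f(Ybar_i) has the favourable sign, whence
    E[V |e_i|] <= E[V |e_{i+1}|] + data error
                  + E[V sgn(e_i) abar_i \int_{t_i}^{t_{i+1}} (f(Y_s) - f(Y_{t_i})) ds].
    In the last term expand f at Y_{t_i} to second order. The first order part is
    driven by the drift of Y only, and |f'| <= |f'(K)| on [0, K] by concavity. The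
    second order part involves E[V (Y_s - Y_{t_i})^2], which is at most
    E[V (Y_s^2 - Y_{t_i}^2 + 2 K lambda^* (s - t_i))] because the drift of -Y is
    at most lambda^*; these bounds telescope over the steps to
    E[V (xi^2 - Y_{t_i}^2 + 2 K lambda^* (T - t_i))]. Taking V = 1_A for all A in
    F_{t_i} gives the conditional bound. *)

Require Import Defs.
From HB Require Import structures.
From mathcomp Require Import all_boot all_order all_algebra.
From mathcomp Require Import all_classical all_reals all_analysis.
From mathcomp Require Import measurable_realfun ess_sup_inf ring lra.
Local Open Scope classical_set_scope.
Local Open Scope ring_scope.

(** * Expectations, conditional expectations and orthogonality *)

(** Tested inequalities keep the recursion elementary: a weight measurable at [t_i] stays admissible
    at every later grid point, so one weight serves all steps. The sign of the error is absorbed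
    into the weight, and the quadratic terms are then tested against its absolute value. The
    compensated increment of [Y ^+ 2] is non-negative only in weighted mean, so two weights are
    compared by testing with their difference, never pointwise.

    The delicate point of the comparison is a limit along partitions. The martingale transforms that
    occur there have second moments bounded by that of one increment of [M]; this uniform
    integrability lets an almost sure upper bound in the limit pass to the mean.

    Time integrals of [f (Y s)] are treated as limits of Riemann sums, which gives their
    measurability by completeness and their estimates term by term. The factor 1/2 of the first
    order constant arises from summing the elapsed times inside one step; the factor
    [eta_inf^-1 * |f K| + lambda_sup] bounds the drift of [Y]. *)

Section Expectation.
Context {R : realType} {d : measure_display} {Omega : measurableType d}.
Variable P : probability Omega R.
Implicit Types (X Y V : Omega -> R).

Definition intg X := P.-integrable [set: Omega] (EFin \o X).
Definition Ex X : R := \int[P]_w X w.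

Lemma intg_meas X : intg X -> measurable_fun setT X.
Proof. by move=> /measurable_int /measurable_EFinP. Qed.

Lemma intgD X Y : intg X -> intg Y -> intg (fun w => X w + Y w).
Proof. by move=> iX iY; apply: eq_integrable (integrableD _ iX iY) => //. Qed.

Lemma intgB X Y : intg X -> intg Y -> intg (fun w => X w - Y w).
Proof. by move=> iX iY; apply: eq_integrable (integrableB _ iX iY) => //. Qed.

Lemma intgN X : intg X -> intg (fun w => - X w).
Proof. by move=> iX; apply: eq_integrable (integrableN iX) => //. Qed.

Lemma intgZ c X : intg X -> intg (fun w => c * X w).
Proof. by move=> iX; apply: eq_integrable (integrableZl _ c iX) => //. Qed.

Lemma intg_cst c : intg (fun=> c).
Proof. exact: finite_measure_integrable_cst. Qed.

Lemma intg_norm X : intg X -> intg (fun w => `|X w|).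
Proof. by move=> iX; apply: integrable_norm. Qed.

Lemma intg_le X Y : measurable_fun setT X -> intg Y ->
  (\forall w \ae P, `|X w| <= Y w) -> intg X.
Proof.
move=> mX iY XY; apply/integrableP; split; first exact/measurable_EFinP.
have /integrableP[mY ltY] := iY.
apply: le_lt_trans ltY; apply: ae_ge0_le_integral => //.
- by apply/measurableT_comp => //; apply/measurable_EFinP.
- by apply/measurableT_comp.
- by apply: filterS XY => w h _ /=; rewrite lee_fin (le_trans h)// ler_norm.
Qed.

Lemma intg_sum (I : Type) (r : seq I) (F : I -> Omega -> R) :
  (forall i, intg (F i)) -> intg (fun w => \sum_(i <- r) F i w).
Proof.
move=> iF; elim: r => [|i r IH].
  by rewrite (_ : (fun _ => _) = fun=> 0) ?funeqE//; [exact: intg_cst|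
    move=> w; rewrite big_nil].
rewrite (_ : (fun _ => _) = fun w => F i w + \sum_(j <- r) F j w).
  exact: intgD.
by rewrite funeqE => w; rewrite big_cons.
Qed.

Lemma ExD X Y : intg X -> intg Y -> Ex (fun w => X w + Y w) = Ex X + Ex Y.
Proof. by move=> iX iY; rewrite /Ex RintegralD. Qed.

Lemma ExB X Y : intg X -> intg Y -> Ex (fun w => X w - Y w) = Ex X - Ex Y.
Proof. by move=> iX iY; rewrite /Ex RintegralB. Qed.

Lemma ExZ c X : intg X -> Ex (fun w => c * X w) = c * Ex X.
Proof. by move=> iX; rewrite /Ex RintegralZl. Qed.

Lemma ExN X : intg X -> Ex (fun w => - X w) = - Ex X.
Proof.
by move=> iX; rewrite -mulN1r -ExZ//; congr Ex; apply/funext => w; rewrite mulN1r.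
Qed.

Lemma Ex_cst c : Ex (fun=> c) = c.
Proof.
rewrite /Ex Rintegral_cst//.
by change (c * fine (P setT) = c); rewrite probability_setT mulr1.
Qed.

Lemma Ex_sum (I : Type) (r : seq I) (F : I -> Omega -> R) :
  (forall i, intg (F i)) ->
  Ex (fun w => \sum_(i <- r) F i w) = \sum_(i <- r) Ex (F i).
Proof.
move=> iF; elim: r => [|i r IH].
  by under [fun _ => _]funext do rewrite big_nil; rewrite Ex_cst big_nil.
under [fun _ => _]funext do rewrite big_cons.
by rewrite ExD// ?IH ?big_cons//; apply: intg_sum.
Qed.

Lemma Ex_eq_ae X Y : measurable_fun setT X -> measurable_fun setT Y ->
  (\forall w \ae P, X w = Y w) -> Ex X = Ex Y.
Proof.
move=> mX mY XY; congr fine; apply: ae_eq_integral => //.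
- exact/measurable_EFinP.
- exact/measurable_EFinP.
- by apply: filterS XY => w h _ /=; rewrite h.
Qed.

(** [Ex] is the finite part of an extended integral, hence 0 when that integral is infinite. Passing
    to [Num.max 0 (X w)] therefore settles the sign without integrability. *)
Lemma Ex_ge0 X : measurable_fun setT X -> (\forall w \ae P, 0 <= X w) ->
  0 <= Ex X.
Proof.
move=> mX X0; rewrite (_ : Ex X = Ex (fun w => Num.max 0 (X w))).
  by apply: Rintegral_ge0 => w _; rewrite le_max lexx.
apply: Ex_eq_ae => //; first by apply: measurable_maxr.
by apply: filterS X0 => w h; rewrite max_r.
Qed.

Lemma Ex_le_ae X Y : intg X -> intg Y -> (\forall w \ae P, X w <= Y w) ->
  Ex X <= Ex Y.
Proof.
move=> iX iY XY; rewrite -subr_ge0 -ExB//; apply: Ex_ge0.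
  by apply: intg_meas; apply: intgB.
by apply: filterS XY => w; rewrite subr_ge0.
Qed.

Lemma Ex_le_norm X : intg X -> `|Ex X| <= Ex (fun w => `|X w|).
Proof. by move=> iX; apply: le_normr_Rintegral. Qed.

Lemma Ex_eq0_ae X : intg X -> (\forall w \ae P, 0 <= X w) -> Ex X = 0 ->
  \forall w \ae P, X w = 0.
Proof.
move=> iX X0 E0.
have mX := intg_meas iX.
have h : (\int[P]_(w in setT) `|(EFin \o X) w| = 0)%E.
  have -> : (\int[P]_(w in setT) `|(EFin \o X) w| = \int[P]_w (X w)%:E)%E.
    apply: ae_eq_integral => //.
    - by apply/measurableT_comp => //; apply/measurable_EFinP.
    - exact/measurable_EFinP.
    - by apply: filterS X0 => w h _ /=; rewrite ger0_norm.
  by rewrite -[LHS]fineK ?integrable_fin_num//; congr EFin.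
have /(ae_eq_integral_abs P measurableT) : measurable_fun setT (EFin \o X).
  exact/measurable_EFinP.
by move=> [/(_ h) H _]; apply: filterS H => w /(_ I) [].
Qed.

(** The bound is almost sure because the bounds on the data and on [Y] are. The class is stable
    under products and consists of integrable functions, so it provides the weights. *)
Definition bdd X := measurable_fun setT X /\
  exists C, \forall w \ae P, `|X w| <= C.

Lemma bdd_intg X : bdd X -> intg X.
Proof. by move=> [mX [C XC]]; apply: intg_le mX (intg_cst C) XC. Qed.

Lemma bdd_cst c : bdd (fun=> c).
Proof. by split => //; exists `|c|; apply: aeW. Qed.

Lemma bdd_indic (A : set Omega) : measurable A -> bdd (\1_A : Omega -> R).
Proof.
move=> mA; split; first exact: measurable_indic.
by exists 1; apply: aeW => w; rewrite indicE; case: (_ \in _); rewrite ?normr1 ?normr0.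
Qed.

Lemma bddD X Y : bdd X -> bdd Y -> bdd (fun w => X w + Y w).
Proof.
move=> [mX [C XC]] [mY [D YD]]; split; first exact: measurable_funD.
exists (C + D); apply: filterS2 XC YD => w h1 h2.
by rewrite (le_trans (ler_normD _ _))// lerD.
Qed.

Lemma bddN X : bdd X -> bdd (fun w => - X w).
Proof.
move=> [mX [C XC]]; split; first exact: measurableT_comp.
by exists C; apply: filterS XC => w; rewrite normrN.
Qed.

Lemma bddB X Y : bdd X -> bdd Y -> bdd (fun w => X w - Y w).
Proof. by move=> bX bY; apply: bddD => //; apply: bddN. Qed.

Lemma bddM X Y : bdd X -> bdd Y -> bdd (fun w => X w * Y w).
Proof.
move=> [mX [C XC]] [mY [D YD]]; split; first exact: measurable_funM.
exists (C * D); apply: filterS2 XC YD => w h1 h2.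
by rewrite normrM ler_pM.
Qed.

Lemma bdd_norm X : bdd X -> bdd (fun w => `|X w|).
Proof.
move=> [mX [C XC]]; split; first exact: measurableT_comp.
by exists C; apply: filterS XC => w; rewrite normr_id.
Qed.

Lemma intg_bddM V X : bdd V -> intg X -> intg (fun w => V w * X w).
Proof.
move=> [mV [C VC]] iX.
apply: (intg_le _ (intgZ C (intg_norm iX))).
  by apply: measurable_funM => //; apply: intg_meas.
by apply: filterS VC => w h; rewrite normrM ler_wpM2r.
Qed.

End Expectation.

Import HBNNSimple.

(** * Orthogonality to a sub-sigma-algebra and testing on its sets *)

Section SubSigmaAlgebra.
Context {R : realType} {d : measure_display} {Omega : measurableType d}.
Variable P : probability Omega R.
Implicit Types (X Y V : Omega -> R) (G : set (set Omega)).

Lemma Ex_dominated (Xn : nat -> Omega -> R) X Y :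
  (forall m, measurable_fun setT (Xn m)) -> measurable_fun setT X -> intg P Y ->
  (\forall w \ae P, Xn m w @[m --> \oo] --> X w) ->
  (\forall w \ae P, forall m, `|Xn m w| <= Y w) ->
  Ex P (Xn m) @[m --> \oo] --> Ex P X.
Proof.
move=> mXn mX iY XnX XnY.
have [||||iX _ cv] := @dominated_convergence _ Omega R P setT measurableT
  (fun m => EFin \o Xn m) (EFin \o X) (EFin \o Y) _ _ _ iY _.
- by move=> m; exact/measurable_EFinP.
- exact/measurable_EFinP.
- by apply: filterS XnX => w h _; apply/cvg_EFin; [apply: nearW|apply: h].
- by apply: filterS XnY => w h m _ /=; rewrite lee_fin.
have e : (Ex P X)%:E = (\int[P]_w (EFin \o X) w)%E.
  by rewrite /Ex /Rintegral fineK// integrable_fin_num.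
by move: cv; rewrite -e => /fine_cvgP[].
Qed.

Lemma measurable_sigmaE G : sigma_algebra setT G ->
  (@measurable _ (g_sigma_algebraType G) : set (set Omega)) = G.
Proof. by move=> sG; exact: sigma_algebra_id. Qed.

Lemma wrt_preimage G X (B : set R) : sigma_algebra setT G ->
  measurable_wrt G X -> measurable B -> G (X @^-1` B).
Proof.
move=> sG mX mB; have := mX measurableT B mB.
by rewrite setTI measurable_sigmaE.
Qed.

Lemma wrt_sub G H X : sigma_algebra setT G -> sigma_algebra setT H ->
  G `<=` H -> measurable_wrt G X -> measurable_wrt H X.
Proof.
move=> sG sH GH mX _ B mB; rewrite setTI measurable_sigmaE//.
by apply: GH; exact: wrt_preimage.
Qed.

Lemma wrt_measurable G X : sigma_algebra setT G -> G `<=` measurable ->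
  measurable_wrt G X -> measurable_fun setT X.
Proof.
move=> sG Gm mX _ B mB; rewrite setTI; apply: Gm; exact: wrt_preimage.
Qed.

Lemma wrt_indic G (A : set Omega) : sigma_algebra setT G -> G A ->
  measurable_wrt G (\1_A : Omega -> R).
Proof.
move=> sG GA; apply: measurable_indic.
by rewrite measurable_sigmaE.
Qed.

(** This is E[X | G] = 0, expressed by integrals over the sets of [G] so that no version of a
    conditional expectation has to be chosen. *)
Definition orth G X := intg P X /\ forall A, G A -> \int[P]_(w in A) X w = 0.

Lemma Rint_indic (A : set Omega) X : measurable A ->
  \int[P]_(w in A) X w = Ex P (fun w => \1_A w * X w).
Proof.
move=> mA; rewrite Rintegral_mkcond; apply: eq_Rintegral => w _.
by rewrite patchE indicE; case: (w \in A); rewrite ?mul1r ?mul0r.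
Qed.

Section Orthogonality.
Variable G : set (set Omega).
Hypotheses (sG : sigma_algebra setT G) (Gm : G `<=` measurable).

(** For simple [V] the claim is linear in the defining property of [orth]. Simple functions
    increasing to [V] are dominated by [V], so [|V * X|] is an integrable majorant and [V] itself
    may be unbounded. *)
Lemma orth_mul_nneg V X : orth G X -> measurable_wrt G V ->
  (forall w, 0 <= V w) -> intg P (fun w => V w * X w) ->
  Ex P (fun w => V w * X w) = 0.
Proof.
move=> [iX X0] mV V0 iVX.
have mV' : measurable_fun setT (EFin \o V : g_sigma_algebraType G -> \bar R).
  exact/measurable_EFinP.
pose gn := nnsfun_approx measurableT mV'.
pose g (m : nat) : Omega -> R := gn m.
have gV w : g m w @[m --> \oo] --> V w.
  have := @cvg_nnsfun_approx _ _ _ _ measurableT _ mV' (fun x _ => V0 x) w I.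
  by move/fine_cvgP => [].
have gle m w : g m w <= V w.
  have nd (k l : nat) : (k <= l)%N -> g k w <= g l w.
    by move=> kl; have /lefP := @nd_nnsfun_approx _ _ _ _ measurableT _ mV' k l kl; apply.
  have <- : lim (g k w @[k --> \oo]) = V w by exact/cvg_lim.
  by apply: nondecreasing_cvgn_le => //; apply/cvg_ex; exists (V w).
have mg m : measurable_fun setT (g m : Omega -> R).
  apply: (@wrt_measurable G) => //.
  exact: measurable_funPT.
have E0 m : Ex P (fun w => g m w * X w) = 0.
  under [fun _ => _]funext do rewrite /g fimfunEord mulr_suml.
  have GA y : G (gn m @^-1` [set y]) by apply: wrt_preimage => //; exact: measurable_funPT.
  rewrite Ex_sum; last first.
    move=> i; under [fun _ => _]funext do rewrite -mulrA.
    by apply: intgZ; apply: intg_bddM => //; apply: bdd_indic; exact/Gm/GA.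
  rewrite big1// => i _; under [fun _ => _]funext do rewrite -mulrA.
  rewrite ExZ; last first.
    by apply: intg_bddM => //; apply: bdd_indic; exact/Gm/GA.
  by rewrite -Rint_indic ?X0 ?mulr0//; exact/Gm/GA.
have cv : Ex P (fun w => g m w * X w) @[m --> \oo] --> Ex P (fun w => V w * X w).
  apply: Ex_dominated (intg_norm iVX) _ _.
  - by move=> m; apply: measurable_funM => //; exact: intg_meas iX.
  - exact: intg_meas iVX.
  - by apply: aeW => w /=; apply: cvgMl.
  - apply: aeW => w m; rewrite !normrM ler_wpM2r//.
    by rewrite !ger0_norm//.
rewrite -(cvg_lim _ cv)//; under eq_fun do rewrite E0.
exact: lim_cst.
Qed.

Lemma orth_mul V X : orth G X -> measurable_wrt G V ->
  intg P (fun w => V w * X w) -> Ex P (fun w => V w * X w) = 0.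
Proof.
move=> oX mV iVX; have iX := oX.1; have mX := intg_meas iX.
have mp : measurable_wrt G (fun w => Num.max (V w) 0) by apply: measurable_maxr.
have mn : measurable_wrt G (fun w => Num.max (- V w) 0).
  by apply: measurable_maxr => //; exact: measurableT_comp.
have e w : V w * X w = Num.max (V w) 0 * X w - Num.max (- V w) 0 * X w.
  by rewrite -mulrBl; congr (_ * _); rewrite !maxEle; case: ifPn; case: ifPn; lra.
have ip : intg P (fun w => Num.max (V w) 0 * X w).
  apply: (@intg_le _ _ _ _ _ (fun w => `|V w * X w|)); last 1 first.
  - apply: aeW => w; rewrite !normrM ler_wpM2r// maxEle; case: ifPn => h //.
    by rewrite normr0.
  - by apply: measurable_funM => //; exact: wrt_measurable mp.
  - exact: intg_norm.
have in_ : intg P (fun w => Num.max (- V w) 0 * X w).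
  apply: (@intg_le _ _ _ _ _ (fun w => `|V w * X w|)); last 1 first.
  - apply: aeW => w; rewrite !normrM ler_wpM2r// maxEle; case: ifPn => h //.
      by rewrite normr0.
    by rewrite normrN.
  - by apply: measurable_funM => //; exact: wrt_measurable mn.
  - exact: intg_norm.
under [fun _ => _]funext do rewrite e.
by rewrite ExB// !orth_mul_nneg ?subr0// => w; rewrite le_max lexx orbT.
Qed.

(** The test set is {X < 0}: there the integral of [X] is minus the mean of its negative part, which
    must therefore vanish. *)
Lemma tested_ge0 X : measurable_wrt G X -> intg P X ->
  (forall A, G A -> 0 <= \int[P]_(w in A) X w) -> \forall w \ae P, 0 <= X w.
Proof.
move=> mX iX X0.
have mXP := intg_meas iX.
pose A := X @^-1` `]-oo, 0[%classic.
have GA : G A by exact: wrt_preimage.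
have h w : \1_A w * X w = - (Num.max (- X w) 0).
  rewrite indicE; have [|] := boolP (w \in A).
    by rewrite inE /A /= in_itv/= mul1r => h; rewrite max_l; lra.
  by move=> /negP; rewrite inE /A /= in_itv/= mul0r => /negP; rewrite -leNgt => h; rewrite max_r; lra.
have iM : intg P (fun w => Num.max (- X w) 0).
  apply: intg_le (intg_norm iX) _.
    by apply: measurable_maxr => //; exact: measurableT_comp.
  apply: aeW => w; rewrite ger0_norm ?le_max ?lexx ?orbT//.
  by rewrite ge_max normr_ge0 andbT -normrN ler_norm.
have E0 : Ex P (fun w => Num.max (- X w) 0) = 0.
  apply/eqP; rewrite eq_le; apply/andP; split; last first.
    apply: Ex_ge0 => //; first exact: intg_meas iM.
    by apply: aeW => w; rewrite le_max lexx orbT.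
  have := X0 _ GA; rewrite Rint_indic; last exact: Gm.
  by under [fun _ => _]funext do rewrite h; rewrite ExN// oppr_ge0.
have /(_ _) := Ex_eq0_ae iM _ E0.
have hh : \forall w \ae P, 0 <= Num.max (- X w) 0.
  by apply: aeW => w; rewrite le_max lexx orbT.
move=> /(_ hh); apply: filterS => w H.
have : - X w <= Num.max (- X w) 0 by rewrite le_max lexx.
by rewrite H; lra.
Qed.

End Orthogonality.

End SubSigmaAlgebra.

Section CondExp.
Context {R : realType} {d : measure_display} {Omega : measurableType d}.
Variable P : probability Omega R.
Variable G : set (set Omega).
Hypotheses (sG : sigma_algebra setT G) (Gm : G `<=` measurable).

(** The default value in [cond_exp] is excluded by exhibiting a version: the charge A |-> E[X; A],
    restricted to [G], is dominated by the restriction of [P], and its Radon-Nikodym density is one.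
    The restriction of [P] is realised as its image under the identity map into Omega equipped with
    [G]. *)
Lemma cond_expP (X : Omega -> R) : intg P X -> is_cond_exp P G X (cond_exp P G X).
Proof.
move=> iX; apply: (@xgetPex _ (fun=> 0) [set Y | is_cond_exp P G X Y]).
pose idG : Omega -> g_sigma_algebraType G := id.
have midG : measurable_fun setT idG.
  move=> _ A; rewrite setTI => mA; apply: Gm.
  by move: mA; rewrite measurable_sigmaE.
pose idF : {mfun Omega >-> g_sigma_algebraType G} :=
  HB.pack idG (isMeasurableFun.Build _ _ _ _ _ midG).
pose PG : probability (g_sigma_algebraType G) R := distribution P idF.
pose nuX := induced_charge iX.
pose nu0 : set (g_sigma_algebraType G) -> \bar R := nuX.
have mG (A : set (g_sigma_algebraType G)) : measurable A -> (measurable : set (set Omega)) A.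
  by rewrite measurable_sigmaE => //; apply: Gm.
have nu1 : nu0 set0 = 0%E by exact: charge0.
have nu2 A : measurable A -> nu0 A \is a fin_num.
  by move=> /mG mA; exact: (@fin_num_measure _ _ _ nuX).
have nu3 : semi_sigma_additive nu0.
  move=> F mF tF mU; apply: (@charge_semi_sigma_additive _ _ _ nuX) => //.
    by move=> i; exact: mG.
  exact: mG.
pose nu : {charge set (g_sigma_algebraType G) -> \bar R} :=
  HB.pack nu0 (isCharge.Build _ _ _ nu0 nu1 nu2 nu3).
have dom : nu `<< PG.
  apply/null_content_dominatesP => A mA A0.
  rewrite /nu /= /nu0 /nuX /induced_charge.
  apply: null_set_integral => //; first exact: mG.
  by apply: measurable_funTS; exact: measurable_int iX.
pose Y : Omega -> R := fine \o Radon_Nikodym nu PG.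
have Yfin x := Radon_Nikodym_fin_num x dom.
have YE : EFin \o Y = Radon_Nikodym nu PG.
  by apply/funext => x; rewrite /Y /= fineK.
have iY := Radon_Nikodym_integrable dom.
have mY : measurable_wrt G Y by apply/measurable_EFinP; rewrite YE; exact: measurable_int iY.
have mYP : measurable_fun [set: Omega] Y by exact: wrt_measurable mY.
have iYP : intg P Y.
  apply/integrableP; split; first exact/measurable_EFinP.
  have /integrableP[_] := iY; rewrite -YE /= ge0_integral_distribution//.
  by apply/measurable_EFinP; apply: measurableT_comp.
exists Y; split => // A GA.
have mA : measurable (A : set (g_sigma_algebraType G)) by rewrite measurable_sigmaE.
have := Radon_Nikodym_integral dom mA.
rewrite -YE /= /nu0 /nuX /induced_charge => ->.
rewrite /PG integral_pushforward//.
- exact/measurable_EFinP.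
- by apply: integrableS iYP => //; exact: mG.
Qed.

(** This turns an estimate tested on all sets of [G] into an almost sure conditional one. *)
Lemma cond_exp_ge (X V : Omega -> R) : intg P X -> measurable_wrt G V -> intg P V ->
  (forall A, G A -> \int[P]_(w in A) V w <= \int[P]_(w in A) X w) ->
  \forall w \ae P, V w <= cond_exp P G X w.
Proof.
move=> iX mV iV VX; have [_ mC iC CX] := cond_expP iX.
have : \forall w \ae P, 0 <= cond_exp P G X w - V w.
  apply: (tested_ge0 sG Gm).
  - exact: measurable_funB.
  - exact: intgB.
  - move=> A GA; have mA := Gm GA.
    rewrite RintegralB//; [|by apply: integrableS iC|by apply: integrableS iV].
    by rewrite subr_ge0 (le_trans (VX _ GA))// /Rintegral CX.
by apply: filterS => w; rewrite subr_ge0.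
Qed.

End CondExp.

(** * The stochastic integral is a square integrable martingale *)

Section Gaussian.
Context {R : realType}.
Variable s : R.
Hypothesis s_gt0 : 0 < s.
Notation mu := (@lebesgue_measure R).

(** The Radon-Nikodym derivative used by the change of variables agrees almost everywhere with the
    Gaussian density, since both have the same integral over every measurable set. *)
Lemma ge0_integral_normal_prob (f : R -> R) : measurable_fun setT f ->
  (forall x, 0 <= f x) ->
  (\int[normal_prob 0 s]_x (f x)%:E = \int[mu]_x (f x * normal_pdf 0 s x)%:E)%E.
Proof.
move=> mf f0.
have dom := @normal_prob_dominates R 0 s.
rewrite -(Radon_Nikodym_SigmaFinite.change_of_variables dom)//; last exact/measurable_EFinP.
have iRN := Radon_Nikodym_SigmaFinite.f_integrable dom.
apply: ae_eq_integral => //.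
- by apply: emeasurable_funM; [exact/measurable_EFinP|exact: measurable_int iRN].
- apply/measurable_EFinP; apply: measurable_funM => //; exact: measurable_normal_pdf.
- have : ae_eq mu setT (Radon_Nikodym_SigmaFinite.f (normal_prob 0 s) mu) (EFin \o normal_pdf 0 s).
    apply: integral_ae_eq => //.
      by apply/measurable_EFinP; exact: measurable_normal_pdf.
    by move=> E _ mE; rewrite -Radon_Nikodym_SigmaFinite.f_integral.
  by apply: filterS => x h /h; rewrite EFinM => ->.
Qed.

Lemma normal_prob_sqr_lty : (\int[normal_prob 0 s]_x (x ^+ 2)%:E < +oo)%E.
Proof.
rewrite (@ge0_integral_normal_prob (fun x => x ^+ 2)) => [||x]; last 2 first.
- exact: exprn_measurable.
- exact: sqr_ge0.
(* Doubling the variance halves the exponent: with u = x^2 / (4 s^2) the density at [s] carries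
   exp(-2u) and the one at [s'] carries exp(-u). Since u exp(-u) <= 1, the factor x^2 is absorbed by
   one of the two exponentials, at the price of the constant [C]. *)
pose s' := Num.sqrt (2 * s ^+ 2).
have s'2 : s' ^+ 2 = 2 * s ^+ 2 by rewrite sqr_sqrtr// mulr_ge0// sqr_ge0.
have s'0 : 0 < s' by rewrite sqrtr_gt0 mulr_gt0// exprn_gt0.
have p0 := normal_peak_gt0 (lt0r_neq0 s_gt0).
have p'0 := normal_peak_gt0 (lt0r_neq0 s'0).
pose C := normal_peak s / normal_peak s' * (4 * s ^+ 2).
have C0 : 0 <= C.
  have s20 := sqr_ge0 s; have q0 : 0 < (normal_peak s')^-1 by rewrite invr_gt0.
  rewrite /C; apply: mulr_ge0; last by apply: mulr_ge0.
  by apply: mulr_ge0; exact: ltW.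
apply: (@le_lt_trans _ _ (\int[mu]_x (C%:E * (normal_pdf 0 s' x)%:E))%E).
  apply: ge0_le_integral => //.
  - by move=> x _; rewrite lee_fin mulr_ge0 ?sqr_ge0 ?normal_pdf_ge0.
  - apply/measurable_EFinP; apply: measurable_funM; last exact: measurable_normal_pdf.
    exact: exprn_measurable.
  - apply/measurable_EFinP; apply: measurable_funM => //; exact: measurable_normal_pdf.
  - move=> x _; rewrite -EFinM lee_fin !normal_pdfE ?lt0r_neq0// /normal_fun subr0 s'2.
    set u := x ^+ 2 / (4 * s ^+ 2).
    have -> : - x ^+ 2 / (s ^+ 2 *+ 2) = - u - u.
      by rewrite /u -mulr_natr; field; rewrite lt0r_neq0.
    have -> : - x ^+ 2 / (2 * s ^+ 2 *+ 2) = - u.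
      by rewrite /u -mulr_natr; field; rewrite lt0r_neq0.
    have xu : x ^+ 2 = u * (4 * s ^+ 2) by rewrite /u; field; rewrite lt0r_neq0.
    have ue : u * expR (- u) <= 1.
      rewrite -(expRxMexpNx_1 u) ler_wpM2r ?expR_ge0//.
      by have := expR_ge1Dx u; lra.
    rewrite expRD xu /C.
    rewrite [leLHS](_ : _ = (u * expR (- u)) * (4 * s ^+ 2 * normal_peak s * expR (- u))); last by ring.
    rewrite [leRHS](_ : _ = 1 * (4 * s ^+ 2 * normal_peak s * expR (- u))); last first.
      by field; rewrite lt0r_neq0.
    by rewrite ler_wpM2r// !mulr_ge0 ?sqr_ge0 ?expR_ge0// ltW.
rewrite ge0_integralZl//.
- by rewrite integral_normal_pdf mule1 ltry.
- by apply/measurable_EFinP; exact: measurable_normal_pdf.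
- by move=> x _; rewrite lee_fin normal_pdf_ge0.
Qed.

Lemma normal_probN (B : set (measurableTypeR R)) : measurable B ->
  normal_prob 0 s (-%R @^-1` B) = normal_prob 0 s B.
Proof.
move=> mB; rewrite /normal_prob.
rewrite (_ : (\int[mu]_(x in B) _)%E =
  (\int[pushforward mu (-%R : R -> measurableTypeR R)]_(x in B) (normal_pdf 0 s x)%:E)%E); last first.
  apply: eq_measure_integral => A mA _; exact/esym/lebesgue_measureN.
rewrite ge0_integral_pushforward//.
- apply: eq_integral => x _; rewrite /= !normal_pdfE ?lt0r_neq0// /normal_fun.
  by rewrite !subr0 sqrrN.
- apply: measurable_funTS; apply/measurable_EFinP; exact: measurable_normal_pdf.
- by move=> x _; rewrite lee_fin normal_pdf_ge0.
Qed.

Context {d : measure_display} {Omega : measurableType d}.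
Variable P : probability Omega R.
Variable X : Omega -> R.
Hypothesis mX : measurable_fun setT X.
Hypothesis X_normal : forall B : set (measurableTypeR R), measurable B ->
  P (X @^-1` B) = normal_prob 0 s B.

Lemma ge0_integral_normal (f : R -> R) : measurable_fun setT f ->
  (forall x, 0 <= f x) ->
  (\int[P]_w (f (X w))%:E = \int[normal_prob 0 s]_x (f x)%:E)%E.
Proof.
move=> mf f0.
have mX' : measurable_fun setT (X : Omega -> measurableTypeR R) := mX.
pose Xf : {mfun Omega >-> measurableTypeR R} :=
  HB.pack (X : Omega -> measurableTypeR R) (isMeasurableFun.Build _ _ _ _ _ mX').
rewrite -(@ge0_integral_distribution _ _ _ _ _ P Xf (EFin \o f))//; last first.
  exact/measurable_EFinP.
by apply: eq_measure_integral => A mA _; exact: X_normal.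
Qed.

Lemma normal_sqr_intg : intg P (fun w => X w ^+ 2).
Proof.
apply/integrableP; split; first exact/measurable_EFinP/measurable_funX.
under eq_integral do rewrite /= ger0_norm ?sqr_ge0//.
rewrite (@ge0_integral_normal (fun x => x ^+ 2)) ?normal_prob_sqr_lty//.
by move=> x; exact: sqr_ge0.
Qed.

Lemma normal_intg : intg P X.
Proof.
apply: intg_le mX (intgD (intg_cst P 1) normal_sqr_intg) _.
apply: aeW => w; rewrite ler_norml; nra.
Qed.

End Gaussian.

Section Independence.
Context {R : realType} {d : measure_display} {Omega : measurableType d}.
Variable P : probability Omega R.

(** By symmetry of the law, [X] and its opposite have positive parts of equal mean, and [X] is the
    difference of these two positive parts. *)
Lemma normal_mean0 (s : R) (X : Omega -> R) : 0 < s -> measurable_fun setT X ->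
  (forall B : set (measurableTypeR R), measurable B ->
     P (X @^-1` B) = normal_prob 0 s B) -> Ex P X = 0.
Proof.
move=> s0 mX hX.
pose X' w := - X w.
have mX' : measurable_fun setT X' by exact: measurableT_comp.
have hX' (B : set (measurableTypeR R)) : measurable B -> P (X' @^-1` B) = normal_prob 0 s B.
  move=> mB; rewrite -normal_probN// -hX//.
  by rewrite -[X in measurable X]setTI; apply: oppr_measurable.
have iX : intg P X := normal_intg s0 mX hX.
have mp : measurable_fun setT (fun x : R => Num.max x 0) by apply: measurable_maxr.
have p0 (x : R) : 0 <= Num.max x 0 by rewrite le_max lexx orbT.
have ip (Y : Omega -> R) : intg P Y -> intg P (fun w => Num.max (Y w) 0).
  move=> iY; apply: intg_le (intg_norm iY) _.
    by apply: measurable_maxr => //; exact: (intg_meas iY).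
  by apply: aeW => w; rewrite ger0_norm// ge_max normr_ge0 ler_norm.
have -> : X = fun w => Num.max (X w) 0 - Num.max (X' w) 0.
  by apply/funext => w; rewrite /X' !maxEle; case: ifPn; case: ifPn; lra.
rewrite ExB; [|exact: ip|by apply: ip; exact: intgN].
apply/eqP; rewrite subr_eq0; apply/eqP; congr fine.
by rewrite (ge0_integral_normal mX hX mp p0) (ge0_integral_normal mX' hX' mp p0).
Qed.

(** Independence says that the centred indicator of [A] is orthogonal to the sigma-algebra generated
    by [X]; multiplying by [X], which is measurable for it, is then allowed by [orth_mul]. *)
Lemma indep_integral (A : set Omega) (X : Omega -> R) :
  measurable A -> measurable_fun setT X -> intg P X ->
  (forall B : set (measurableTypeR R), measurable B ->
    P (A `&` X @^-1` B) = (P A * P (X @^-1` B))%E) ->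
  \int[P]_(w in A) X w = fine (P A) * Ex P X.
Proof.
move=> mA mX iX ind.
pose G := [set X @^-1` B | B in (measurable : set (set R))].
have sG : sigma_algebra setT G.
  have := @sigma_algebra_preimage _ _ _ setT X (@sigma_algebra_measurable _ (measurableTypeR R)).
  by congr sigma_algebra; apply/seteqP; split => _ [B mB <-]; exists B; rewrite ?setTI.
have Gm : G `<=` measurable.
  by move=> _ [B mB <-]; rewrite -[X in measurable X]setTI; exact: mX.
have mXG : measurable_wrt G X.
  move=> _ B mB; rewrite setTI measurable_sigmaE//; by exists B.
have bA : bdd P (\1_A : Omega -> R) by exact: bdd_indic.
pose Z w := (\1_A w : R) - fine (P A).
have bZ : bdd P Z by apply: bddB => //; exact: bdd_cst.
have PAE (E : set Omega) : measurable E -> (fine (P E))%:E = P E.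
  by move=> mE; rewrite fineK// fin_num_measure.
have oZ : orth P G Z.
  split; first exact: bdd_intg.
  move=> _ [B mB <-].
  have mXB : measurable (X @^-1` B) by rewrite -[X in measurable X]setTI; exact: mX.
  rewrite /Z RintegralB//; last 2 first.
  - by apply: integrableS (bdd_intg bA).
  - by apply: integrableS (intg_cst P _).
  rewrite Rintegral_cst// /Rintegral integral_indic//.
  apply/eqP; rewrite subr_eq0; apply/eqP.
  transitivity (fine (P A * P (X @^-1` B))%E); first by congr fine; exact: ind.
  by rewrite fineM// fin_num_measure.
have e : (fun w => Z w * X w) = (fun w => X w * Z w) by apply/funext => w; rewrite mulrC.
have e' : (fun w => X w * Z w) = (fun w => \1_A w * X w - fine (P A) * X w).
  by apply/funext => w; rewrite /Z; ring.
have iXZ : intg P (fun w => X w * Z w) by rewrite -e; exact: intg_bddM.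
have := orth_mul sG Gm oZ mXG iXZ; rewrite e' ExB; [|exact: intg_bddM|exact: intgZ].
by rewrite ExZ// -Rint_indic// => /eqP; rewrite subr_eq0 => /eqP.
Qed.

End Independence.

Section SquareIntegrable.
Context {R : realType} {d : measure_display} {Omega : measurableType d}.
Variable P : probability Omega R.
Implicit Types (X Y V : Omega -> R) (G : set (set Omega)).

Definition L2 X := measurable_fun setT X /\ intg P (fun w => X w ^+ 2).

Lemma L2_intg X : L2 X -> intg P X.
Proof.
move=> [mX iX]; apply: intg_le mX (intgD (intg_cst P 1) iX) _.
apply: aeW => w; rewrite ler_norml; nra.
Qed.

Lemma L2_M X Y : L2 X -> L2 Y -> intg P (fun w => X w * Y w).
Proof.
move=> [mX iX] [mY iY]; apply: intg_le (measurable_funM mX mY) (intgD iX iY) _.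
apply: aeW => w /=; rewrite ler_norml.
by have := sqr_ge0 (X w - Y w); have := sqr_ge0 (X w + Y w); nra.
Qed.

Lemma L2D X Y : L2 X -> L2 Y -> L2 (fun w => X w + Y w).
Proof.
move=> [mX iX] [mY iY]; have mXY := measurable_funD mX mY; split => //.
apply: (@intg_le _ _ _ _ _ (fun w => 2 * (X w ^+ 2 + Y w ^+ 2))).
- by apply: measurable_funX.
- by apply: intgZ; apply: intgD.
- apply: aeW => w; rewrite ger0_norm ?sqr_ge0//; have := sqr_ge0 (X w - Y w); nra.
Qed.

Lemma L2N X : L2 X -> L2 (fun w => - X w).
Proof.
move=> [mX iX]; split; first exact: measurableT_comp.
by under [fun _ => _]funext do rewrite sqrrN.
Qed.

Lemma L2B X Y : L2 X -> L2 Y -> L2 (fun w => X w - Y w).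
Proof. by move=> lX lY; apply: L2D => //; exact: L2N. Qed.

Lemma bdd_L2 X : bdd P X -> L2 X.
Proof.
move=> bX; split; first by case: bX.
by apply: bdd_intg; under [fun _ => _]funext do rewrite expr2; exact: bddM.
Qed.

Lemma L2_bddM V X : bdd P V -> L2 X -> L2 (fun w => V w * X w).
Proof.
move=> bV [mX iX]; split; first by apply: measurable_funM => //; case: bV.
under [fun _ => _]funext do rewrite exprMn; apply: intg_bddM => //.
by under [fun _ => _]funext do rewrite expr2; exact: bddM.
Qed.

Lemma L2_sum (I : Type) (r : seq I) (X : I -> Omega -> R) :
  (forall i, L2 (X i)) -> L2 (fun w => \sum_(i <- r) X i w).
Proof.
move=> lX; elim: r => [|i r IH].
  by under [fun _ => _]funext do rewrite big_nil; apply: bdd_L2; exact: bdd_cst.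
by under [fun _ => _]funext do rewrite big_cons; exact: L2D.
Qed.

(** Integrate |x| <= e + x^2 / e. This weak form of the Cauchy-Schwarz inequality suffices for
    limits. *)
Lemma Ex_norm_le_sqr X e : L2 X -> 0 < e ->
  Ex P (fun w => X w ^+ 2) <= e ^+ 2 -> Ex P (fun w => `|X w|) <= 2 * e.
Proof.
move=> lX e0 h; have iX := L2_intg lX; have iX2 := lX.2.
apply: (@le_trans _ _ (Ex P (fun w => e + e^-1 * X w ^+ 2))).
  apply: Ex_le_ae; [exact: intg_norm|by apply: intgD; [exact: intg_cst|exact: intgZ]|].
  apply: aeW => w; rewrite -(ler_pM2r e0) mulrDl mulrAC mulVf ?lt0r_neq0// mul1r.
  rewrite -[X w ^+ 2]real_normK ?num_real//; have := sqr_ge0 (e - `|X w|); nra.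
rewrite ExD; [|exact: intg_cst|exact: intgZ].
rewrite Ex_cst ExZ// -(ler_pM2l e0) mulrDr mulrA mulfV ?lt0r_neq0// mul1r; nra.
Qed.

Lemma orthD G X Y : G `<=` measurable ->
  orth P G X -> orth P G Y -> orth P G (fun w => X w + Y w).
Proof.
move=> Gm [iX X0] [iY Y0]; split; first exact: intgD.
move=> A GA; have mA := Gm _ GA.
rewrite RintegralD ?X0 ?Y0 ?addr0//.
- exact: integrableS iX.
- exact: integrableS iY.
Qed.

Lemma orth0 G : orth P G (fun=> 0).
Proof.
split; first exact: intg_cst.
by move=> A GA; rewrite /Rintegral integral0.
Qed.

Lemma orth_sum (I : Type) (r : seq I) G (X : I -> Omega -> R) : G `<=` measurable ->
  (forall i, orth P G (X i)) -> orth P G (fun w => \sum_(i <- r) X i w).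
Proof.
move=> Gm lX; elim: r => [|i r IH].
  by under [fun _ => _]funext do rewrite big_nil; exact: orth0.
by under [fun _ => _]funext do rewrite big_cons; exact: orthD.
Qed.

Lemma orth_sub G H X : G `<=` H -> orth P H X -> orth P G X.
Proof. by move=> GH [iX X0]; split => // A /GH; exact: X0. Qed.

Lemma orth_scale G V X : sigma_algebra setT G -> G `<=` measurable ->
  measurable_wrt G V -> bdd P V -> orth P G X -> orth P G (fun w => V w * X w).
Proof.
move=> sG Gm mV bV oX; split; first by apply: intg_bddM => //; exact: oX.1.
move=> A GA; have mA := Gm _ GA; rewrite Rint_indic//.
under [fun _ => _]funext do rewrite mulrA.
apply: (orth_mul sG Gm oX).
- by apply: measurable_funM => //; exact: wrt_indic.
- by apply: intg_bddM; [apply: bddM => //; exact: bdd_indic|exact: oX.1].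
Qed.

End SquareIntegrable.

(** * From Brownian increments to the Ito integral *)

Section ItoMartingale.
Context {R : realType} {d : measure_display} {Omega : measurableType d} {n : nat}.
Variables (P : probability Omega R) (T : R) (W : 'I_n -> R -> Omega -> R).
Variable F : R -> set (set Omega).
Hypothesis W_brownian : brownian_motion P T W.
Hypothesis F_usual : usual_conditions P T F.
Hypothesis F_generated : forall t : R, 0 <= t <= T -> F t = brownian_filtration P W t.

(** Independence of the increments is postulated for the raw past only, whereas [F s] also contains
    the null sets. The sets that agree with a raw past event up to a null set form a sigma-algebra
    containing all generators. *)
Lemma brownian_filtration_approx (s : R) (A : set Omega) : 0 <= s <= T -> F s A ->
  exists2 B, <<s past_events W s >> B &
    [/\ measurable A, measurable B & \forall w \ae P, A w <-> B w].
Proof.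
move=> sT FA; have mF := uc_measurable F_usual sT.
pose C := [set A | exists2 B, <<s past_events W s >> B & \forall w \ae P, A w <-> B w].
have sB : sigma_algebra setT <<s past_events W s >> by exact: smallest_sigma_algebra.
have subF : <<s past_events W s >> `<=` F s.
  rewrite F_generated//; apply: sub_smallest2r; first exact: smallest_sigma_algebra.
  exact: subsetUl.
suff : C A.
  by move=> [B sBB AB]; exists B => //; split => //; [exact: mF|exact/mF/subF].
move: FA; rewrite F_generated//; apply: smallest_sub => //; last first.
  move=> E [h|h].
    by exists E; [exact: sub_sigma_algebra|exact: aeW].
  exists set0; first by case: sB.
  apply: negligibleS h => w /=; apply: contra_notP => h1; split => //.
case: sB => s0 sC sU; split.
- by exists set0 => //; exact: aeW.
- move=> E [B hB EB]; exists (setT `\` B); first exact: sC.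
  by apply: filterS EB => w h; split => -[_ h1]; split => //; move: h1; rewrite h.
- move=> E hE.
  have /choice[B hB] : forall k, exists B : set Omega, <<s past_events W s >> B /\
      \forall w \ae P, E k w <-> B w.
    by move=> k; have [B h1 h2] := hE k; exists B.
  exists (\bigcup_k B k); first by apply: sU => k; case: (hB k).
  have : \forall w \ae P, forall k, E k w <-> B k w.
    by apply: ae_foralln => k; case: (hB k).
  by apply: filterS => w h; split => -[k _ hk]; exists k => //; apply/h.
Qed.

Lemma brownian_increment_normal j (s t : R) : 0 <= s -> s < t -> t <= T ->
  forall (A : set Omega) (B : set (measurableTypeR R)),
    <<s past_events W s >> A -> measurable B ->
    P (A `&` (fun w => W j t w - W j s w) @^-1` B)
      = (P A * normal_prob 0 (Num.sqrt (t - s)) B)%E.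
Proof.
move=> s0 st tT A B sA mB.
pose B' (k : 'I_n) : set (measurableTypeR R) := if k == j then B else setT.
have mB' k : measurable (B' k) by rewrite /B'; case: ifP.
have := bm_increments W_brownian s0 st tT sA mB'.
rewrite (bigD1 j)//= big1 ?mule1; last first.
  by move=> k /negbTE kj; rewrite /B' kj; exact: probability_setT.
rewrite /B' eqxx => <-; congr (P _); apply/seteqP; split => w /=.
  move=> [Aw Bw]; split => // k.
  by case: eqP => // ->.
by move=> [Aw /(_ j)]; rewrite eqxx => h; split.
Qed.

Lemma brownian_increment_meas j (s t : R) : 0 <= s <= T -> 0 <= t <= T ->
  measurable_fun setT (fun w => W j t w - W j s w).
Proof. by move=> sT tT; apply: measurable_funB; exact: (bm_measurable W_brownian). Qed.

Lemma brownian_increment_normalT j (s t : R) : 0 <= s -> s < t -> t <= T ->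
  forall (B : set (measurableTypeR R)), measurable B ->
    P ((fun w => W j t w - W j s w) @^-1` B) = normal_prob 0 (Num.sqrt (t - s)) B.
Proof.
move=> s0 st tT B mB.
have h : <<s past_events W s >> setT.
  have [h0 hC _] : sigma_algebra setT <<s past_events W s >> by exact: smallest_sigma_algebra.
  by have := hC _ h0; rewrite setD0.
have := brownian_increment_normal j s0 st tT h mB.
by rewrite setTI => ->; rewrite probability_setT mul1e.
Qed.

Lemma brownian_increment_L2 j (s t : R) : 0 <= s -> s <= t -> t <= T ->
  L2 P (fun w => W j t w - W j s w).
Proof.
move=> s0; rewrite le_eqVlt => /predU1P[<-|st] tT.
  under [fun _ => _]funext do rewrite subrr.
  by apply: bdd_L2; exact: bdd_cst.
have mX := @brownian_increment_meas j s t.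
split; first by apply: mX; apply/andP; split; lra.
apply: (@normal_sqr_intg _ (Num.sqrt (t - s))).
- by rewrite sqrtr_gt0 subr_gt0.
- by apply: mX; apply/andP; split; lra.
- exact: brownian_increment_normalT.
Qed.

(** [A] is replaced by a raw past event, which is independent of the centred increment. The case
    [s = t] is separate because the normal law needs a positive deviation. *)
Lemma brownian_increment_orth j (s t : R) : 0 <= s -> s <= t -> t <= T ->
  orth P (F s) (fun w => W j t w - W j s w).
Proof.
move=> s0 st tT; have lX := brownian_increment_L2 j s0 st tT.
split; first exact: L2_intg.
move=> A FA; have sT : 0 <= s <= T by apply/andP; split; lra.
have [B sB [mA mB AB]] := brownian_filtration_approx sT FA.
move: st; rewrite le_eqVlt => /predU1P[e|st].
  by under eq_Rintegral do rewrite e subrr; rewrite /Rintegral integral0.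
have mX := lX.1; have iX := L2_intg lX.
have sq0 : 0 < Num.sqrt (t - s) by rewrite sqrtr_gt0 subr_gt0.
have -> : \int[P]_(w in A) (W j t w - W j s w) = \int[P]_(w in B) (W j t w - W j s w).
  rewrite !Rint_indic//; apply: Ex_eq_ae.
  - by apply: measurable_funM => //; exact: measurable_indic.
  - by apply: measurable_funM => //; exact: measurable_indic.
  - apply: filterS AB => w h; rewrite !indicE; congr (_%:R * _).
    by congr nat_of_bool; apply/idP/idP; rewrite !inE h.
rewrite indep_integral//.
  by rewrite (normal_mean0 sq0 mX (brownian_increment_normalT j s0 st tT)) mulr0.
by move=> C mC; rewrite brownian_increment_normalT// -(brownian_increment_normal j).
Qed.

Section SimpleIntegrals.
Variable H : simple_process (R := R) (Omega := Omega) (n := n).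
Hypothesis sH : simple_predictable T F H.

Let val_bdd k j : (k < sp_size H)%N -> bdd P (sp_val H k j).
Proof.
move=> kH; split.
  have kT := sp_time_range sH (ltnW kH).
  apply: (wrt_measurable (uc_sigma_algebra F_usual kT) (uc_measurable F_usual kT)).
  exact: (sp_adapted sH).
by have [C hC] := sp_bounded sH; exists C; apply: aeW => w; exact: hC.
Qed.

Let incr_range k (t : R) : (k < sp_size H)%N -> 0 <= t <= T ->
  [/\ 0 <= Num.min (sp_time H k) t, Num.min (sp_time H k) t <= Num.min (sp_time H k.+1) t
    & Num.min (sp_time H k.+1) t <= T].
Proof.
move=> kH /andP[t0 tT]; have /andP[a0 aT] := sp_time_range sH (ltnW kH).
have /andP[b0 bT] := sp_time_range sH kH; have ab := sp_time_mono sH kH.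
by split; rewrite !minEle; case: ifPn => //; case: ifPn => // *; lra.
Qed.

Lemma sp_integral_L2 t : 0 <= t <= T -> L2 P (sp_integral W H t).
Proof.
move=> tT; rewrite /sp_integral; apply: L2_sum => k; apply: L2_sum => j.
apply: L2_bddM; first exact: val_bdd.
by have [h1 h2 h3] := incr_range (ltn_ord k) tT; exact: brownian_increment_L2.
Qed.

(** Each summand lives on a cell from a to b. It vanishes if t <= a or b <= s. If s <= a, it is
    orthogonal to [F a], hence to the smaller [F s]. If a < s < b, its coefficient is already
    [F s]-measurable and multiplies an increment starting at [s]. *)
Lemma sp_integral_orth s t : 0 <= s -> s <= t -> t <= T ->
  orth P (F s) (fun w => sp_integral W H t w - sp_integral W H s w).
Proof.
move=> s0 st tT; have sT : 0 <= s <= T by apply/andP; split; lra.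
have sFs := uc_sigma_algebra F_usual sT; have mFs := uc_measurable F_usual sT.
rewrite /sp_integral; under [fun _ => _]funext do rewrite -sumrB.
apply: orth_sum => // k; under [fun _ => _]funext do rewrite -sumrB.
apply: orth_sum => // j; under [fun _ => _]funext do rewrite -mulrBr.
have kH := ltn_ord k.
have aT := sp_time_range sH (ltnW kH).
have bT := sp_time_range sH kH; have ab := sp_time_mono sH kH.
have va := @sp_adapted _ _ _ _ _ _ _ sH k j kH.
have vb := val_bdd j kH.
move: aT bT ab va; set a := sp_time H k; set b := sp_time H k.+1 => aT bT ab va.
have [a0 aT'] := andP aT; have [b0 bT'] := andP bT.
have [ta|at_] := lerP t a.
  have e w : sp_val H k j w * (W j t w - W j t w - (W j (Num.min b s) w - W j (Num.min a s) w)) = 0.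
    by rewrite !min_r ?subrr ?subr0 ?mulr0//; lra.
  rewrite min_r; last by lra.
  by under [fun _ => _]funext do rewrite e; exact: orth0.
have [sa|as_] := lerP s a.
  rewrite !(min_r (y := s)); try lra.
  under [fun _ => _]funext do rewrite subrr subr0.
  have sub : F s `<=` F a by apply: (uc_nondecreasing F_usual).
  apply: (orth_sub sub); apply: orth_scale => //.
  - exact: (uc_sigma_algebra F_usual).
  - exact: (uc_measurable F_usual).
  - apply: brownian_increment_orth => //; rewrite ?minEle; case: ifPn => // *; lra.
have e w : W j (Num.min b t) w - W j a w - (W j (Num.min b s) w - W j a w) =
    W j (Num.min b t) w - W j (Num.min b s) w by ring.
under [fun _ => _]funext do rewrite e.
apply: orth_scale => //.
  apply: wrt_sub va => //; first exact: (uc_sigma_algebra F_usual).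
  by apply: (uc_nondecreasing F_usual) => //; lra.
have [bs|sb] := lerP b s.
  rewrite min_l; last by lra.
  by under [fun _ => _]funext do rewrite subrr; exact: orth0.
apply: brownian_increment_orth => //; rewrite ?minEle; case: ifPn => // *; lra.
Qed.

End SimpleIntegrals.

Variables (Z : 'I_n -> R -> Omega -> R) (M : R -> Omega -> R).
Hypothesis M_ito : is_ito_integral P T F W Z M.

Lemma ito_wrt t : 0 <= t <= T -> measurable_wrt (F t) (M t).
Proof. exact: (ito_adapted M_ito). Qed.

Lemma ito_meas t : 0 <= t <= T -> measurable_fun setT (M t).
Proof.
move=> tT; apply: (wrt_measurable (uc_sigma_algebra F_usual tT) (uc_measurable F_usual tT)).
exact: ito_wrt.
Qed.

(** Both properties pass to the limit from simple integrals S at fixed times: the mean of M_t - M_s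
    over [A] differs from that of S_t - S_s, which is 0, by two approximation errors. *)
Lemma ito_L2_orth : (forall t, 0 <= t <= T -> L2 P (M t)) /\
  (forall s t, 0 <= s -> s <= t -> t <= T -> orth P (F s) (fun w => M t w - M s w)).
Proof.
have [H [sH _ cH]] := ito_approx M_ito.
(* Convergence to 0 in the extended reals makes the integrals finite from some index on; this is
   where square integrability of the differences comes from. *)
have near t e : 0 <= t <= T -> 0 < e ->
  \forall m \near \oo, L2 P (fun w => sp_integral W (H m) t w - M t w) /\
    Ex P (fun w => (sp_integral W (H m) t w - M t w) ^+ 2) <= e.
  move=> tT e0; have /fine_cvgP[fin cv] := cH t tT.
  have cl : \forall m \near \oo, fine (\int[P]_w ((sp_integral W (H m) t w - M t w) ^+ 2)%:E)%E < e.
    by move/cvgr_lt : cv; apply.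
  near=> m.
  have mD : measurable_fun setT (fun w => sp_integral W (H m) t w - M t w).
    by apply: measurable_funB; [exact: (sp_integral_L2 (sH m) tT).1|exact: ito_meas].
  split; last by apply: ltW; near: m.
  split => //; apply/integrableP; split; first exact/measurable_EFinP/measurable_funX.
  under eq_integral do rewrite /= ger0_norm ?sqr_ge0//.
  rewrite -ge0_fin_numE; first by near: m.
  by apply: integral_ge0 => w _; rewrite lee_fin sqr_ge0.
have ML2 t : 0 <= t <= T -> L2 P (M t).
  move=> tT; have [m _ /(_ m (leqnn m)) [h _]] := near t 1 tT ltr01.
  have -> : M t = fun w => sp_integral W (H m) t w - (sp_integral W (H m) t w - M t w).
    by apply/funext => w; ring.
  by apply: L2B => //; exact: sp_integral_L2.
split => // s t s0 st tT.
have sT : 0 <= s <= T by apply/andP; split; lra.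
have tT' : 0 <= t <= T by apply/andP; split; lra.
have iM r : 0 <= r <= T -> intg P (M r) by move=> rT; apply: L2_intg; exact: ML2.
split; first by apply: intgB; exact: iM.
move=> A FA; have mA : measurable A := uc_measurable F_usual sT FA.
apply/eqP; rewrite -normr_le0; apply/ler_addgt0Pr => e e0; rewrite add0r.
(* [Ex_norm_le_sqr] doubles the tolerance and there are two errors, so their sum is at most e /
   2. *)
have e80 : 0 < e / 8 by rewrite divr_gt0.
have e2 : 0 < (e / 8) ^+ 2 by rewrite exprn_gt0.
have [m [[h1 h2] [h3 h4]]] : exists m,
  (L2 P (fun w => sp_integral W (H m) s w - M s w) /\
    Ex P (fun w => (sp_integral W (H m) s w - M s w) ^+ 2) <= (e / 8) ^+ 2) /\
  (L2 P (fun w => sp_integral W (H m) t w - M t w) /\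
    Ex P (fun w => (sp_integral W (H m) t w - M t w) ^+ 2) <= (e / 8) ^+ 2).
  have [m _ /(_ m (leqnn m)) h] := filterI (near s _ sT e2) (near t _ tT' e2).
  by exists m.
have [_ oS] := sp_integral_orth (sH m) s0 st tT.
have iS r : 0 <= r <= T -> intg P (sp_integral W (H m) r).
  by move=> rT; apply: L2_intg; exact: sp_integral_L2.
have bA := bdd_indic P mA.
have E1 := Ex_norm_le_sqr h1 e80 h2; have E2 := Ex_norm_le_sqr h3 e80 h4.
move: (oS _ FA); rewrite !Rint_indic// => S0.
have -> : Ex P (fun w => \1_A w * (M t w - M s w)) =
  Ex P (fun w => \1_A w * (sp_integral W (H m) s w - M s w)) -
  Ex P (fun w => \1_A w * (sp_integral W (H m) t w - M t w)).
  rewrite -[RHS]addr0 -S0 -ExB; [|apply: intg_bddM => //; exact: L2_intg..].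
  rewrite -ExD.
  - by congr Ex; apply/funext => w; ring.
  - by apply: intgB; apply: intg_bddM => //; exact: L2_intg.
  - by apply: intg_bddM => //; apply: intgB; exact: iS.
have nb X : L2 P X -> `|Ex P (fun w => \1_A w * X w)| <= Ex P (fun w => `|X w|).
  move=> lX; apply: le_trans (Ex_le_norm _) _.
    by apply: intg_bddM => //; exact: L2_intg.
  apply: Ex_le_ae.
  - by apply: intg_norm; apply: intg_bddM => //; exact: L2_intg.
  - by apply: intg_norm; exact: L2_intg.
  - apply: aeW => w; rewrite normrM indicE; case: (_ \in _); rewrite ?normr1 ?normr0 ?mul1r//.
    by rewrite mul0r.
have := ler_normB (Ex P (fun w => \1_A w * (sp_integral W (H m) s w - M s w)))
  (Ex P (fun w => \1_A w * (sp_integral W (H m) t w - M t w))).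
have := nb _ h1; have := nb _ h3; lra.
Unshelve. all: by end_near.
Qed.

End ItoMartingale.

(** * Path regularity and Riemann sums *)

Section Paths.
Context {R : realType}.
Notation mu := (@lebesgue_measure R).
Implicit Types (x g beta : R -> R) (a b c C : R).

Definition ucont a b x : Prop := forall e : R, 0 < e -> exists2 dl : R, 0 < dl &
  forall s t, a <= s <= b -> a <= t <= b -> `|s - t| < dl -> `|x s - x t| < e.

Lemma heine a b x : {within `[a, b], continuous x} -> ucont a b x.
Proof.
move=> /subspace_continuousP cx e e0.
have /compact_near_coveringP/near_covering_withinP cov := @segment_compact R a b.
pose Q (dl t : R) := forall s, a <= s <= b -> `|s - t| < dl -> `|x s - x t| < e.
have : \forall dl \near (0 : R)^'+, `[a, b]%classic `<=` Q dl.
  apply: cov => t0 ht0.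
  have := cx t0 ht0; move=> /cvgrPdist_lt/(_ (e / 2)).
  rewrite divr_gt0// => /(_ isT)/nbhs_ballP[r /= r0 h].
  have h' s : a <= s <= b -> `|t0 - s| < r -> `|x t0 - x s| < e / 2.
    by move=> sab d; apply: h => //=; rewrite in_itv.
  exists (ball t0 (r / 2), [set dl | 0 < dl < r / 2]).
    split; first by apply: nbhsx_ballx; rewrite divr_gt0.
    have r2 : 0 < r / 2 by rewrite divr_gt0.
    have H1 : \forall dl \near (0 : R)^'+, dl < r / 2 by exact: nbhs_right_lt.
    have H2 : \forall dl \near (0 : R)^'+, 0 < dl by exact: nbhs_right_gt.
    by apply: filterS2 H1 H2 => dl h1 h2; apply/andP.
  move=> [t dl] /= [+ /andP[dl0 dlr]]; rewrite /ball /= => tt0 tab s sab st.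
  have t1 : `|t0 - t| < r by lra.
  have s1 : `|t0 - s| < r.
    have := ler_distD t t0 s; rewrite (distrC t s); lra.
  have := h' s sab s1; have := h' t tab t1.
  have := ler_distD (x t0) (x s) (x t); rewrite (distrC (x s) (x t0)); lra.
move=> /nbhs_ballP[r /= r0 h].
exists (r / 2); first by rewrite divr_gt0.
move=> s t sab tab st; apply: (h (r / 2)) => //=.
- by rewrite /ball /= sub0r normrN gtr0_norm; [lra|rewrite divr_gt0].
- by rewrite divr_gt0.
Qed.

Lemma ucontD a b x g : ucont a b x -> ucont a b g -> ucont a b (fun t => x t + g t).
Proof.
move=> cx cg e e0; have e2 : 0 < e / 2 by rewrite divr_gt0.
have [d1 d10 h1] := cx _ e2; have [d2 d20 h2] := cg _ e2.
exists (Num.min d1 d2); first by rewrite lt_min d10.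
move=> s t sab tab; rewrite lt_min => /andP[st1 st2].
have := h1 s t sab tab st1; have := h2 s t sab tab st2.
have := ler_normD (x s - x t) (g s - g t).
rewrite (_ : x s - x t + (g s - g t) = x s + g s - (x t + g t)); [lra|ring].
Qed.

Lemma ucont_lipschitz a b x C :
  (forall s t, a <= s <= b -> a <= t <= b -> `|x s - x t| <= C * `|s - t|) ->
  ucont a b x.
Proof.
move=> h e e0; pose D := `|C| + 1.
have D0 : 0 < D by rewrite ltr_wpDl.
exists (e / D); first by rewrite divr_gt0.
move=> s t sab tab; rewrite ltr_pdivlMr// => st.
apply: le_lt_trans (h s t sab tab) _.
apply: le_lt_trans st; rewrite mulrC ler_wpM2l//.
by rewrite /D (le_trans (ler_norm C))// lerDl.
Qed.

Lemma ucont_comp a b x g c C : ucont c C g -> (forall s, a <= s <= b -> c <= x s <= C) ->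
  ucont a b x -> ucont a b (g \o x).
Proof.
move=> cg hx cx e e0; have [d1 d10 h1] := cg _ e0; have [d2 d20 h2] := cx _ d10.
by exists d2 => // s t sab tab st; apply: h1; [exact: hx|exact: hx|exact: h2].
Qed.

Lemma ucont_within a b x : ucont a b x -> {within `[a, b], continuous x}.
Proof.
move=> ux; apply/subspace_continuousP => t tab; apply/cvgrPdist_lt => e e0.
have [dl dl0 h] := ux _ e0.
apply/nbhs_ballP; exists dl => //= s st sab.
by apply: h; rewrite -?in_itv.
Qed.

Lemma ucont_meas a b x : ucont a b x -> measurable_fun `[a, b] x.
Proof.
by move=> /ucont_within h; apply: subspace_continuous_measurable_fun.
Qed.

(** Around each time the right limit, the left limit and the value itself give a local bound;
    compactness of the interval makes it global. *)
Lemma cadlag_bounded T x : cadlag_path T x ->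
  exists C, forall t, 0 <= t <= T -> `|x t| <= C.
Proof.
move=> [xr xl].
have /compact_near_coveringP/near_covering_withinP cov := @segment_compact R 0 T.
have : \forall C \near +oo, `[0, T]%classic `<=` (fun t => `|x t| <= C).
  apply: cov => t0; rewrite /= in_itv/= => ht0; have [t00 t0T] := andP ht0.
  have [r1 r10 [C1 h1]] : exists2 r : R, 0 < r & exists C, forall s, s <= T -> t0 < s < t0 + r -> `|x s| <= C.
    have [tT|tT] := ltrP t0 T; last first.
      by exists 1 => //; exists 0 => s sT /andP[]; lra.
    have ht : 0 <= t0 < T by rewrite t00.
    have := xr _ ht => /cvgrPdist_lt/(_ 1 ltr01)/nbhs_ballP[r /= r0 h].
    exists r => //; exists (`|x t0| + 1) => s sT /andP[s1 s2].
    have := h s; rewrite /ball /= ltr_norml => /(_ _ s1) h'.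
    have : `|x t0 - x s| < 1 by apply: h'; apply/andP; split; lra.
    have := ler_distD (x t0) (x s) 0; rewrite !subr0 distrC; lra.
  have [r2 r20 [C2 h2]] : exists2 r : R, 0 < r & exists C, forall s, 0 <= s -> t0 - r < s < t0 -> `|x s| <= C.
    have [tT|tT] := ltrP 0 t0; last first.
      by exists 1 => //; exists 0 => s sT /andP[]; lra.
    have ht : 0 < t0 <= T by rewrite tT.
    have /cvg_ex[l] := xl _ ht => /cvgrPdist_lt/(_ 1 ltr01)/nbhs_ballP[r /= r0 h].
    exists r => //; exists (`|l| + 1) => s sT /andP[s1 s2].
    have := h s; rewrite /ball /= ltr_norml => /(_ _ s2) h'.
    have : `|l - x s| < 1 by apply: h'; apply/andP; split; lra.
    have := ler_distD l (x s) 0; rewrite !subr0 distrC; lra.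
  exists (ball t0 (Num.min r1 r2), [set C | `|C1| + `|C2| + `|x t0| < C]).
    split; first by apply: nbhsx_ballx; rewrite lt_min r10.
    exact: nbhs_pinfty_gt.
  move=> [t C] /= []; rewrite /ball /= lt_min !ltr_norml in_itv/= => + hC tT.
  move=> /andP[/andP[u1 u2] /andP[u3 u4]]; have [tT1 tT2] := andP tT.
  have := normr_ge0 C1; have := normr_ge0 C2; have := normr_ge0 (x t0).
  have := ler_norm C1; have := ler_norm C2.
  have [tt0|tt0|<-] := ltrgtP t0 t; last by lra.
    have : `|x t| <= C1 by apply: h1 => //; apply/andP; split; lra.
    lra.
  have : `|x t| <= C2 by apply: h2 => //; apply/andP; split; lra.
  lra.
move=> [C [_ h]]; exists (C + 1) => t tT.
by apply: h; [lra|rewrite /= in_itv].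
Qed.

Definition pt a b (m j : nat) : R := a + j%:R * ((b - a) / m%:R).

Lemma pt0 a b m : pt a b m 0 = a.
Proof. by rewrite /pt mul0r addr0. Qed.

Lemma ptn a b m : (0 < m)%N -> pt a b m m = b.
Proof.
move=> m0; have h : (m%:R : R) != 0 by rewrite pnatr_eq0 -lt0n.
by rewrite /pt mulrC divfK// addrC subrK.
Qed.

Lemma ptS a b m j : pt a b m j.+1 = pt a b m j + (b - a) / m%:R.
Proof. by rewrite /pt -natr1 mulrDl mul1r addrA. Qed.

Lemma pt_le a b m i j : a <= b -> (i <= j)%N -> pt a b m i <= pt a b m j.
Proof.
move=> ab ij; rewrite lerD2l ler_wpM2r ?ler_nat//.
by rewrite divr_ge0// subr_ge0.
Qed.

Lemma pt_range a b m j : a <= b -> (j <= m)%N -> a <= pt a b m j <= b.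
Proof.
case: m => [|m] ab jm.
  by move: jm; rewrite leqn0 => /eqP ->; rewrite pt0 lexx.
rewrite -{1}(pt0 a b m.+1) pt_le//=.
by rewrite -{2}(@ptn a b m.+1 isT) pt_le.
Qed.

Lemma pt_find a b m s : a < b -> (0 < m)%N -> a <= s < b ->
  exists2 k, (k < m)%N & pt a b m k <= s < pt a b m k.+1.
Proof.
move=> ab m0 /andP[as_ sb].
have ex : exists k, s < pt a b m k by exists m; rewrite ptn.
have := find_ex_minn ex => -[k hk mink].
case: k hk mink => [|k] hk mink; first by move: hk; rewrite pt0; lra.
exists k.
  by rewrite -ltnS ltnS; apply: mink; rewrite ptn.
by rewrite hk andbT leNgt; apply/negP => /mink; rewrite ltnn.
Qed.

Lemma step_sum a b m k s (cf : nat -> R) : a <= b -> (k < m)%N ->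
  pt a b m k <= s < pt a b m k.+1 ->
  \sum_(j < m) cf j * \1_`[pt a b m j, pt a b m j.+1[ s = cf k.
Proof.
move=> ab km /andP[ks sk].
rewrite (bigD1 (Ordinal km))//= big1 ?addr0; last first.
  move=> j jk; rewrite indicE memNset ?mulr0//= in_itv/= => /andP[js sj].
  have [jlt|jgt|e] := ltngtP j k.
  - by have := @pt_le a b m _ _ ab jlt; lra.
  - by have := @pt_le a b m _ _ ab jgt; lra.
  - by move/negP: jk; apply; apply/eqP/val_inj.
by rewrite indicE mem_set ?mulr1//= in_itv/= ks.
Qed.

Lemma mesh_small (a b e : R) : 0 < e -> \forall m \near \oo, (b - a) / m%:R < e.
Proof.
move=> e0; near=> m.
have m0 : (0 : R) < m%:R by rewrite ltr0n; near: m; exact: nbhs_infty_gt.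
rewrite ltr_pdivrMr// mulrC -ltr_pdivrMr//.
by near: m; exact: nbhs_infty_gtr.
Unshelve. all: by end_near. Qed.

Lemma cadlag_measurable T x : 0 < T -> cadlag_path T x -> measurable_fun `[0, T] x.
Proof.
move=> T0 [xr _].
rewrite -[X in measurable_fun X](@setDUK _ `[0, T[%classic `[0, T]%classic); last first.
  by apply: subset_itvl; rewrite bnd_simp.
apply/measurable_funU => //; first exact: measurableD.
split; last first.
  apply: (@measurable_funS _ _ _ _ [set T]) => //; last exact: measurable_fun_set1.
  move=> t []/=; rewrite !in_itv/= => /andP[t0 tT]; rewrite t0/= => /negP.
  by rewrite -leNgt => h; apply/eqP; rewrite eq_le tT h.
(* On each cell the step function takes the value at the right end point, which lies to the right of
   [s]; right continuity then gives pointwise convergence. The terminal time has been split off as a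
   singleton. *)
pose h (m : nat) (s : R) : R :=
  \sum_(j < m.+1) x (pt 0 T m.+1 j.+1) * \1_`[pt 0 T m.+1 j, pt 0 T m.+1 j.+1[ s.
apply: (@measurable_fun_cvg _ _ _ _ h) => //.
- move=> m; apply: measurable_funTS; apply: measurable_sum => j.
  by apply: measurable_funM => //; apply: measurable_indic.
- move=> s; rewrite /= in_itv/= => /andP[s0 sT].
  have hs : 0 <= s < T by rewrite s0.
  apply/cvgrPdist_lt => e e0.
  have := xr _ hs => /cvgrPdist_lt/(_ e e0)/nbhs_ballP[r /= r0 hr].
  have [k0 _ hk0] := @mesh_small 0 T r r0; exists k0 => // m /= mk0.
  have hm := hk0 m.+1 (leqW mk0).
  have [k km ks] := @pt_find 0 T m.+1 s T0 isT hs.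
  rewrite /h (@step_sum 0 T m.+1 k s (fun j => x (pt 0 T m.+1 j.+1)) (ltW T0) km ks).
  have [k1 k2] := andP ks; apply: hr => //.
  have gen (u v q : R) : u <= v -> v < u + q -> q < r -> `|v - (u + q)| < r.
    by move=> uv vq qr; rewrite ltr_norml; apply/andP; split; lra.
  by move: k2; rewrite /ball /= ptS => k2; exact: gen.
Qed.

Definition itg a b g : R := \int[mu]_(t in `[a, b]) g t.

Lemma itg_integrable a b g C : measurable_fun `[a, b] g ->
  (forall t, a <= t <= b -> `|g t| <= C) -> mu.-integrable `[a, b] (EFin \o g).
Proof.
move=> mg gC; apply: measurable_bounded_integrable => //.
  by rewrite /= lebesgue_measure_itv/=; case: ifP => // _; rewrite -EFinD ltry.
exists C; split; first exact: num_real.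
move=> y Cy t /=; rewrite in_itv/= => tab; exact: le_trans (gC _ tab) (ltW Cy).
Qed.

Lemma itg_chasles a b c g : mu.-integrable `[a, c] (EFin \o g) -> a <= b <= c ->
  itg a c g = itg a b g + itg b c g.
Proof.
move=> ig /andP[ab bc].
have := @Rintegral_itvB R g (BLeft a) (BRight c) b ig.
rewrite !bnd_simp => /(_ ab bc) h.
have ibc : mu.-integrable `]b, c] (EFin \o g).
  by apply: integrableS ig => //; apply: subset_itvr; rewrite bnd_simp.
by rewrite /itg -(Rintegral_itv_obnd_cbnd ibc) -h addrC subrK.
Qed.

Lemma itg_sub a b c e g : mu.-integrable `[a, b] (EFin \o g) -> a <= c -> e <= b ->
  mu.-integrable `[c, e] (EFin \o g).
Proof.
move=> ig ac eb; apply: integrableS ig => //.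
by apply: subset_itv; rewrite bnd_simp.
Qed.

Lemma itg_sum a b g m : (0 < m)%N -> a <= b -> mu.-integrable `[a, b] (EFin \o g) ->
  itg a b g = \sum_(j < m) itg (pt a b m j) (pt a b m j.+1) g.
Proof.
move=> m0 ab ig.
suff H k : (k <= m)%N -> itg a (pt a b m k) g =
    \sum_(j < k) itg (pt a b m j) (pt a b m j.+1) g.
  by rewrite -H// ptn.
elim: k => [|k IH] km.
  by rewrite big_ord0 pt0 /itg set_itv1 Rintegral_set1.
rewrite big_ord_recr/= -IH; last exact: ltnW.
have /andP[r1 r2] := @pt_range a b m k.+1 ab km.
apply: itg_chasles; first exact: itg_sub ig _ _.
by rewrite (pt_le _ _ _)//; have /andP[-> _] := @pt_range a b m k ab (ltnW km).
Qed.

Lemma itg_cst a b c : a <= b -> itg a b (fun=> c) = c * (b - a).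
Proof.
move=> ab; rewrite /itg Rintegral_cst//= lebesgue_measure_itv/= lte_fin.
case: ltrP => [_|ba]; first by rewrite -EFinD.
by rewrite (_ : b - a = 0)//=; lra.
Qed.

Lemma itg_le a b g beta : mu.-integrable `[a, b] (EFin \o g) ->
  mu.-integrable `[a, b] (EFin \o beta) ->
  (forall t, a <= t <= b -> g t <= beta t) -> itg a b g <= itg a b beta.
Proof.
by move=> ig ib h; apply: le_Rintegral.
Qed.

Lemma eq_itg a b g beta :
  (forall t, a <= t <= b -> g t = beta t) -> itg a b g = itg a b beta.
Proof. by move=> h; apply: eq_Rintegral => t; rewrite inE/= in_itv; exact: h. Qed.

Lemma itg_cst_integrable a b c : mu.-integrable `[a, b] (EFin \o (fun=> c)).
Proof. by apply: (@itg_integrable _ _ _ `|c|). Qed.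

Lemma itg_norm_le a b g C : a <= b -> mu.-integrable `[a, b] (EFin \o g) ->
  (forall t, a <= t <= b -> `|g t| <= C) -> `|itg a b g| <= C * (b - a).
Proof.
move=> ab ig gC; apply: le_trans (le_normr_Rintegral _ ig) _ => //.
rewrite -itg_cst//; apply: itg_le => //; first exact: integrable_norm.
exact: itg_cst_integrable.
Qed.

Lemma itgD a b g beta : mu.-integrable `[a, b] (EFin \o g) ->
  mu.-integrable `[a, b] (EFin \o beta) ->
  itg a b (fun t => g t + beta t) = itg a b g + itg a b beta.
Proof. by move=> ig ib; rewrite /itg RintegralD. Qed.

Lemma itgB a b g beta : mu.-integrable `[a, b] (EFin \o g) ->
  mu.-integrable `[a, b] (EFin \o beta) ->
  itg a b (fun t => g t - beta t) = itg a b g - itg a b beta.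
Proof. by move=> ig ib; rewrite /itg RintegralB. Qed.

Lemma itgZ a b c g : mu.-integrable `[a, b] (EFin \o g) ->
  itg a b (fun t => c * g t) = c * itg a b g.
Proof. by move=> ig; rewrite /itg RintegralZl. Qed.

Lemma itg_ucont a b g C : measurable_fun `[a, b] g ->
  (forall t, a <= t <= b -> `|g t| <= C) -> ucont a b (fun t => itg a t g).
Proof.
move=> mg gC; have ig := itg_integrable mg gC.
have H s t : a <= s -> s <= t -> t <= b -> `|itg a s g - itg a t g| <= C * `|s - t|.
  move=> as_ st tb; rewrite distrC (distrC s) (@ger0_norm _ (t - s)) ?subr_ge0//.
  rewrite (@itg_chasles a s t); [|exact: itg_sub ig _ _|by rewrite as_].
  rewrite addrAC subrr add0r; apply: itg_norm_le => //.
    exact: itg_sub ig _ _.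
  by move=> r /andP[r1 r2]; apply: gC; apply/andP; split; lra.
apply: (@ucont_lipschitz _ _ _ C) => s t /andP[s1 s2] /andP[t1 t2].
have [st|st] := orP (le_total s t); first exact: H.
by rewrite distrC (distrC s); apply: H.
Qed.

Lemma ucont_bounded a b g : ucont a b g -> exists C, forall t, a <= t <= b -> `|g t| <= C.
Proof.
move=> /ucont_within cg.
have := @continuous_compact _ _ g `[a, b]%classic cg (@segment_compact R a b).
move=> /compact_bounded[C [_ h]]; exists (C + 1) => t tab.
by apply: (h (C + 1)); [lra|exists t => //; rewrite /= in_itv].
Qed.

Lemma itgM_integrable a b g beta C : ucont a b g -> measurable_fun `[a, b] beta ->
  (forall t, a <= t <= b -> `|beta t| <= C) ->
  mu.-integrable `[a, b] (EFin \o (fun t => g t * beta t)).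
Proof.
move=> ug mb bC; have [D hD] := ucont_bounded ug.
apply: (@itg_integrable _ _ _ (D * C)).
  by apply: measurable_funM => //; exact: ucont_meas.
by move=> t tab; rewrite normrM ler_pM//; [exact: hD|exact: bC].
Qed.

(** On a fine partition [g] varies by at most e / D inside a cell, and [beta] is at most [C]. Only
    [g] is sampled, because the drift is merely measurable in time; the [+ 1] in [D] keeps the
    divisor positive. *)
Lemma riemann_cvg a b g beta C : a <= b -> ucont a b g -> measurable_fun `[a, b] beta ->
  (forall t, a <= t <= b -> `|beta t| <= C) ->
  \sum_(j < m) g (pt a b m j) * itg (pt a b m j) (pt a b m j.+1) beta @[m --> \oo]
    --> itg a b (fun t => g t * beta t).
Proof.
move=> ab ug mb bC; apply/cvgrPdist_le => e e0.
have C0 : 0 <= C by apply: le_trans (bC a _); rewrite ?lexx.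
pose D := C * (b - a) + 1.
have D0 : 0 < D by rewrite ltr_wpDl// mulr_ge0// subr_ge0.
have eD : 0 < e / D by rewrite divr_gt0.
have [dl dl0 h] := ug _ eD.
have ib := itg_integrable mb bC.
have igb := itgM_integrable ug mb bC.
near=> m.
have m0 : (0 < m)%N by near: m; exact: nbhs_infty_gt.
have hm : (b - a) / m%:R < dl by near: m; exact: mesh_small.
rewrite (itg_sum m0 ab igb) -sumrB.
apply: le_trans (ler_norm_sum _ _ _) _.
apply: (@le_trans _ _ (\sum_(j < m) (e / D * C) * (pt a b m j.+1 - pt a b m j))).
  apply: ler_sum => j _.
  have jm := ltn_ord j.
  have /andP[p1 p2] := @pt_range a b m j ab (ltnW jm).
  have /andP[q1 q2] := @pt_range a b m j.+1 ab jm.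
  have pq := @pt_le a b m j j.+1 ab (leqnSn j).
  have ib' := itg_sub ib p1 q2; have igb' := itg_sub igb p1 q2.
  rewrite -itgZ// -itgB//; last first.
    by apply: eq_integrable (integrableZl _ (g (pt a b m j)) ib').
  apply: itg_norm_le => //.
    apply: eq_integrable (integrableB _ igb' _) => //; last first.
      exact: (integrableZl _ (g (pt a b m j)) ib').
    by [].
  move=> t /andP[t1 t2]; rewrite -mulrBl normrM ler_pM//.
    apply/ltW/h; rewrite ?p1//; first by apply/andP; split; lra.
    by move: t2; rewrite ptS => t2; rewrite ger0_norm; lra.
  by apply: bC; apply/andP; split; lra.
rewrite -mulr_sumr -(big_mkord xpredT (fun j => pt a b m j.+1 - pt a b m j)).
rewrite telescope_sumr// ptn// pt0 -mulrA.
rewrite mulrAC ler_pdivrMr// ler_wpM2l ?(ltW e0)// /D; lra.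
Unshelve. all: by end_near. Qed.

Lemma riemann_sum_cvg a b g : a <= b -> ucont a b g ->
  \sum_(j < m) g (pt a b m j) * ((b - a) / m%:R) @[m --> \oo] --> itg a b g.
Proof.
move=> ab ug.
have := @riemann_cvg a b g (fun=> 1) 1 ab ug (measurable_cst _) _.
rewrite (_ : itg a b (fun t => g t * 1) = itg a b g); last first.
  by apply: eq_itg => t _; rewrite mulr1.
move=> h; apply: cvg_trans (h _); last by move=> t _; rewrite normr1.
apply: near_eq_cvg; near=> m; apply: eq_bigr => j _; congr (_ * _).
by rewrite itg_cst ?mul1r ?ptS; [ring|rewrite lerDl divr_ge0// subr_ge0].
Unshelve. all: by end_near. Qed.

End Paths.

(** * Taylor expansion of the driver *)

Section OneSidedDerivative.
Context {R : realType}.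
Implicit Types (g f : R -> R) (x y L : R).
Let A : set R := `[0, +oo[%classic.

(** Differentiability relative to the half-line in epsilon form: two-sided at interior points,
    one-sided at 0. *)
Definition quot_near g x L : Prop := forall e : R, 0 < e -> exists2 r : R, 0 < r &
  forall y, 0 <= y -> y != x -> `|y - x| < r -> `|(g y - g x) / (y - x) - L| < e.

Lemma derivable_in_quot g x : derivable_in A g x -> quot_near g x (derive_in A g x).
Proof.
move=> dg e e0; move: dg; rewrite /derivable_in.
move=> /cvgrPdist_lt/(_ e e0)/nbhs_ballP[r /= r0 h].
exists r => // y y0 yx yr.
rewrite distrC; apply: (h y) => //=; last by rewrite /A /= in_itv/= andbT.
by rewrite /ball /= distrC.
Qed.

Lemma quot_derive g x L : 0 < x -> quot_near g x L -> is_derive x 1 g L.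
Proof.
move=> x0 hq.
have cv : h^-1 *: ((g \o shift x) (h *: (1 : R)) - g x) @[h --> (0 : R)^'] --> L.
  apply/cvgrPdist_lt => e e0; have [r r0 hr] := hq _ e0.
  apply/nbhs_ballP; exists (Num.min r x); first by rewrite /= lt_min r0.
  move=> h; rewrite /ball /= sub0r normrN lt_min => /andP[hr' hx] h0.
  rewrite /shift /= [h *: 1]mulr1.
  have := hr (h + x); rewrite addrK distrC mulrC; apply => //.
    by move: hx; rewrite ltr_norml => /andP[]; lra.
  by rewrite -subr_eq0 addrK.
apply: DeriveDef; first by apply/cvg_ex; exists L.
exact/cvg_lim.
Qed.

Lemma quot_continuous g x L : quot_near g x L -> forall e : R, 0 < e ->
  exists2 r : R, 0 < r & forall y, 0 <= y -> `|y - x| < r -> `|g y - g x| < e.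
Proof.
move=> hq e e0; have [r r0 hr] := hq 1 ltr01.
pose D := `|L| + 1; have D0 : 0 < D by rewrite ltr_wpDl.
exists (Num.min r (e / D)); first by rewrite lt_min r0 divr_gt0.
move=> y y0; rewrite lt_min => /andP[y1 y2].
have [->|yx] := eqVneq y x; first by rewrite subrr normr0.
have yx0 : y - x != 0 by rewrite subr_eq0.
have h := hr y y0 yx y1.
rewrite -[g y - g x](divfK yx0) normrM.
have q : `|(g y - g x) / (y - x)| <= D.
  by have := ler_distD L ((g y - g x) / (y - x)) 0; rewrite !subr0 /D; lra.
move: y2; rewrite ltr_pdivlMr// mulrC => y2.
by apply: le_lt_trans y2; rewrite ler_wpM2r.
Qed.

Lemma quotD g1 g2 x L1 L2 : quot_near g1 x L1 -> quot_near g2 x L2 ->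
  quot_near (fun y => g1 y + g2 y) x (L1 + L2).
Proof.
move=> h1 h2 e e0; have e2 : 0 < e / 2 by rewrite divr_gt0.
have [r1 r10 q1] := h1 _ e2; have [r2 r20 q2] := h2 _ e2.
exists (Num.min r1 r2); first by rewrite lt_min r10.
move=> y y0 yx; rewrite lt_min => /andP[y1 y2].
have := q1 y y0 yx y1; have := q2 y y0 yx y2.
have := ler_normD ((g1 y - g1 x) / (y - x) - L1) ((g2 y - g2 x) / (y - x) - L2).
rewrite [X in `|X| <= _](_ : _ = (g1 y + g2 y - (g1 x + g2 x)) / (y - x) - (L1 + L2));
  [lra|ring].
Qed.

Lemma quot_parabola a b c x :
  quot_near (fun y => b * y + a * (y - c) ^+ 2) x (b + 2 * a * (x - c)).
Proof.
move=> e e0; pose D := `|a| + 1; have D0 : 0 < D by rewrite ltr_wpDl.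
exists (e / D); first by rewrite divr_gt0.
move=> y y0 yx; rewrite ltr_pdivlMr// mulrC => yr.
have yx0 : y - x != 0 by rewrite subr_eq0.
rewrite [X in `|X|](_ : _ = a * (y - x)); last by field.
by rewrite normrM; apply: le_lt_trans yr; rewrite ler_wpM2r// lerDl.
Qed.

(** Interior points of the segment are positive, so there the relative derivative is an ordinary
    one; at the end points, possibly 0, continuity is enough. *)
Lemma quot_mvt g (dg : R -> R) u v : 0 <= u -> u < v ->
  (forall x, u <= x <= v -> quot_near g x (dg x)) ->
  exists2 c, u < c < v & g v - g u = dg c * (v - u).
Proof.
move=> u0 uv hg.
have [||c cuv e] := @MVT R g dg u v uv.
- move=> x; rewrite in_itv/= => /andP[ux xv]; apply: quot_derive; first by lra.
  by apply: hg; apply/andP; split; lra.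
- apply/subspace_continuousP => x; rewrite /= in_itv/= => xuv.
  apply/cvgrPdist_lt => e e0.
  have [r r0 hr] := quot_continuous (hg x xuv) e0.
  apply/nbhs_ballP; exists r => //= y yr; rewrite in_itv/= => /andP[uy yv].
  by rewrite distrC; apply: hr; [lra|rewrite distrC].
- by exists c => //; rewrite -in_itv.
Qed.

Section ConcaveC2.
Variable f : R -> R.
Hypothesis f_nonincreasing : {homo f : x y / x <= y >-> y <= x}.
Hypothesis f_concave : convex_function (`[0, +oo[%classic : set R) (fun x => - f x).
Hypothesis f_C2 : C2_on `[0, +oo[ f.
Variable K : R.
Hypothesis K_ge0 : 0 <= K.

Let f' := derive_in A f.
Let f'' := derive_in A f'.
Let L := sup [set `|f'' y| | y in `[0, K]].

Lemma quot_f x : 0 <= x -> quot_near f x (f' x).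
Proof.
move=> x0; apply: derivable_in_quot; case: f_C2 => h _ _; apply: h.
by rewrite /= in_itv/= x0.
Qed.

Lemma quot_f' x : 0 <= x -> quot_near f' x (f'' x).
Proof.
move=> x0; apply: derivable_in_quot; case: f_C2 => _ h _; apply: h.
by rewrite /= in_itv/= x0.
Qed.

(** A [sup] bounds its set only if the set is bounded; here continuity on the compact segment
    provides this. *)
Lemma f''_ubound : has_ubound [set `|f'' y| | y in `[0, K]].
Proof.
have c2 : {within `[0, K], continuous f''}.
  case: f_C2 => _ _; apply: continuous_subspaceW.
  by apply: subset_itvl; rewrite bnd_simp.
have [C hC] := ucont_bounded (heine c2).
by exists C => _ [y yK <-]; apply: hC; move: yK; rewrite /= in_itv.
Qed.

Lemma f''_le y : 0 <= y <= K -> `|f'' y| <= L.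
Proof.
by move=> yK; apply: (ub_le_sup f''_ubound); exists y => //; rewrite /= in_itv.
Qed.

Lemma L_ge0 : 0 <= L.
Proof. by apply: le_trans (normr_ge0 _) (f''_le (y := 0) _); rewrite lexx. Qed.

Lemma f'_lipschitz x y : 0 <= x -> x <= y -> y <= K ->
  `|f' y - f' x| <= L * (y - x).
Proof.
move=> x0; rewrite le_eqVlt => /predU1P[<-|xy] yK; first by rewrite !subrr normr0 mulr0.
have [|c /andP[xc cy] ->] := @quot_mvt f' f'' x y x0 xy.
  by move=> z /andP[xz zy]; apply: quot_f'; lra.
rewrite normrM (@ger0_norm _ (y - x)); last by lra.
by rewrite ler_wpM2r ?f''_le//; lra.
Qed.

Lemma f'_ucont : ucont 0 K f'.
Proof.
have H s t : 0 <= s -> s <= t -> t <= K -> `|f' s - f' t| <= L * `|s - t|.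
  move=> s0 st tK; rewrite distrC (distrC s) (@ger0_norm _ (t - s)) ?subr_ge0//.
  exact: f'_lipschitz.
apply: (@ucont_lipschitz _ _ _ _ L) => s t /andP[s0 sK] /andP[t0 tK].
have [st|st] := orP (le_total s t); first exact: H.
by rewrite distrC (distrC s); exact: H.
Qed.

Let taylor_quot s x z : 0 <= z ->
  quot_near (fun y => f y + (- f' x * y + s * (y - x) ^+ 2)) z
    (f' z + (- f' x + 2 * s * (z - x))).
Proof. by move=> z0; apply: quotD; [exact: quot_f|exact: quot_parabola]. Qed.

Let taylor_mvt s x u v : 0 <= u -> u < v -> exists2 c, u < c < v &
  f v + (- f' x * v + s * (v - x) ^+ 2) - (f u + (- f' x * u + s * (u - x) ^+ 2)) =
  (f' c + (- f' x + 2 * s * (c - x))) * (v - u).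
Proof.
move=> u0 uv; apply: (@quot_mvt (fun y => f y + (- f' x * y + s * (y - x) ^+ 2))
  (fun z => f' z + (- f' x + 2 * s * (z - x)))) => // z /andP[uz _].
by apply: taylor_quot; exact: le_trans uz.
Qed.

(** Adding (L/2)(y - x)^2 to, or subtracting it from, f(y) - f'(x) y gives a function whose
    derivative has a constant sign on either side of x, because f' is L-Lipschitz. The mean value
    theorem then yields the two halves of the bound. *)
Lemma f_taylor x y : 0 <= x <= K -> 0 <= y <= K ->
  `|f y - f x - f' x * (y - x)| <= L / 2 * (y - x) ^+ 2.
Proof.
move=> /andP[x0 xK] /andP[y0 yK]; rewrite ler_norml.
have [xy|yx|->] := ltrgtP x y; last first.
- by rewrite !subrr mulr0 expr0n/= mulr0 subr0 oppr0 lexx.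
- have lip c : y < c -> c < x -> - (L * (x - c)) <= f' x - f' c <= L * (x - c).
    by move=> yc cx; rewrite -ler_norml; apply: f'_lipschitz; lra.
  apply/andP; split.
  + have [c /andP[yc cx]] := taylor_mvt (L / 2) x y0 yx.
    rewrite subrr expr0n/= mulr0 addr0.
    have : 0 <= - (f' c + (- f' x + 2 * (L / 2) * (c - x))) * (x - y).
      by apply: mulr_ge0; have /andP[] := lip c yc cx; lra.
    by move=> h1 h2; lra.
  + have [c /andP[yc cx]] := taylor_mvt (- (L / 2)) x y0 yx.
    rewrite subrr expr0n/= mulr0 addr0.
    have : 0 <= (f' c + (- f' x + 2 * - (L / 2) * (c - x))) * (x - y).
      by apply: mulr_ge0; have /andP[] := lip c yc cx; lra.
    by move=> h1 h2; lra.
- have lip c : x < c -> c < y -> - (L * (c - x)) <= f' c - f' x <= L * (c - x).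
    by move=> yc cx; rewrite -ler_norml; apply: f'_lipschitz; lra.
  apply/andP; split.
  + have [c /andP[yc cx]] := taylor_mvt (L / 2) x x0 xy.
    rewrite subrr expr0n/= mulr0 addr0.
    have : 0 <= (f' c + (- f' x + 2 * (L / 2) * (c - x))) * (y - x).
      by apply: mulr_ge0; have /andP[] := lip c yc cx; lra.
    by move=> h1 h2; lra.
  + have [c /andP[yc cx]] := taylor_mvt (- (L / 2)) x x0 xy.
    rewrite subrr expr0n/= mulr0 addr0.
    have : 0 <= - (f' c + (- f' x + 2 * - (L / 2) * (c - x))) * (y - x).
      by apply: mulr_ge0; have /andP[] := lip c yc cx; lra.
    by move=> h1 h2; lra.
Qed.

(** Three-chord form of concavity: [v] is the convex combination of [u] and [w] with weight (w - v)
    / (w - u) on [u]. *)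
Lemma f_concave_slope u v w : 0 <= u -> u < v -> v < w ->
  (w - v) * f u + (v - u) * f w <= (w - u) * f v.
Proof.
move=> u0 uv vw.
have wu : 0 < w - u by lra.
pose t := (w - v) / (w - u).
have t0 : 0 <= t by rewrite divr_ge0; lra.
have t1 : t <= 1 by rewrite ler_pdivrMr//; lra.
have inA (z : R) : 0 <= z -> z \in (`[0, +oo[%classic : set R).
  by move=> z0; rewrite inE/= in_itv/= z0.
have w0 : 0 <= w by lra.
have := f_concave (Itv01 t0 t1) (inA u u0) (inA w w0).
rewrite !convRE /= /unstable.onem.
have e : conv (Itv01 t0 t1) (u : R^o) (w : R^o) = v.
  by rewrite convRE /= /unstable.onem /t; field; rewrite lt0r_neq0.
move=> hc; have {hc} : - f v <= t * - f u + (1 - t) * - f w by rewrite -e; exact: hc.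
have -> : t * - f u + (1 - t) * - f w = - (((w - v) * f u + (v - u) * f w) / (w - u)).
  by rewrite /t; field; rewrite lt0r_neq0.
by rewrite lerN2 ler_pdivrMr// [f v * _]mulrC.
Qed.

Lemma f'_le0 x : 0 <= x -> f' x <= 0.
Proof.
move=> x0; rewrite leNgt; apply/negP => fx.
have [r r0 hr] := quot_f x0 fx.
have r2 : 0 < r / 2 by rewrite divr_gt0.
have := hr (x + r / 2) _ _ _; rewrite (addrC x) addrK => h.
have : `|(f (r / 2 + x) - f x) / (r / 2) - f' x| < f' x.
  apply: h; [lra|by rewrite -subr_eq0 addrK lt0r_neq0|rewrite ger0_norm; lra].
have : (f (r / 2 + x) - f x) / (r / 2) <= 0.
  rewrite pmulr_lle0 ?invr_gt0// subr_le0; apply: f_nonincreasing; lra.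
by rewrite ltr_norml => h1 /andP[]; lra.
Qed.

(** The slope [s] of the chord from [x] to [K] separates the two derivatives: concavity puts it
    above the slopes near [K] and below those near [x]. Each half is by contradiction with a
    difference quotient close to the derivative. *)
Lemma f'_ge_K x : 0 <= x <= K -> f' K <= f' x.
Proof.
move=> /andP[x0]; rewrite le_eqVlt => /predU1P[->//|xK].
have xK0 : 0 < K - x by lra.
pose s := (f K - f x) / (K - x).
apply: (@le_trans _ _ s).
  rewrite leNgt; apply/negP => h; have e0 : 0 < f' K - s by lra.
  have [r r0 hr] := quot_f K_ge0 e0.
  pose q := Num.min (r / 2) ((K - x) / 2).
  have q0 : 0 < q by rewrite lt_min !divr_gt0.
  have qr : q <= r / 2 by rewrite ge_min lexx.
  have qK : q <= (K - x) / 2 by rewrite ge_min lexx orbT.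
  have := hr (K - q) _ _ _; rewrite (_ : K - q - K = - q); last by ring.
  move=> h'; have : `|(f (K - q) - f K) / - q - f' K| < f' K - s.
    apply: h'; [lra| |rewrite normrN ger0_norm; lra].
    by rewrite -subr_eq0 (_ : K - q - K = - q) ?oppr_eq0 ?lt0r_neq0//; ring.
  have := @f_concave_slope x (K - q) K x0 _ _.
  have -> : (f (K - q) - f K) / - q = (f K - f (K - q)) / q by field; rewrite lt0r_neq0.
  move=> h1; have : (f K - f (K - q)) / q <= s.
    rewrite ler_pdivrMr// /s mulrAC ler_pdivlMr//.
    by have := h1 _ _; lra.
  by rewrite ltr_norml => h2 /andP[]; lra.
rewrite leNgt; apply/negP => h; have e0 : 0 < s - f' x by lra.
have [r r0 hr] := quot_f x0 e0.
pose q := Num.min (r / 2) ((K - x) / 2).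
have q0 : 0 < q by rewrite lt_min !divr_gt0.
have qr : q <= r / 2 by rewrite ge_min lexx.
have qK : q <= (K - x) / 2 by rewrite ge_min lexx orbT.
have := hr (x + q) _ _ _; rewrite (_ : x + q - x = q); last by ring.
move=> h'; have : `|(f (x + q) - f x) / q - f' x| < s - f' x.
  apply: h'; [lra| |rewrite ger0_norm; lra].
  by rewrite -subr_eq0 (_ : x + q - x = q) ?lt0r_neq0//; ring.
have h1 := @f_concave_slope x (x + q) K x0 _ _.
have : s <= (f (x + q) - f x) / q.
  rewrite ler_pdivlMr// /s mulrAC ler_pdivrMr//.
  by have := h1 _ _; lra.
by rewrite ltr_norml => h2 /andP[]; lra.
Qed.

Lemma f'_norm_le x : 0 <= x <= K -> `|f' x| <= `|f' K|.
Proof.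
move=> xK; have /andP[x0 _] := xK.
rewrite !ler0_norm ?f'_le0// lerN2; exact: f'_ge_K.
Qed.

End ConcaveC2.
End OneSidedDerivative.

(** * Comparison *)

Section Huber.
Context {R : realType}.
Implicit Types u v : R.

(* A C^1 convex replacement of the positive part: since [huber] lies above its
   tangents, [huber' (X_s) * (X_t - X_s) <= huber (X_t) - huber (X_s)] takes the
   place of Tanaka's formula. *)
Definition huber u : R :=
  if u <= 0 then 0 else if u <= 1 then u ^+ 2 / 2 else u - 2^-1.

Definition huber' u : R := Num.min 1 (Num.max 0 u).

Lemma huber_ge0 u : 0 <= huber u.
Proof. by rewrite /huber; repeat case: ifPn; rewrite -?ltNge => *; nra. Qed.

Lemma huber_eq0 u : (huber u == 0) = (u <= 0).
Proof.
rewrite /huber; case: ifPn; first by rewrite eqxx.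
rewrite -ltNge => u0; apply/negbTE; case: ifPn; rewrite -?ltNge => h; rewrite lt0r_neq0//.
  by rewrite divr_gt0// exprn_gt0.
by lra.
Qed.

Lemma huber'_norm u : `|huber' u| <= 1.
Proof.
rewrite /huber' minEle maxEle ler_norml.
by repeat case: ifPn; rewrite -?ltNge => *; apply/andP; split; lra.
Qed.

Lemma huber'_ge0 u : 0 <= huber' u.
Proof. by rewrite /huber' le_min ler01 le_max lexx. Qed.

Lemma huber'_eq0 u : u <= 0 -> huber' u = 0.
Proof. by move=> u0; rewrite /huber' max_l// min_r. Qed.

Lemma huber_tangent u v : huber' u * (v - u) <= huber v - huber u.
Proof.
have [u0|u0] := lerP u 0.
  by rewrite huber'_eq0// mul0r {2}/huber u0 subr0 huber_ge0.
have h' : huber' u = if u <= 1 then u else 1.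
  by rewrite /huber' max_r ?(ltW u0)// minEle; case: (lerP u 1); case: (lerP 1 u) => *; lra.
have hu : huber u = if u <= 1 then u ^+ 2 / 2 else u - 2^-1 by rewrite /huber leNgt u0.
rewrite h' hu /huber.
have [u1|u1] := lerP u 1; have [v0|v0] := lerP v 0; first by nra.
- have [v1|v1] := lerP v 1; first by have := sqr_ge0 (v - u); lra.
  have : 0 <= (v - 1) * (1 - u) by rewrite mulr_ge0; lra.
  by have := sqr_ge0 (1 - u); lra.
- by lra.
- by have [v1|v1] := lerP v 1; have := sqr_ge0 (v - 1); lra.
Qed.

Lemma huber'_lip u v : `|huber' u - huber' v| <= `|u - v|.
Proof.
rewrite /huber' !minEle !maxEle ler_norml.
have := ler_norm (u - v); have := ler_norm (v - u); rewrite (distrC v).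
by repeat case: ifPn; rewrite -?ltNge => *; apply/andP; split; lra.
Qed.

Lemma measurable_huber' : measurable_fun setT huber'.
Proof. by apply: measurable_minr => //; apply: measurable_maxr. Qed.

Lemma measurable_huber : measurable_fun setT huber.
Proof.
apply: measurable_fun_ifT => //; first by apply: measurable_fun_ler.
apply: measurable_fun_ifT => //; first by apply: measurable_fun_ler.
- by apply: measurable_funM => //; exact: exprn_measurable.
- by apply: measurable_funB.
Qed.

End Huber.

Section Comparison.
Context {R : realType} {d : measure_display} {Omega : measurableType d}.
Variables (P : probability Omega R) (T : R) (F : R -> set (set Omega)).
Hypothesis F_usual : usual_conditions P T F.
Variables (X M beta : R -> Omega -> R).
Hypothesis X_wrt : forall t, 0 <= t <= T -> measurable_wrt (F t) (X t).
Hypothesis M_wrt : forall t, 0 <= t <= T -> measurable_wrt (F t) (M t).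
Hypothesis M_L2 : forall t, 0 <= t <= T -> L2 P (M t).
Hypothesis M_orth : forall s t, 0 <= s -> s <= t -> t <= T ->
  orth P (F s) (fun w => M t w - M s w).
Hypothesis X_path : \forall w \ae P,
  [/\ ucont 0 T (fun t => X t w),
      measurable_fun `[0, T] (fun t => beta t w),
      exists C, forall t, 0 <= t <= T -> `|beta t w| <= C &
      forall s t, 0 <= s -> s <= t -> t <= T ->
        X t w - X s w = - itg s t (fun r => beta r w) + (M t w - M s w)].
Hypothesis X_terminal : \forall w \ae P, X T w <= 0.
Hypothesis beta_sign : \forall w \ae P, forall t, 0 <= t <= T ->
  0 < X t w -> beta t w <= 0.

Let wrt_up s t (V : Omega -> R) : 0 <= s -> s <= t -> t <= T ->
  measurable_wrt (F s) V -> measurable_wrt (F t) V.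
Proof.
move=> s0 st tT; apply: wrt_sub.
- by apply: (uc_sigma_algebra F_usual); apply/andP; split; lra.
- by apply: (uc_sigma_algebra F_usual); apply/andP; split; lra.
- exact: (uc_nondecreasing F_usual).
Qed.

Let wrt_meas t (V : Omega -> R) : 0 <= t <= T -> measurable_wrt (F t) V -> measurable_fun setT V.
Proof.
move=> tT; apply: wrt_measurable.
- exact: (uc_sigma_algebra F_usual).
- exact: (uc_measurable F_usual).
Qed.

Section AtTime.
Variable t : R.
Hypothesis tT : 0 <= t <= T.

Let t_ge0 : 0 <= t. Proof. by case/andP: tT. Qed.
Let t_leT : t <= T. Proof. by case/andP: tT. Qed.
Let Tge0 : 0 <= T. Proof. exact: le_trans t_leT. Qed.

(** Martingale transform of [M] along the uniform partition of [t, T], with left end point weights: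
    a discrete stand-in for the stochastic integral of [huber' (X s)]. *)
Let S m k w : R := \sum_(j < k) huber' (X (pt t T m j) w) *
  (M (pt t T m j.+1) w - M (pt t T m j) w).

Let ptT m k : (k <= m)%N -> 0 <= pt t T m k <= T.
Proof. by move=> km; have /andP[h ->] := pt_range t_leT km; rewrite (le_trans t_ge0). Qed.

Let ptS_le m k : pt t T m k <= pt t T m k.+1.
Proof. exact: pt_le. Qed.

Let theta_wrt m k : (k <= m)%N -> measurable_wrt (F (pt t T m k)) (fun w => huber' (X (pt t T m k) w)).
Proof. by move=> km; exact: (measurableT_comp measurable_huber' (X_wrt (ptT km))). Qed.

Let theta_bdd m k : (k <= m)%N -> bdd P (fun w => huber' (X (pt t T m k) w)).
Proof.
move=> km; split; first exact: wrt_meas (ptT km) (theta_wrt km).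
by exists 1; apply: aeW => w; exact: huber'_norm.
Qed.

Let delta_L2 m k : (k < m)%N -> L2 P (fun w => M (pt t T m k.+1) w - M (pt t T m k) w).
Proof. by move=> km; apply: L2B; apply: M_L2; apply: ptT => //; exact: ltnW. Qed.

Let delta_orth m k : (k < m)%N ->
  orth P (F (pt t T m k)) (fun w => M (pt t T m k.+1) w - M (pt t T m k) w).
Proof.
move=> km; have /andP[p0 _] := ptT (ltnW km); have /andP[_ q1] := ptT km.
by apply: M_orth.
Qed.

Let S_wrt m k : (k <= m)%N -> measurable_wrt (F (pt t T m k)) (S m k).
Proof.
elim: k => [|k IH] km.
  by rewrite /S; under [fun _ => _]funext do rewrite big_ord0; exact: measurable_cst.
rewrite /S; under [fun _ => _]funext do rewrite big_ord_recr/=.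
have /andP[p0 p1] := ptT (ltnW km); have /andP[q0 q1] := ptT km.
have up V := @wrt_up _ _ V p0 (ptS_le m k) q1.
apply: measurable_funD; first by apply: up; apply: IH; exact: ltnW.
apply: measurable_funM; first by apply: up; apply: theta_wrt; exact: ltnW.
apply: measurable_funB; first exact: (M_wrt (ptT km)).
by apply: up; apply: M_wrt; apply: ptT; exact: ltnW.
Qed.

Let S_L2 m k : (k <= m)%N -> L2 P (S m k).
Proof.
elim: k => [|k IH] km; rewrite /S.
  by under [fun _ => _]funext do rewrite big_ord0; apply: bdd_L2; exact: bdd_cst.
under [fun _ => _]funext do rewrite big_ord_recr/=.
apply: L2D; first by apply: IH; exact: ltnW.
by apply: L2_bddM; [apply: theta_bdd; exact: ltnW|exact: delta_L2].
Qed.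

Let orth_cross m k V : (k < m)%N -> measurable_wrt (F (pt t T m k)) V -> L2 P V ->
  Ex P (fun w => V w * (M (pt t T m k.+1) w - M (pt t T m k) w)) = 0.
Proof.
move=> km Vw VL; have pT := ptT (ltnW km).
apply: (orth_mul (uc_sigma_algebra F_usual pT) (uc_measurable F_usual pT)) => //.
- exact: delta_orth.
- by apply: L2_M => //; exact: delta_L2.
Qed.

Let S_mean0 m k : (k <= m)%N -> Ex P (S m k) = 0.
Proof.
elim: k => [|k IH] km; rewrite /S.
  by under [fun _ => _]funext do rewrite big_ord0; exact: Ex_cst.
under [fun _ => _]funext do rewrite big_ord_recr/=.
have bk := theta_bdd (ltnW km); have lk := delta_L2 km.
rewrite ExD; [|exact: L2_intg (S_L2 (ltnW km))|exact: intg_bddM bk (L2_intg lk)].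
rewrite IH ?add0r; last exact: ltnW.
apply: orth_cross => //; first exact: theta_wrt (ltnW km).
exact: bdd_L2.
Qed.

(** Both sides grow by the square of the new increment, weighted by a factor at most 1 on the left,
    because the cross terms have mean 0. The resulting bound at k = m does not depend on [m]. *)
Let S_sqr m k : (k <= m)%N ->
  Ex P (fun w => S m k w ^+ 2) <= Ex P (fun w => (M (pt t T m k) w - M t w) ^+ 2).
Proof.
elim: k => [|k IH] km.
  rewrite pt0 /S; under [fun _ => _]funext do rewrite big_ord0 expr0n/=.
  by under [X in _ <= Ex P X]funext do rewrite subrr expr0n/=.
have km' := ltnW km; have pT := ptT km'; have /andP[p0 p1] := pT.
set D := fun w => M (pt t T m k.+1) w - M (pt t T m k) w.
set th := fun w => huber' (X (pt t T m k) w).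
set B := fun w => M (pt t T m k) w - M t w.
have lD : L2 P D := delta_L2 km; have bth : bdd P th := theta_bdd km'.
have lB : L2 P B by apply: L2B; apply: M_L2.
have wB : measurable_wrt (F (pt t T m k)) B.
  apply: measurable_funB; first exact: M_wrt.
  apply: (wrt_up t_ge0 _ p1); last exact: M_wrt.
  by have /andP[] := pt_range t_leT km'.
have lS := S_L2 km'; have wS := S_wrt km'.
have lth : L2 P (fun w => th w * D w) by exact: L2_bddM.
have e1 : (fun w => S m k.+1 w ^+ 2) = fun w => S m k w ^+ 2 +
    (2 * ((th w * S m k w) * D w) + (th w * D w) ^+ 2).
  by apply/funext => w; rewrite /S big_ord_recr/= -/(th w) -/(D w); ring.
have e2 : (fun w => (M (pt t T m k.+1) w - M t w) ^+ 2) = fun w => B w ^+ 2 +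
    (2 * (B w * D w) + D w ^+ 2).
  by apply/funext => w; rewrite /B /D; ring.
have lthS : L2 P (fun w => th w * S m k w) by exact: L2_bddM.
have i1 := L2_M lthS lD; have i2 := L2_M lB lD.
have z1 : Ex P (fun w => th w * S m k w * D w) = 0.
  by apply: orth_cross => //; apply: measurable_funM => //; exact: theta_wrt.
have z2 : Ex P (fun w => B w * D w) = 0 by exact: orth_cross.
rewrite e1 e2 !ExD ?ExZ ?z1 ?z2 ?mulr0 ?add0r//; first last.
- by apply: intgD; [exact: intgZ|exact: lth.2].
- exact: lS.2.
- exact: lth.2.
- exact: intgZ.
- by apply: intgD; [exact: intgZ|exact: lD.2].
- exact: lB.2.
- exact: lD.2.
- exact: intgZ.
apply: lerD; first exact: IH.
apply: Ex_le_ae; [exact: lth.2|exact: lD.2|].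
apply: aeW => w; rewrite exprMn ler_piMl ?sqr_ge0//.
by rewrite -[th w ^+ 2]real_normK ?num_real// expr_le1// huber'_norm.
Qed.

(** Truncation at 1 makes the quantity integrable without a moment bound on [X t], and keeps its
    zero set. *)
Let Phi w : R := Num.min (huber (X t w)) 1.
Let Rm m w : R := Num.max 0 (S m m w + Phi w).

Let Phi_bdd : bdd P Phi.
Proof.
split.
  apply: measurable_minr => //; apply: (measurableT_comp measurable_huber).
  exact: wrt_meas (X_wrt tT).
exists 1; apply: aeW => w; rewrite ger0_norm ?ge_min ?lexx ?orbT//.
by rewrite le_min huber_ge0 ler01.
Qed.

(** Summing the tangent inequality along the partition, with [X T w <= 0], bounds S + huber(X_t) by
    a weighted Riemann sum of [beta]. Its limit is non-positive: the weight vanishes where X <= 0,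
    and elsewhere [beta] is non-positive. *)
Let Rm_cvg : \forall w \ae P, Rm m w @[m --> \oo] --> 0.
Proof.
apply: filterS3 X_path X_terminal beta_sign => w [uX mb [C bC] dX] XT sgn.
have sub s : t <= s <= T -> 0 <= s <= T.
  by move=> /andP[ts ->]; rewrite (le_trans t_ge0).
have uX' : ucont t T (fun s => huber' (X s w)).
  move=> e e0; have [r r0 h] := uX e e0; exists r => // u v /sub u1 /sub v1 uv.
  exact: le_lt_trans (huber'_lip _ _) (h _ _ u1 v1 uv).
have mb' : measurable_fun `[t, T] (fun s => beta s w).
  by apply: measurable_funS mb => //; apply: subset_itvr; rewrite bnd_simp.
have bC' s : t <= s <= T -> `|beta s w| <= C by move=> /sub; exact: bC.
have cv := riemann_cvg t_leT uX' mb' bC'.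
set ell := itg t T _ in cv.
have ell0 : ell <= 0.
  have -> : 0 = itg t T (fun=> 0 : R) by rewrite itg_cst ?mul0r.
  apply: itg_le.
  - exact: itgM_integrable uX' mb' bC'.
  - exact: itg_cst_integrable.
  - move=> s st; have [Xs|Xs] := ltrP 0 (X s w).
      by apply: mulr_ge0_le0; [exact: huber'_ge0|apply: sgn => //; exact: sub].
    by rewrite huber'_eq0 ?mul0r.
apply/cvgrPdist_le => e e0.
have /cvgrPdist_le/(_ e e0) near1 := cv.
near=> m.
have m0 : (0 < m)%N by near: m; exact: nbhs_infty_gt.
have h1 : `|ell - \sum_(j < m) huber' (X (pt t T m j) w) *
    itg (pt t T m j) (pt t T m j.+1) (fun s => beta s w)| <= e by near: m.
rewrite sub0r normrN ger0_norm ?le_max ?lexx//.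
rewrite /Rm ge_max (ltW e0)/=.
have h2 : S m m w + huber (X t w) <= \sum_(j < m) huber' (X (pt t T m j) w) *
    itg (pt t T m j) (pt t T m j.+1) (fun s => beta s w).
  have -> : huber (X t w) = - \sum_(j < m) (huber (X (pt t T m j.+1) w) - huber (X (pt t T m j) w)).
    rewrite -(big_mkord xpredT (fun j => huber (X (pt t T m j.+1) w) - huber (X (pt t T m j) w))).
    rewrite (telescope_sumr (fun j => huber (X (pt t T m j) w)))// ptn// pt0.
    have /eqP -> : huber (X T w) == 0 by rewrite huber_eq0.
    by rewrite sub0r opprK.
  rewrite /S -sumrN -big_split/=; apply: ler_sum => j _.
  have /andP[p0 p1] := ptT (ltnW (ltn_ord j)); have /andP[q0 q1] := ptT (ltn_ord j).
  have := dX _ _ p0 (ptS_le m j) q1.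
  have := huber_tangent (X (pt t T m j) w) (X (pt t T m j.+1) w).
  by move=> + e1; rewrite e1; lra.
have : Phi w <= huber (X t w) by rewrite ge_min lexx.
by move: h1; rewrite ler_norml => /andP[]; lra.
Unshelve. all: by end_near. Qed.

Let Rm_L2 m : L2 P (Rm m).
Proof.
have lSP : L2 P (fun w => S m m w + Phi w) by apply: L2D; [exact: S_L2|exact: bdd_L2].
split; first by apply: measurable_maxr => //; exact: lSP.1.
apply: intg_le lSP.2 _.
  by apply: measurable_funX; apply: measurable_maxr => //; exact: lSP.1.
apply: aeW => w; rewrite ger0_norm ?sqr_ge0// /Rm maxEle; case: ifPn => // _.
by rewrite expr0n sqr_ge0.
Qed.

Let Rm_sqr m : (0 < m)%N ->
  Ex P (fun w => Rm m w ^+ 2) <= 2 * Ex P (fun w => (M T w - M t w) ^+ 2) + 2.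
Proof.
move=> m0; have := S_sqr (leqnn m); rewrite ptn// => hS.
have lS := S_L2 (leqnn m).
apply: (@le_trans _ _ (Ex P (fun w => 2 * S m m w ^+ 2 + 2))).
  apply: Ex_le_ae; first exact: (Rm_L2 m).2.
    by apply: intgD; [apply: intgZ; exact: lS.2|exact: intg_cst].
  apply: aeW => w; have P0 : 0 <= Phi w <= 1.
    by rewrite le_min huber_ge0 ler01/= ge_min lexx orbT.
  rewrite /Rm maxEle; have [_|_] := boolP (0 <= _); last first.
    by rewrite expr0n/=; have := sqr_ge0 (S m m w); lra.
  by have := sqr_ge0 (S m m w - Phi w); nra.
rewrite ExD; [|by apply: intgZ; exact: lS.2|exact: intg_cst].
rewrite Ex_cst ExZ; last exact: lS.2.
by lra.
Qed.

Let Rm_mean m : Ex P Phi <= Ex P (Rm m).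
Proof.
have iS := L2_intg (S_L2 (leqnn m)); have iP := bdd_intg Phi_bdd.
rewrite -[leLHS]add0r -(S_mean0 (leqnn m)) -ExD//.
apply: Ex_le_ae; [exact: intgD|exact: L2_intg (Rm_L2 m)|].
by apply: aeW => w; rewrite /Rm le_max lexx orbT.
Qed.

(** As S has mean 0, the mean of [Phi] is at most that of [Rm m]. The latter tends to 0 by almost
    sure convergence and the uniform second moment bound, so [Phi] vanishes almost surely. *)
Lemma comparison_at : \forall w \ae P, X t w <= 0.
Proof.
have Phi0 w : 0 <= Phi w by rewrite le_min huber_ge0 ler01.
have E0 : Ex P Phi = 0.
  apply/eqP; rewrite eq_le; apply/andP; split; last first.
    by apply: Ex_ge0; [exact: Phi_bdd.1|exact: aeW].
  apply/ler_addgt0Pr => e e0; rewrite add0r.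
  set C := 2 * Ex P (fun w => (M T w - M t w) ^+ 2) + 2.
  have C0 : 0 < C.
    rewrite ltr_wpDl// mulr_ge0//; apply: Ex_ge0; last by apply: aeW => w; exact: sqr_ge0.
    by apply: measurable_funX; apply: measurable_funB; apply: (M_L2 _).1 => //; rewrite Tge0 lexx.
  (* Truncation level: dominated convergence handles the part below [c], and the second moment bound
     [C] makes the part above [c] at most C / (4 c) = e / 4. *)
  pose c := C / e; have c0 : 0 < c by rewrite divr_gt0.
  have cv : Ex P (fun w => Num.min (Rm m w) c) @[m --> \oo] --> Ex P (fun=> 0).
    apply: Ex_dominated (intg_cst P c) _ _.
    - by move=> m; apply: measurable_minr => //; exact: (Rm_L2 m).1.
    - exact: measurable_cst.
    - apply: filterS Rm_cvg => w h.
      apply: (@squeeze_cvgr _ _ _ _ (fun=> 0) (fun m => Rm m w)) => //; last exact: cvg_cst.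
      apply: nearW => m; rewrite ge_min lexx le_min (ltW c0) !andbT /Rm.
      by rewrite le_max lexx.
    - apply: aeW => w m; rewrite ger0_norm; first by rewrite ge_min lexx orbT.
      by rewrite le_min (ltW c0) andbT /Rm le_max lexx.
  rewrite Ex_cst in cv.
  have e2 : 0 < e / 2 by rewrite divr_gt0.
  move/cvgrPdist_le : cv => /(_ _ e2) near1.
  have [m [m0 hm]] : exists m, (0 < m)%N /\ `|0 - Ex P (fun w => Num.min (Rm m w) c)| <= e / 2.
    have [k _ hk] := near1; exists k.+1; split => //.
    by apply: hk => /=.
  apply: (le_trans (Rm_mean m)).
  have iR := L2_intg (Rm_L2 m).
  have imin : intg P (fun w => Num.min (Rm m w) c).
    apply: intg_le iR _; first by apply: measurable_minr => //; exact: (Rm_L2 m).1.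
    apply: aeW => w; rewrite ger0_norm ?ge_min ?lexx//.
    by rewrite le_min (ltW c0) andbT /Rm le_max lexx.
  (* Above the level [c] this is r - c <= r^2 / (4 c), that is, (r - 2 c)^2 >= 0. *)
  apply: (@le_trans _ _ (Ex P (fun w => Num.min (Rm m w) c + (4 * c)^-1 * Rm m w ^+ 2))).
    apply: Ex_le_ae => //; first by apply: intgD => //; apply: intgZ; exact: (Rm_L2 m).2.
    apply: aeW => w; have c4 : 0 < 4 * c by rewrite mulr_gt0.
    have i0 : 0 < (4 * c)^-1 by rewrite invr_gt0.
    rewrite minEle; case: ifPn => h; first by rewrite lerDl mulr_ge0 ?sqr_ge0// ltW.
    rewrite -subr_ge0 -(pmulr_rge0 _ c4).
    rewrite [X in 0 <= X](_ : _ = (Rm m w - 2 * c) ^+ 2); first exact: sqr_ge0.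
    by field; rewrite lt0r_neq0.
  rewrite ExD//; last by apply: intgZ; exact: (Rm_L2 m).2.
  rewrite ExZ; last exact: (Rm_L2 m).2.
  have := Rm_sqr m0; rewrite -/C => hC.
  have : (4 * c)^-1 * Ex P (fun w => Rm m w ^+ 2) <= e / 4.
    have c4 : 0 < 4 * c by rewrite mulr_gt0.
    rewrite mulrC ler_pdivrMr//.
    by rewrite (_ : e / 4 * (4 * c) = C)// /c; field; rewrite lt0r_neq0.
  move: hm; rewrite sub0r normrN => hm.
  by have := ler_norm (Ex P (fun w => Num.min (Rm m w) c)); lra.
have := Ex_eq0_ae (bdd_intg Phi_bdd) (aeW _ Phi0) E0.
apply: filterS => w; rewrite /Phi minEle; case: ifPn => _ /eqP.
  by rewrite huber_eq0.
by rewrite oner_eq0.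
Qed.

End AtTime.
End Comparison.

(** Inversion is continuous on both open half-lines, and the remaining point is a singleton. It
    makes the rate [(eta t w)^-1] measurable. *)
Lemma measurable_invr {R : realType} : measurable_fun [set: R] (@GRing.inv R).
Proof.
rewrite -[X in measurable_fun X](_ : `]-oo, 0[%classic `|` ([set 0] `|` `]0, +oo[%classic) = setT :> set R); last first.
  apply/seteqP; split => // x _; rewrite /= !in_itv/= andbT.
  by have [h|h|->] := ltrgtP x 0; [left|right; right|right; left].
apply/measurable_funU => //; first exact: measurableU.
split.
  apply: (subspace_continuous_measurable_fun (D := `]-oo, 0[%classic)) => //.
  apply: continuous_in_subspaceT => x; rewrite inE/= in_itv/= => x0.
  by apply: cvgV; [rewrite lt_eqF|exact: cvg_id].
apply/measurable_funU => //; split; first exact: measurable_fun_set1.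
apply: (subspace_continuous_measurable_fun (D := `]0, +oo[%classic)) => //.
apply: continuous_in_subspaceT => x; rewrite inE/= in_itv/= andbT => x0.
by apply: cvgV; [rewrite gt_eqF|exact: cvg_id].
Qed.

(** * Joint measurability, the essential supremum and uniform continuity *)

Section JointMeasurability.
Context {R : realType} {d : measure_display} {Omega : measurableType d}.
Notation mu := (@lebesgue_measure R).
Implicit Types X : R -> Omega -> R.

Definition joint_meas (D : set R) X : Prop :=
  measurable_fun (D `*` [set: Omega])
    (fun p : measurableTypeR R * Omega => X p.1 p.2).

Lemma progressive_joint (T : R) (F : R -> set (set Omega)) X : 0 <= T ->
  F T `<=` measurable -> sigma_algebra setT (F T) ->
  progressively_measurable T F X -> joint_meas `[0, T] X.
Proof.
move=> T0 FT sT pX.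
pose i : measurableTypeR R * Omega -> measurableTypeR R * g_sigma_algebraType (F T) := id.
have mid : measurable_fun [set: Omega] (id : Omega -> g_sigma_algebraType (F T)).
  by move=> _ A; rewrite setTI => mA; apply: FT; move: mA; rewrite measurable_sigmaE.
have mi : measurable_fun setT i.
  have := measurable_fun_pair (@measurable_fst _ _ (measurableTypeR R) Omega)
    (measurableT_comp mid (@measurable_snd _ _ (measurableTypeR R) Omega)).
  by congr measurable_fun; apply/funext => -[].
have mD : measurable (`[0, T]%classic `*` [set: g_sigma_algebraType (F T)] :
    set (measurableTypeR R * g_sigma_algebraType (F T))).
  by apply: measurableX.
apply: (measurable_comp mD _ (pX T _)).
- by move=> _ [p [h1 h2] <-]; split.
- by rewrite T0 lexx.
- exact: measurable_funTS.
Qed.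

Lemma joint_section (D : set R) X w : measurable D -> joint_meas D X ->
  measurable_fun D (fun t => X t w).
Proof.
move=> mD mX _ B mB.
have mDT : measurable (D `*` [set: Omega] : set (measurableTypeR R * Omega)) by exact: measurableX.
have := @measurable_ysection _ _ _ _ _ w (mX mDT B mB).
congr measurable; apply/seteqP; split => t /=.
  by rewrite /ysection/= inE => -[[h _] h']; split.
by move=> [h h']; rewrite /ysection/= inE; split.
Qed.

Lemma joint_comp (D : set R) (g : R -> R) X : measurable_fun setT g ->
  joint_meas D X -> joint_meas D (fun t w => g (X t w)).
Proof. by move=> mg mX; exact: (measurableT_comp mg mX). Qed.

(** Tonelli's theorem for the process extended by 0 outside the time interval; non-negativity gives
    measurability in [w] without integrability. *)
Lemma joint_itg a b X : joint_meas `[a, b] X -> (forall t w, 0 <= X t w) ->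
  measurable_fun setT (fun w => itg a b (fun t => X t w)).
Proof.
move=> mX X0.
pose D : set (measurableTypeR R * Omega) := `[a, b]%classic `*` setT.
have mD : measurable D by exact: measurableX.
pose g : measurableTypeR R * Omega -> \bar R := ((fun p => (X p.1 p.2)%:E) \_ D).
have mg : measurable_fun setT g by apply/(measurable_restrictT _ mD)/measurable_EFinP.
have g0 p : (0 <= g p)%E by rewrite /g patchE; case: ifP => // _; rewrite lee_fin.
have mG := @measurable_fun_fubini_tonelli_G _ _ _ _ _ mu g mg g0.
have -> : (fun w => itg a b (fun t => X t w)) = fine \o fubini_G mu g.
  apply/funext => w; rewrite /itg /Rintegral /= /fubini_G; congr fine.
  rewrite [LHS]integral_mkcond.
  apply: eq_integral => t _; rewrite /g !patchE; congr (if _ then _ else _).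
  by apply/idP/idP; rewrite !inE /D /=; [move=> h; split|case].
exact: measurableT_comp.
Qed.

End JointMeasurability.

Section Linfty.
Context {R : realType} {d : measure_display} {Omega : measurableType d}.
Variables (P : probability Omega R) (X : Omega -> R).

Lemma Linfty_norm_ge0 : 0 <= Linfty_norm P X.
Proof. by rewrite /Linfty_norm fine_ge0// Lnorm_ge0. Qed.

(** The essential supremum is finite under the stated bound, so taking its finite part loses
    nothing. *)
Lemma Linfty_norm_le : (exists C, \forall w \ae P, `|X w| <= C) ->
  \forall w \ae P, `|X w| <= Linfty_norm P X.
Proof.
move=> [C XC].
have E : ('N[P]_+oo[EFin \o X] = ess_sup P (abse \o (EFin \o X)))%E.
  rewrite unlock /= ifT//; change (0 < P [set: Omega])%E.
  by rewrite probability_setT lte01.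
have le : (ess_sup P (abse \o (EFin \o X)) <= C%:E)%E.
  by apply/ess_supP; apply: filterS XC => w h /=; rewrite lee_fin.
have fin : ('N[P]_+oo[EFin \o X] \is a fin_num)%E.
  by rewrite ge0_fin_numE ?Lnorm_ge0// E (le_lt_trans le) ?ltry.
have := ess_sup_ge P (abse \o (EFin \o X)).
by apply: filterS => w; rewrite -E -(fineK fin) /= lee_fin.
Qed.

End Linfty.

Section UniformContinuity.
Context {R : realType}.

Lemma ucontN (a b : R) (x : R -> R) : ucont a b x -> ucont a b (fun t => - x t).
Proof.
move=> cx e e0; have [r r0 h] := cx e e0; exists r => // s t sab tab st.
by rewrite -opprD normrN; exact: h.
Qed.

Lemma eq_ucont (a b : R) (x y : R -> R) : (forall t, a <= t <= b -> y t = x t) ->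
  ucont a b x -> ucont a b y.
Proof.
move=> e cx r r0; have [q q0 h] := cx r r0; exists q => // s t sab tab st.
by rewrite !e//; exact: h.
Qed.

Lemma ucont_cst (a b c : R) : ucont a b (fun=> c).
Proof. by move=> e e0; exists 1 => // s t _ _ _; rewrite subrr normr0. Qed.

(** Comparison yields one exceptional null set per time. Checking the countably many points of all
    uniform partitions leaves a single null set, and uniform continuity covers the other times. *)
Lemma ucont_le (T : R) (x y : R -> R) : 0 < T -> ucont 0 T x -> ucont 0 T y ->
  (forall m k : nat, (k <= m.+1)%N -> x (pt 0 T m.+1 k) <= y (pt 0 T m.+1 k)) ->
  forall t, 0 <= t <= T -> x t <= y t.
Proof.
move=> T0 cx cy h t /andP[t0]; rewrite le_eqVlt => /predU1P[->|tT].
  by have := h 0%N 1%N (leqnn _); rewrite ptn.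
rewrite leNgt; apply/negP => xy; have e0 : 0 < (x t - y t) / 2 by lra.
have [r r0 hr] := cx _ e0; have [q q0 hq] := cy _ e0.
have rq : 0 < Num.min r q by rewrite lt_min r0.
have [k0 _ hk] := @mesh_small R 0 T _ rq.
have ht : 0 <= t < T by rewrite t0.
have [k km /andP[kt tk]] := @pt_find R 0 T k0.+1 t T0 isT ht.
have := hk k0.+1 (leqnSn k0); rewrite /= lt_min => /andP[m1 m2].
have kT := @pt_range R 0 T k0.+1 k (ltW T0) (ltnW km).
have tT' : 0 <= t <= T by rewrite t0 ltW.
have gen (u v p : R) : u <= v -> v < u + p -> `|v - u| <= p.
  by move=> uv vp; rewrite ger0_norm; lra.
have dist := gen _ _ _ kt (eq_ind _ (fun z => t < z) tk _ (ptS 0 T k0.+1 k)).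
have := hr t _ tT' kT (le_lt_trans dist m1); have := hq t _ tT' kT (le_lt_trans dist m2).
have := h k0 k (ltnW km).
by rewrite !ltr_norml => h1 /andP[h2 h3] /andP[h4 h5]; lra.
Qed.

End UniformContinuity.

(** * Path regularity of the solution and a priori bounds *)

Section BsdeBounds.
Context {R : realType} {d : measure_display} {Omega : measurableType d} {n : nat}.
Variables (P : probability Omega R) (T : R) (W : 'I_n -> R -> Omega -> R).
Variable F : R -> set (set Omega).
Hypothesis T_gt0 : 0 < T.
Hypothesis W_brownian : brownian_motion P T W.
Hypothesis F_usual : usual_conditions P T F.
Hypothesis F_generated : forall t : R, 0 <= t <= T -> F t = brownian_filtration P W t.
Variables (eta_inf eta_sup lambda_sup : R).
Hypothesis eta_inf_gt0 : 0 < eta_inf.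
Hypothesis lambda_sup_ge0 : 0 <= lambda_sup.
Variables (eta lambda : R -> Omega -> R).
Hypothesis eta_prog : progressively_measurable T F eta.
Hypothesis lambda_prog : progressively_measurable T F lambda.
Hypothesis eta_bounds : \forall w \ae P, forall t : R, 0 <= t <= T ->
  eta_inf <= eta t w <= eta_sup.
Hypothesis lambda_bounds : \forall w \ae P, forall t : R, 0 <= t <= T ->
  0 <= lambda t w <= lambda_sup.
Variable f : R -> R.
Hypothesis f_continuous : continuous f.
Hypothesis f_nonincreasing : {homo f : x y / x <= y >-> y <= x}.
Hypothesis f0 : f 0 = 0.
Variable xi : Omega -> R.
Hypothesis xi_bounded : exists C, \forall w \ae P, `|xi w| <= C.
Hypothesis xi_ge0 : \forall w \ae P, 0 <= xi w.
Variables (Y : R -> Omega -> R) (Z : 'I_n -> R -> Omega -> R).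
Hypothesis YZ_solution :
  bsde_solution P T F W f (fun t w => (eta t w)^-1) lambda xi Y Z.

Definition drift (t : R) (w : Omega) : R := (eta t w)^-1 * f (Y t w) + lambda t w.

Let T_ge0 : 0 <= T. Proof. exact: ltW. Qed.
Let TT : 0 <= T <= T. Proof. by rewrite T_ge0 lexx. Qed.

Lemma measurable_f : measurable_fun setT f.
Proof. exact: continuous_measurable_fun. Qed.

Lemma eta_joint : joint_meas `[0, T] eta.
Proof.
apply: (progressive_joint (F := F)) => //.
- exact: (uc_measurable F_usual).
- exact: (uc_sigma_algebra F_usual).
Qed.

Lemma lambda_joint : joint_meas `[0, T] lambda.
Proof.
apply: (progressive_joint (F := F)) => //.
- exact: (uc_measurable F_usual).
- exact: (uc_sigma_algebra F_usual).
Qed.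

Lemma rate_bounds : \forall w \ae P, forall t : R, 0 <= t <= T ->
  0 <= (eta t w)^-1 <= eta_inf^-1.
Proof.
apply: filterS eta_bounds => w h t tT; have /andP[h1 h2] := h t tT.
have e0 : 0 < eta t w by exact: lt_le_trans h1.
by rewrite invr_ge0 (ltW e0) lef_pV2 ?posrE.
Qed.

(** A cadlag path is bounded and measurable, hence so is the drift, by monotonicity of [f]. Its time
    integral is then Lipschitz, and together with the continuous [M] this makes [Y] continuous. *)
Lemma bsde_path : exists2 M, is_ito_integral P T F W Z M & \forall w \ae P,
  [/\ ucont 0 T (fun t => Y t w),
      measurable_fun `[0, T] (fun t => drift t w),
      exists C, forall t, 0 <= t <= T -> `|drift t w| <= C &
      forall s t, 0 <= s -> s <= t -> t <= T ->
        Y t w - Y s w = - itg s t (fun r => drift r w) + (M t w - M s w)].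
Proof.
have [M Mito dyn] := bsde_dynamics YZ_solution; exists M => //.
have aux : \forall w \ae P, [/\ {within `[0, T], continuous (fun t => M t w)},
    forall t : R, 0 <= t <= T -> 0 <= (eta t w)^-1 <= eta_inf^-1 &
    forall t : R, 0 <= t <= T -> 0 <= lambda t w <= lambda_sup].
  by apply: filterS3 (ito_continuous Mito) rate_bounds lambda_bounds.
apply: filterS3 (bsde_cadlag YZ_solution) dyn aux => w cY dY [cM hr hl].
have [C hC] := cadlag_bounded cY.
have C0 : 0 <= C by apply: le_trans (normr_ge0 _) (hC 0 _); rewrite lexx.
have mY : measurable_fun `[0, T] (fun t => Y t w) by exact: cadlag_measurable.
pose C' := eta_inf^-1 * (`|f C| + `|f (- C)|) + lambda_sup.
have md : measurable_fun `[0, T] (fun t => drift t w).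
  apply: measurable_funD; last exact: joint_section lambda_joint.
  apply: measurable_funM; last exact: (measurableT_comp measurable_f mY).
  by apply: (measurableT_comp measurable_invr); exact: joint_section eta_joint.
have dC t : 0 <= t <= T -> `|drift t w| <= C'.
  move=> tT; have /andP[r0 r1] := hr t tT; have /andP[l0 l1] := hl t tT.
  have := hC t tT; rewrite ler_norml => /andP[y1 y2].
  have fY : `|f (Y t w)| <= `|f C| + `|f (- C)|.
    have := f_nonincreasing y1; have := f_nonincreasing y2.
    have := ler_norm (f (- C)); have := ler_norm (- f C); rewrite normrN.
    have := normr_ge0 (f C); have := normr_ge0 (f (- C)).
    by rewrite [in X in _ -> _ -> _ -> _ -> _ -> _ -> X]ler_norml => *; apply/andP; split; lra.
  apply: le_trans (ler_normD _ _) _; rewrite normrM (ger0_norm r0) (ger0_norm l0).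
  by rewrite lerD// ler_pM.
have id_ := itg_integrable md dC.
have inc s t : 0 <= s -> s <= t -> t <= T ->
    Y t w - Y s w = - itg s t (fun r => drift r w) + (M t w - M s w).
  move=> s0 st tT.
  have e1 := dY t _; rewrite e1 ?(le_trans s0 st)//.
  rewrite (dY s) ?s0 ?(le_trans st tT)//.
  have := @itg_chasles R 0 s t (fun r => drift r w) (itg_sub id_ (lexx _) tT) _.
  by rewrite s0 st /itg /drift => /(_ isT) ->; ring.
split => //; last by exists C'.
apply: (@eq_ucont _ _ _ (fun t => (Y 0 w - M 0 w + - itg 0 t (fun r => drift r w)) + M t w)).
  move=> t /andP[t0 tT]; have := inc 0 t (lexx _) t0 tT.
  by move=> /eqP; rewrite subr_eq => /eqP ->; ring.
apply: ucontD; last exact: heine.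
by apply: ucontD; [exact: ucont_cst|apply: ucontN; exact: itg_ucont md dC].
Qed.

Section WithMartingale.
Variable M : R -> Omega -> R.
Hypothesis M_ito : is_ito_integral P T F W Z M.
Hypothesis Y_path : \forall w \ae P,
  [/\ ucont 0 T (fun t => Y t w),
      measurable_fun `[0, T] (fun t => drift t w),
      exists C, forall t, 0 <= t <= T -> `|drift t w| <= C &
      forall s t, 0 <= s -> s <= t -> t <= T ->
        Y t w - Y s w = - itg s t (fun r => drift r w) + (M t w - M s w)].

Let M_facts := ito_L2_orth W_brownian F_usual F_generated M_ito.

Let Y_wrt t : 0 <= t <= T -> measurable_wrt (F t) (Y t).
Proof. exact: (bsde_adapted YZ_solution). Qed.

Let ae_all_times (Q : R -> Omega -> Prop) :
  (forall t, 0 <= t <= T -> \forall w \ae P, Q t w) ->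
  \forall w \ae P, forall m k : nat, (k <= m.+1)%N -> Q (pt 0 T m.+1 k) w.
Proof.
move=> h; apply: ae_foralln => m; apply: ae_foralln => k.
have [km|km] := leqP k m.+1; last by apply: aeW.
apply: filterS (h _ (pt_range T_ge0 km)) => w hw _; exact: hw.
Qed.

(** The comparison is applied to -Y: where Y < 0, monotonicity and f(0) = 0 make the drift
    non-negative. *)
Lemma bsde_ge0 : \forall w \ae P, forall t, 0 <= t <= T -> 0 <= Y t w.
Proof.
have at_time t : 0 <= t <= T -> \forall w \ae P, - Y t w <= 0.
  apply: (@comparison_at _ _ _ P T F F_usual (fun s w => - Y s w) (fun s w => - M s w)
    (fun s w => - drift s w)).
  - by move=> s sT; apply: measurable_funN; exact: Y_wrt.
  - by move=> s sT; apply: measurable_funN; exact: (ito_wrt M_ito).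
  - by move=> s sT; apply: L2N; exact: M_facts.1.
  - move=> r s r0 rs sT; have [i0 o0] := M_facts.2 r s r0 rs sT.
    have e w : - M s w - - M r w = -1 * (M s w - M r w) by ring.
    under [fun _ => _]funext do rewrite e.
    split; first exact: intgZ.
    have rT : 0 <= r <= T by rewrite r0 (le_trans rs).
    move=> A FA; have mA := uc_measurable F_usual rT FA.
    rewrite RintegralZl ?o0 ?mulr0//; first exact: integrableS i0.
  - apply: filterS Y_path => w [uY md [C dC] inc]; split.
    + exact: ucontN.
    + exact: measurable_funN.
    + by exists C => s sT; rewrite normrN; exact: dC.
    + move=> r s r0 rs sT; have id_ := itg_integrable md dC.
      have e : itg r s (fun t => - drift t w) = - itg r s (fun t => drift t w).
        rewrite -mulN1r -itgZ; last exact: itg_sub id_ r0 sT.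
        by apply: eq_itg => u _; rewrite mulN1r.
      by rewrite e; have := inc r s r0 rs sT; lra.
  - by apply: filterS2 (bsde_terminal YZ_solution) xi_ge0 => w -> h; rewrite oppr_le0.
  - apply: filterS2 rate_bounds lambda_bounds => w hr hl s sT Ys.
    have /andP[r0 _] := hr s sT; have /andP[l0 _] := hl s sT.
    rewrite oppr_le0 /drift addr_ge0// mulr_ge0// -f0; apply: f_nonincreasing; lra.
have := ae_all_times at_time; apply: filterS2 Y_path => w [uY _ _ _] h t tT.
apply: (ucont_le T_gt0 (ucont_cst 0 T 0) uY _ tT) => m k km.
by have := h m k km; rewrite oppr_le0.
Qed.

(** The upper barrier decreases at rate [lambda_sup]. Above it Y > 0, so f(Y) <= 0 and the drift is
    at most [lambda_sup]. *)
Lemma bsde_le : \forall w \ae P, forall t, 0 <= t <= T ->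
  Y t w <= Linfty_norm P xi + T * lambda_sup.
Proof.
have lam0 := lambda_sup_ge0.
pose K := Linfty_norm P xi; have K0 : 0 <= K := Linfty_norm_ge0 P xi.
have at_time t : 0 <= t <= T ->
    \forall w \ae P, Y t w - (K + (T - t) * lambda_sup) <= 0.
  apply: (@comparison_at _ _ _ P T F F_usual (fun s w => Y s w - (K + (T - s) * lambda_sup)) M
    (fun s w => drift s w - lambda_sup)).
  - by move=> s sT; apply: measurable_funB => //; exact: Y_wrt.
  - by move=> s sT; exact: (ito_wrt M_ito).
  - by move=> s sT; exact: M_facts.1.
  - exact: M_facts.2.
  - apply: filterS Y_path => w [uY md [C dC] inc]; split.
    + apply: ucontD => //; apply: ucontN.
      apply: (@ucont_lipschitz _ _ _ _ lambda_sup) => s r _ _.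
      rewrite (_ : _ - _ = lambda_sup * (r - s)); last by ring.
      by rewrite normrM (ger0_norm lam0) distrC.
    + exact: measurable_funB.
    + exists (C + lambda_sup) => s sT; apply: le_trans (ler_normB _ _) _.
      by rewrite (ger0_norm lam0) lerD2r; exact: dC.
    + move=> r s r0 rs sT; have id_ := itg_integrable md dC.
      rewrite itgB; [|exact: itg_sub id_ r0 sT|exact: itg_cst_integrable].
      by rewrite itg_cst//; have := inc r s r0 rs sT; lra.
  - apply: filterS2 (bsde_terminal YZ_solution) (Linfty_norm_le xi_bounded) => w -> h.
    by rewrite subrr mul0r addr0 subr_le0 (le_trans _ h)// ler_norm.
  - apply: filterS2 rate_bounds lambda_bounds => w hr hl s sT Ys.
    have /andP[r0 _] := hr s sT; have /andP[_ l1] := hl s sT.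
    have : (eta s w)^-1 * f (Y s w) <= 0.
      apply: mulr_ge0_le0 => //; rewrite -f0; apply: f_nonincreasing.
      have : 0 <= (T - s) * lambda_sup by case/andP: sT => *; rewrite mulr_ge0//; lra.
      lra.
    by rewrite /drift; lra.
have := ae_all_times at_time; apply: filterS2 Y_path => w [uY _ _ _] h t tT.
apply: (ucont_le T_gt0 uY (ucont_cst 0 T _) _ tT) => m k km.
have := h m k km; have /andP[p0 _] := pt_range T_ge0 km.
by rewrite -/K; have := mulr_ge0 p0 lam0; lra.
Qed.

End WithMartingale.

End BsdeBounds.

(** * Weighted increments of the solution *)

(** Discrete counterpart of integrating the elapsed time over a step; the factor 1/2 of the first
    order constant originates here. *)
Lemma sum_ord_le {R : realFieldType} (m : nat) :
  (\sum_(j < m) j)%:R <= m%:R ^+ 2 / 2 :> R.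
Proof.
elim: m => [|m IH]; first by rewrite big_ord0 expr0n/= mul0r.
by rewrite big_ord_recr/= natrD -[m.+1%:R]natr1; lra.
Qed.

Section Completeness.
Context {R : realType} {d : measure_display} {Omega : measurableType d}.
Variable P : probability Omega R.
Hypothesis P_complete : P.-negligible `<=` measurable.

Lemma complete_measurable (X Y : Omega -> R) : measurable_fun setT X ->
  (\forall w \ae P, X w = Y w) -> measurable_fun setT Y.
Proof.
move=> mX XY _ B mB; rewrite setTI.
pose N := [set w | X w <> Y w].
have N0 : P.-negligible N by exact: XY.
have -> : Y @^-1` B = (X @^-1` B `\` N) `|` (Y @^-1` B `&` N).
  apply/seteqP; split => w /=.
    have [e|e] := pselect (X w = Y w); last by right; split.
    by move=> h; left; split; [rewrite e|move=> /(_ e)].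
  move=> [[h1 h2]|[]//]; have e : X w = Y w by apply: contrapT.
  by rewrite -e.
apply: measurableU.
  by apply: measurableD; [rewrite -[X in measurable X]setTI; exact: mX|exact: P_complete].
by apply: P_complete; apply: negligibleS N0 => w [].
Qed.

(** Multiplying by the indicator of the convergence set, measurable by completeness, turns almost
    sure convergence into convergence everywhere. *)
Lemma complete_cvg (Xn : nat -> Omega -> R) (X : Omega -> R) :
  (forall m, measurable_fun setT (Xn m)) ->
  (\forall w \ae P, Xn m w @[m --> \oo] --> X w) -> measurable_fun setT X.
Proof.
move=> mXn cX.
pose N := [set w | ~ (Xn m w @[m --> \oo] --> X w)].
have N0 : P.-negligible N by exact: cX.
have mN : measurable N by exact: P_complete.
pose I : Omega -> R := \1_(~` N).
have mI : measurable_fun setT I by apply: measurable_indic; exact: measurableC.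
apply: (@complete_measurable (fun w => I w * X w)); last first.
  apply: filterS cX => w h; rewrite /I indicE mem_set ?mul1r// => hN; exact: hN.
apply: (@measurable_fun_cvg _ _ _ _ (fun m w => I w * Xn m w)) => //.
  by move=> m; exact: measurable_funM.
move=> w _; rewrite /I indicE; have [h|h] := pselect (N w).
  rewrite memNset ?mul0r; last by apply.
  by under eq_fun do rewrite mul0r; exact: cvg_cst.
rewrite mem_set// mul1r; under eq_fun do rewrite mul1r.
exact: contrapT.
Qed.

End Completeness.

Section Estimates.
Context {R : realType} {d : measure_display} {Omega : measurableType d}.
Variables (P : probability Omega R) (T : R) (F : R -> set (set Omega)).
Hypothesis F_usual : usual_conditions P T F.
Variables (Y M b : R -> Omega -> R) (K lam Cb : R).
Hypotheses (K_ge0 : 0 <= K) (lam_ge0 : 0 <= lam).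
Hypothesis Y_wrt : forall t, 0 <= t <= T -> measurable_wrt (F t) (Y t).
Hypothesis M_L2 : forall t, 0 <= t <= T -> L2 P (M t).
Hypothesis M_orth : forall s t, 0 <= s -> s <= t -> t <= T ->
  orth P (F s) (fun w => M t w - M s w).
Hypothesis Y_path : \forall w \ae P,
  [/\ ucont 0 T (fun t => Y t w),
      measurable_fun `[0, T] (fun t => b t w),
      forall t, 0 <= t <= T -> `|b t w| <= Cb /\ b t w <= lam &
      forall s t, 0 <= s -> s <= t -> t <= T ->
        Y t w - Y s w = - itg s t (fun r => b r w) + (M t w - M s w)].
Hypothesis Y_bounds : \forall w \ae P, forall t, 0 <= t <= T -> 0 <= Y t w <= K.
Variables (f f' : R -> R) (D L : R).
Hypothesis f_continuous : continuous f.
Hypothesis f_taylor : forall x y, 0 <= x <= K -> 0 <= y <= K ->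
  `|f y - f x - f' x * (y - x)| <= L / 2 * (y - x) ^+ 2.
Hypothesis f'_le : forall x, 0 <= x <= K -> `|f' x| <= D.
Hypothesis f'_ucont : ucont 0 K f'.
Hypothesis L_ge0 : 0 <= L.

Let wrt_meas t (V : Omega -> R) : 0 <= t <= T -> measurable_wrt (F t) V ->
  measurable_fun setT V.
Proof.
move=> tT; apply: wrt_measurable.
- exact: (uc_sigma_algebra F_usual).
- exact: (uc_measurable F_usual).
Qed.

Lemma Y_bdd t : 0 <= t <= T -> bdd P (Y t).
Proof.
move=> tT; split; first exact: wrt_meas (Y_wrt tT).
exists K; apply: filterS Y_bounds => w /(_ t tT)/andP[h1 h2].
by rewrite ger0_norm.
Qed.

(** Almost surely the drift [b] integrated over [s, t]; written through [M] and [Y] it is visibly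
    measurable in [w]. *)
Definition cumul s t w : R := M t w - M s w - (Y t w - Y s w).

Lemma cumulE : \forall w \ae P, forall s t, 0 <= s -> s <= t -> t <= T ->
  cumul s t w = itg s t (fun r => b r w).
Proof.
apply: filterS Y_path => w [_ _ _ inc] s t s0 st tT.
by rewrite /cumul (inc _ _ s0 st tT); ring.
Qed.

Lemma cumul_le : \forall w \ae P, forall s t, 0 <= s -> s <= t -> t <= T ->
  `|cumul s t w| <= Cb * (t - s) /\ cumul s t w <= lam * (t - s).
Proof.
apply: filterS2 cumulE Y_path => w cE [_ mb bb _] s t s0 st tT.
rewrite (cE _ _ s0 st tT).
have ib := itg_integrable mb (fun t tT => (bb t tT).1).
have ib' := itg_sub ib s0 tT.
have sub r : s <= r <= t -> 0 <= r <= T.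
  by move=> /andP[r1 r2]; rewrite (le_trans s0 r1) (le_trans r2 tT).
split; first by apply: itg_norm_le => // r /sub /bb [].
rewrite -itg_cst//; apply: itg_le => //; first exact: itg_cst_integrable.
by move=> r /sub /bb [].
Qed.

Lemma cumul_bdd s t : 0 <= s -> s <= t -> t <= T -> bdd P (cumul s t).
Proof.
move=> s0 st tT.
have sT : 0 <= s <= T by rewrite s0 (le_trans st).
have tT' : 0 <= t <= T by rewrite (le_trans s0).
split.
  apply: measurable_funB; apply: measurable_funB.
  - exact: (M_L2 tT').1.
  - exact: (M_L2 sT).1.
  - exact: (Y_bdd tT').1.
  - exact: (Y_bdd sT).1.
by exists (Cb * (t - s)); apply: filterS cumul_le => w /(_ _ _ s0 st tT) [].
Qed.

Section Weight.
Variables (s t : R) (U : Omega -> R).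
Hypotheses (s_ge0 : 0 <= s) (s_le_t : s <= t) (t_le_T : t <= T).
Hypotheses (U_bdd : bdd P U) (U_wrt : measurable_wrt (F s) U).

Let sT : 0 <= s <= T. Proof. by rewrite s_ge0 (le_trans s_le_t). Qed.
Let tT : 0 <= t <= T. Proof. by rewrite (le_trans s_ge0). Qed.

Lemma weight_increment :
  Ex P (fun w => U w * (Y t w - Y s w)) = - Ex P (fun w => U w * cumul s t w).
Proof.
have o := M_orth s_ge0 s_le_t t_le_T.
have := orth_mul (uc_sigma_algebra F_usual sT) (uc_measurable F_usual sT) o U_wrt
  (intg_bddM U_bdd o.1).
have bc := cumul_bdd s_ge0 s_le_t t_le_T.
have bY : bdd P (fun w => Y t w - Y s w) by apply: bddB; exact: Y_bdd.
have -> : (fun w => U w * (M t w - M s w)) =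
    (fun w => U w * (Y t w - Y s w) + U w * cumul s t w).
  by apply/funext => w; rewrite /cumul; ring.
rewrite ExD; [|exact/bdd_intg/bddM|exact/bdd_intg/bddM].
by move/eqP; rewrite addr_eq0 => /eqP.
Qed.

(** Increment of Y^2 + 2 K lam t. It is additive over adjacent intervals, and non-negative only in
    weighted mean: this process is a submartingale. *)
Definition qvar w : R := Y t w ^+ 2 - Y s w ^+ 2 + 2 * K * lam * (t - s).

Lemma qvar_bdd : bdd P qvar.
Proof.
apply: bddD; last exact: bdd_cst.
by apply: bddB; under [fun _ => _]funext do rewrite expr2; apply: bddM; exact: Y_bdd.
Qed.

(* Substitute for the Ito isometry: the second moment of an increment of Y is
   controlled by the compensated increment of Y^2, which telescopes in time. *)
Lemma weight_sqr : (\forall w \ae P, 0 <= U w) ->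
  Ex P (fun w => U w * (Y t w - Y s w) ^+ 2) <= Ex P (fun w => U w * qvar w).
Proof.
move=> U0.
have bYs := Y_bdd sT; have bYt := Y_bdd tT.
have bUY : bdd P (fun w => U w * Y s w) by exact: bddM.
have bc := cumul_bdd s_ge0 s_le_t t_le_T.
have bD : bdd P (fun w => Y t w - Y s w) by exact: bddB.
(* The square is Y_t^2 - Y_s^2 - 2 Y_s (Y_t - Y_s). In the last product [U * Y s] is again an
   admissible weight, and the drift part contributes at most K lam (t - s) times the mean of [U]. *)
have e : (fun w => U w * (Y t w - Y s w) ^+ 2) = fun w =>
  (U w * qvar w - (2 * K * lam * (t - s)) * U w) - 2 * ((U w * Y s w) * (Y t w - Y s w)).
  by apply/funext => w; rewrite /qvar; ring.
have bUq : bdd P (fun w => U w * qvar w) by apply: bddM => //; exact: qvar_bdd.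
have bU2 : bdd P (fun w => (2 * K * lam * (t - s)) * U w).
  by apply: bddM => //; exact: bdd_cst.
have bX : bdd P (fun w => (U w * Y s w) * (Y t w - Y s w)) by exact: bddM.
rewrite e ExB; [|by apply: bdd_intg; exact: bddB|by apply: intgZ; exact: bdd_intg].
rewrite ExB; [|exact: bdd_intg|exact: bdd_intg].
rewrite !ExZ; [|exact: bdd_intg|exact: bdd_intg].
have -> : Ex P (fun w => U w * Y s w * (Y t w - Y s w)) =
    - Ex P (fun w => (U w * Y s w) * cumul s t w).
  have o := M_orth s_ge0 s_le_t t_le_T.
  have wUY : measurable_wrt (F s) (fun w => U w * Y s w).
    by apply: measurable_funM => //; exact: Y_wrt.
  have := orth_mul (uc_sigma_algebra F_usual sT) (uc_measurable F_usual sT) o wUY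
    (intg_bddM bUY o.1).
  have -> : (fun w => (U w * Y s w) * (M t w - M s w)) =
      (fun w => (U w * Y s w) * (Y t w - Y s w) + (U w * Y s w) * cumul s t w).
    by apply/funext => w; rewrite /cumul; ring.
  rewrite ExD; [|exact/bdd_intg|exact/bdd_intg/bddM].
  by move/eqP; rewrite addr_eq0 => /eqP.
have : Ex P (fun w => U w * Y s w * cumul s t w) <= Ex P (fun w => (K * lam * (t - s)) * U w).
  apply: Ex_le_ae; [exact/bdd_intg/bddM|by apply: intgZ; exact: bdd_intg|].
  apply: filterS3 U0 Y_bounds cumul_le => w u0 /(_ s sT)/andP[y0 yK] /(_ _ _ s_ge0 s_le_t t_le_T) [_ c1].
  rewrite -mulrA mulrC ler_wpM2r//.
  apply: (@le_trans _ _ (Y s w * (lam * (t - s)))); first by rewrite ler_wpM2l.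
  by rewrite -mulrA ler_wpM2r// mulr_ge0// subr_ge0.
rewrite ExZ; last exact: bdd_intg.
by lra.
Qed.

Lemma weight_qvar_ge0 : (\forall w \ae P, 0 <= U w) -> 0 <= Ex P (fun w => U w * qvar w).
Proof.
move=> U0; apply: le_trans (weight_sqr U0); apply: Ex_ge0.
  apply: measurable_funM; first exact: U_bdd.1.
  apply: measurable_funX; apply: measurable_funB.
  - exact: (Y_bdd tT).1.
  - exact: (Y_bdd sT).1.
by apply: filterS U0 => w h; rewrite mulr_ge0// sqr_ge0.
Qed.

End Weight.

(* Truncation makes f' (Y s) measurable and bounded everywhere, not only almost
   surely. *)
Let clip (x : R) : R := Num.max 0 (Num.min K x).

Let clip_range x : 0 <= clip x <= K.
Proof. by rewrite /clip le_max lexx ge_max K_ge0 ge_min lexx. Qed.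

Let clip_id x : 0 <= x <= K -> clip x = x.
Proof. by move=> /andP[h1 h2]; rewrite /clip min_r// max_r. Qed.

Let f'clip_meas : measurable_fun setT (f' \o clip).
Proof.
apply: (@measurable_comp _ _ _ _ _ _ `[0, K]%classic) => //.
- by move=> _ [x _ <-]; rewrite /= in_itv; exact: clip_range.
- exact: ucont_meas.
- by apply: measurable_maxr => //; exact: measurable_minr.
Qed.

Lemma fY_bdd r : 0 <= r <= T -> bdd P (fun w => f (Y r w)).
Proof.
move=> rT; split.
  by apply: (measurableT_comp (continuous_measurable_fun f_continuous)); exact: (Y_bdd rT).1.
have /heine/ucont_bounded[C hC] : {within `[0, K], continuous f}.
  exact: continuous_subspaceT.
by exists C; apply: filterS Y_bounds => w /(_ r rT) /hC.
Qed.

Section FIncrement.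
Variables (s t : R) (U : Omega -> R).
Hypotheses (s_ge0 : 0 <= s) (s_le_t : s <= t) (t_le_T : t <= T).
Hypotheses (U_bdd : bdd P U) (U_wrt : measurable_wrt (F s) U).

Let sT : 0 <= s <= T. Proof. by rewrite s_ge0 (le_trans s_le_t). Qed.
Let tT : 0 <= t <= T. Proof. by rewrite (le_trans s_ge0). Qed.

(** In the first order term U f'(Y_s) is measurable at time s, so the martingale part of the
    increment drops out and only the drift, of order t - s, remains. The Taylor remainder is handled
    by [weight_sqr] with weight |U|. *)
Lemma weight_f_increment :
  `|Ex P (fun w => U w * (f (Y t w) - f (Y s w)))| <=
    D * (Cb * (t - s)) * Ex P (fun w => `|U w|) + L / 2 * Ex P (fun w => `|U w| * qvar s t w).
Proof.
pose th w := f' (clip (Y s w)).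
have D0 : 0 <= D by apply: le_trans (normr_ge0 _) (f'_le (clip_range 0)).
have wth : measurable_wrt (F s) th by exact: (measurableT_comp f'clip_meas (Y_wrt sT)).
have bth : bdd P th.
  split; first exact: wrt_meas wth.
  by exists D; apply: aeW => w; apply: f'_le; exact: clip_range.
have bYs := Y_bdd sT; have bYt := Y_bdd tT.
have bD : bdd P (fun w => Y t w - Y s w) by exact: bddB.
have bfD : bdd P (fun w => f (Y t w) - f (Y s w)) by apply: bddB; exact: fY_bdd.
have bUth : bdd P (fun w => U w * th w) by exact: bddM.
have wUth : measurable_wrt (F s) (fun w => U w * th w) by exact: measurable_funM.
have bc := cumul_bdd s_ge0 s_le_t t_le_T.
have bnU := bdd_norm U_bdd.
pose r w := f (Y t w) - f (Y s w) - th w * (Y t w - Y s w).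
have br : bdd P r by apply: bddB => //; exact: bddM.
have e : (fun w => U w * (f (Y t w) - f (Y s w))) =
    fun w => (U w * th w) * (Y t w - Y s w) + U w * r w.
  by apply/funext => w; rewrite /r; ring.
rewrite e ExD; [|exact/bdd_intg/bddM|exact/bdd_intg/bddM].
apply: le_trans (ler_normD _ _) _; apply: lerD.
  have -> : Ex P (fun w => U w * th w * (Y t w - Y s w)) =
      - Ex P (fun w => (U w * th w) * cumul s t w).
    have o := M_orth s_ge0 s_le_t t_le_T.
    have := orth_mul (uc_sigma_algebra F_usual sT) (uc_measurable F_usual sT) o wUth
      (intg_bddM bUth o.1).
    have -> : (fun w => (U w * th w) * (M t w - M s w)) =
        (fun w => (U w * th w) * (Y t w - Y s w) + (U w * th w) * cumul s t w).
      by apply/funext => w; rewrite /cumul; ring.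
    rewrite ExD; [|exact/bdd_intg/bddM|exact/bdd_intg/bddM].
    by move/eqP; rewrite addr_eq0 => /eqP.
  rewrite normrN; apply: le_trans (Ex_le_norm _) _; first exact/bdd_intg/bddM.
  rewrite -ExZ; last exact: bdd_intg.
  apply: Ex_le_ae; [exact/bdd_intg/bdd_norm/bddM|by apply: intgZ; exact: bdd_intg|].
  apply: filterS cumul_le => w /(_ _ _ s_ge0 s_le_t t_le_T) [c1 _].
  rewrite !normrM mulrAC -mulrA mulrC ler_wpM2r// mulrC ler_pM//.
  by apply: f'_le; exact: clip_range.
apply: le_trans (Ex_le_norm _) _; first exact/bdd_intg/bddM.
apply: (@le_trans _ _ (Ex P (fun w => L / 2 * (`|U w| * (Y t w - Y s w) ^+ 2)))).
  have bS : bdd P (fun w => (Y t w - Y s w) ^+ 2).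
    by under [fun _ => _]funext do rewrite expr2; exact: bddM.
  apply: Ex_le_ae; [exact/bdd_intg/bdd_norm/bddM|by apply: intgZ; exact/bdd_intg/bddM|].
  apply: filterS Y_bounds => w yb.
  rewrite normrM mulrCA ler_wpM2l// /r /th clip_id; last exact: yb.
  by apply: f_taylor; exact: yb.
rewrite ExZ; last first.
  by apply/bdd_intg/bddM => //; under [fun _ => _]funext do rewrite expr2; exact: bddM.
rewrite ler_wpM2l ?divr_ge0//; apply: weight_sqr => //; last exact: aeW.
exact: measurableT_comp.
Qed.

End FIncrement.

Section Window.
Variables (s t : R) (U : Omega -> R).
Hypotheses (s_ge0 : 0 <= s) (s_le_t : s <= t) (t_le_T : t <= T).
Hypotheses (U_bdd : bdd P U) (U_wrt : measurable_wrt (F s) U).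
Hypothesis P_complete : P.-negligible `<=` measurable.

Let sT : 0 <= s <= T. Proof. by rewrite s_ge0 (le_trans s_le_t). Qed.
Let tT : 0 <= t <= T. Proof. by rewrite (le_trans s_ge0). Qed.

(** By additivity the difference is the weighted [qvar] over [r, t], and a weight known at s is
    known at r. *)
Lemma weight_qvar_mono r : s <= r <= t ->
  Ex P (fun w => `|U w| * qvar s r w) <= Ex P (fun w => `|U w| * qvar s t w).
Proof.
move=> /andP[sr rt].
have rT : 0 <= r <= T by rewrite (le_trans s_ge0 sr) (le_trans rt).
have bU := bdd_norm U_bdd.
have wU : measurable_wrt (F r) (fun w => `|U w|).
  have wU' : measurable_wrt (F s) (fun w => `|U w|) by exact: measurableT_comp.
  apply: wrt_sub wU'.
  - exact: (uc_sigma_algebra F_usual).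
  - exact: (uc_sigma_algebra F_usual).
  - by case/andP: rT => *; exact: (uc_nondecreasing F_usual).
have r0 : 0 <= r by case/andP: rT.
have := weight_qvar_ge0 r0 rt t_le_T bU wU (aeW _ (fun w => normr_ge0 (U w))).
have -> : (fun w => `|U w| * qvar r t w) =
    fun w => `|U w| * qvar s t w - `|U w| * qvar s r w.
  by apply/funext => w; rewrite /qvar; ring.
rewrite ExB ?subr_ge0//; apply/bdd_intg/bddM => //; apply: qvar_bdd => //.
by case/andP: rT.
Qed.

Definition window_int w : R := itg s t (fun r => f (Y r w) - f (Y s w)).

Let Gm m w : R := \sum_(j < m) (f (Y (pt s t m j) w) - f (Y s w)) * ((t - s) / m%:R).

Let fY_ucont : \forall w \ae P, ucont s t (fun r => f (Y r w) - f (Y s w)).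
Proof.
apply: filterS2 Y_path Y_bounds => w [uY _ _ _] yb.
have sub r : s <= r <= t -> 0 <= r <= T.
  by move=> /andP[h1 h2]; rewrite (le_trans s_ge0) ?(le_trans h2).
apply: ucontD; last first.
  by move=> e e0; exists 1 => // *; rewrite subrr normr0.
have uf : ucont 0 K f by apply: heine; exact: continuous_subspaceT.
apply: (ucont_comp uf (fun r rt => yb r (sub r rt))).
move=> e e0; have [q q0 h] := uY e e0; exists q => // u v /sub uu /sub vv.
exact: h.
Qed.

Let Gm_cvg : \forall w \ae P, Gm m w @[m --> \oo] --> window_int w.
Proof. by apply: filterS fY_ucont => w uf; exact: riemann_sum_cvg. Qed.

Let p_range m (j : 'I_m) : s <= pt s t m j <= t.
Proof. by apply: pt_range => //; exact: ltnW. Qed.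

Let pT m (j : 'I_m) : 0 <= pt s t m j <= T.
Proof. by have /andP[h1 h2] := p_range j; rewrite (le_trans s_ge0 h1) (le_trans h2). Qed.

Let incr_bdd m (j : 'I_m) : bdd P (fun w => f (Y (pt s t m j) w) - f (Y s w)).
Proof. by apply: bddB; exact: fY_bdd. Qed.

Let term_bdd m (j : 'I_m) :
  bdd P (fun w => (f (Y (pt s t m j) w) - f (Y s w)) * ((t - s) / m%:R)).
Proof. by apply: bddM; [exact: incr_bdd|exact: bdd_cst]. Qed.

Let Gm_meas m : measurable_fun setT (Gm m).
Proof. by apply: measurable_sum => j; exact: (term_bdd j).1. Qed.

Let fK_bound : exists C, forall y, 0 <= y <= K -> `|f y| <= C.
Proof.
have /heine/ucont_bounded[C hC] : {within `[0, K], continuous f}.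
  exact: continuous_subspaceT.
by exists C.
Qed.

Lemma window_int_bdd : bdd P window_int.
Proof.
split; first exact: complete_cvg Gm_cvg.
have [C hC] := fK_bound; exists ((C + C) * (t - s)).
apply: filterS2 fY_ucont Y_bounds => w uf yb.
have sub r : s <= r <= t -> 0 <= r <= T.
  by move=> /andP[h1 h2]; rewrite (le_trans s_ge0) ?(le_trans h2).
have bound r : s <= r <= t -> `|f (Y r w) - f (Y s w)| <= C + C.
  by move=> rt; apply: le_trans (ler_normB _ _) _; rewrite lerD// hC// yb//; exact: sub.
apply: itg_norm_le => //; apply: itg_integrable bound; exact: ucont_meas.
Qed.

(** [weight_f_increment] is summed over a Riemann partition. Elapsed times j (t - s) / m add up to
    the factor (t - s)^2 / 2; the quadratic parts are all bounded by the one over the whole window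
    and contribute t - s. *)
Lemma weight_window : `|Ex P (fun w => U w * window_int w)| <=
  D * Cb * (t - s) ^+ 2 / 2 * Ex P (fun w => `|U w|) +
  L / 2 * (t - s) * Ex P (fun w => `|U w| * qvar s t w).
Proof.
have D0 : 0 <= D by apply: le_trans (normr_ge0 _) (f'_le (clip_range 0)).
(* [Cb] is only known as a bound for the drift; its sign is read off from an almost sure bound on a
   non-negative quantity. *)
have Cb0 : 0 <= Cb * (t - s) ^+ 2.
  have [->|st] := eqVneq s t; first by rewrite subrr expr0n/= mulr0.
  have st0 : 0 < t - s by rewrite subr_gt0 lt_neqAle st.
  have : 0 <= Cb * (t - s).
    rewrite -(Ex_cst P (Cb * (t - s))); apply: Ex_ge0 => //.
    apply: filterS cumul_le => w /(_ _ _ s_ge0 s_le_t t_le_T) [h _].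
    exact: le_trans h.
  by rewrite expr2 mulrA => h; rewrite mulr_ge0// ltW.
have EU0 : 0 <= Ex P (fun w => `|U w|).
  by apply: Ex_ge0; [exact: (bdd_norm U_bdd).1|exact: aeW].
have EQ0 : 0 <= Ex P (fun w => `|U w| * qvar s t w).
  apply: weight_qvar_ge0 => //; [exact: bdd_norm|exact: measurableT_comp|exact: aeW].
have [C hC] := fK_bound.
have DC0 : 0 <= D * Cb * (t - s) ^+ 2 by rewrite -mulrA mulr_ge0.
have ts0 : 0 <= t - s by rewrite subr_ge0.
have step m : `|Ex P (fun w => U w * Gm m w)| <=
    D * Cb * (t - s) ^+ 2 / 2 * Ex P (fun w => `|U w|) +
    L / 2 * (t - s) * Ex P (fun w => `|U w| * qvar s t w).
  have [->|m0] := posnP m.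
    rewrite (_ : (fun w => _) = fun=> 0) ?Ex_cst ?normr0; last first.
      by apply/funext => w; rewrite /Gm big_ord0 mulr0.
    by have := mulr_ge0 DC0 EU0; have := mulr_ge0 (mulr_ge0 L_ge0 ts0) EQ0; lra.
  have mR : 0 < m%:R :> R by rewrite ltr0n.
  set h := (t - s) / m%:R.
  have h0 : 0 <= h by rewrite divr_ge0 ?subr_ge0.
  have -> : (fun w => U w * Gm m w) = (fun w => \sum_(j < m)
      h * (U w * (f (Y (pt s t m j) w) - f (Y s w)))).
    by apply/funext => w; rewrite /Gm mulr_sumr; apply: eq_bigr => j _; rewrite -/h; ring.
  have ij (j : 'I_m) : intg P (fun w => U w * (f (Y (pt s t m j) w) - f (Y s w))).
    exact/bdd_intg/bddM.
  rewrite Ex_sum; last by move=> j; exact: intgZ.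
  apply: le_trans (ler_norm_sum _ _ _) _.
  apply: (@le_trans _ _ (\sum_(j < m) (h * (D * Cb * (j%:R * h) * Ex P (fun w => `|U w|)) +
      h * (L / 2 * Ex P (fun w => `|U w| * qvar s t w))))).
    apply: ler_sum => j _; rewrite ExZ// normrM (ger0_norm h0) -mulrDr ler_wpM2l//.
    have /andP[sp pt_] := p_range j; have /andP[_ p2] := pT j.
    apply: le_trans (weight_f_increment s_ge0 sp p2 U_bdd U_wrt) _.
    apply: lerD.
      by rewrite /pt [s + _ - s]addrAC subrr add0r -/h mulrA.
    by rewrite ler_wpM2l ?divr_ge0//; apply: weight_qvar_mono; exact: p_range.
  rewrite big_split/= sumr_const card_ord; apply: lerD; last first.
    rewrite -mulr_natl le_eqVlt; apply/orP; left; apply/eqP.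
    by rewrite /h; field; rewrite lt0r_neq0.
  rewrite (eq_bigr (fun j : 'I_m => j%:R * (D * Cb * h ^+ 2 * Ex P (fun w => `|U w|)))); last first.
    by move=> j _; ring.
  rewrite -mulr_suml -natr_sum.
  rewrite mulrA ler_wpM2r//.
  have e : D * Cb * (t - s) ^+ 2 / 2 = m%:R ^+ 2 / 2 * (D * Cb * h ^+ 2).
    by rewrite /h; field; rewrite lt0r_neq0.
  rewrite e ler_wpM2r ?sum_ord_le//.
  by rewrite /h exprMn mulrA mulr_ge0// exprn_ge0// invr_ge0.
(* The bound on the Riemann sums is uniform in [m]; dominated convergence carries it to the
   integral. *)
have cv : Ex P (fun w => U w * Gm m w) @[m --> \oo] --> Ex P (fun w => U w * window_int w).
  apply: (@Ex_dominated _ _ _ _ _ _ (fun w => `|U w| * ((C + C) * (t - s)))).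
  - by move=> m; apply: measurable_funM => //; exact: U_bdd.1.
  - by apply: measurable_funM; [exact: U_bdd.1|exact: window_int_bdd.1].
  - by apply/bdd_intg/bddM; [exact: bdd_norm|exact: bdd_cst].
  - by apply: filterS Gm_cvg => w h; exact: cvgMr.
  - apply: filterS Y_bounds => w yb m; rewrite normrM ler_wpM2l//.
    apply: le_trans (ler_norm_sum _ _ _) _.
    apply: (@le_trans _ _ (\sum_(j < m) (C + C) * ((t - s) / m%:R))).
      apply: ler_sum => j _; rewrite normrM (@ger0_norm _ (_ / _)); last first.
        by rewrite divr_ge0// subr_ge0.
      rewrite ler_wpM2r ?divr_ge0 ?subr_ge0//.
      by apply: le_trans (ler_normB _ _) _; rewrite lerD// hC// yb//; exact: pT.
    rewrite sumr_const card_ord -[_ *+ m]mulr_natl.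
    have [->|m0] := posnP m.
      rewrite mul0r mulr_ge0 ?subr_ge0// addr_ge0//;
      by apply: le_trans (normr_ge0 _) (hC 0 _); rewrite lexx.
    rewrite le_eqVlt; apply/orP; left; apply/eqP; field.
    by rewrite pnatr_eq0 -lt0n.
have cvn : `|Ex P (fun w => U w * Gm m w)| @[m --> \oo] -->
    `|Ex P (fun w => U w * window_int w)| by exact: cvg_norm.
rewrite -(cvg_lim _ cvn)//; apply: limr_le; first by apply/cvg_ex; eexists; exact: cvn.
by apply: nearW => m; exact: step.
Qed.

End Window.
End Estimates.

(** * The Euler scheme *)

Section Grid.
Context {R : realType}.
Variables (T : R) (N : nat).
Hypotheses (T_gt0 : 0 < T) (N_gt0 : (0 < N)%N).

Lemma gridE k : grid T N k = pt 0 T N k.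
Proof. by rewrite /grid /step /pt subr0 add0r. Qed.

Lemma grid_range k : (k <= N)%N -> 0 <= grid T N k <= T.
Proof. by move=> kN; rewrite gridE; apply: pt_range => //; exact: ltW. Qed.

Lemma grid_le i k : (i <= k)%N -> grid T N i <= grid T N k.
Proof. by move=> ik; rewrite !gridE; apply: pt_le => //; exact: ltW. Qed.

Lemma gridS k : grid T N k.+1 = grid T N k + step T N.
Proof. by rewrite !gridE ptS subr0. Qed.

Lemma gridN : grid T N N = T.
Proof. by rewrite gridE ptn. Qed.

Lemma step_gt0 : 0 < step T N.
Proof. by rewrite /step divr_gt0// ltr0n. Qed.

Lemma grid_interpE {d : measure_display} {Omega : measurableType d} (X : nat -> Omega -> R) k s w :
  (k < N)%N -> grid T N k <= s < grid T N k.+1 -> grid_interp T N X s w = X k w.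
Proof.
move=> kN; rewrite !gridE => ks.
have := @step_sum _ 0 T N k s (fun j => X j w) (ltW T_gt0) kN ks.
move=> <-; apply: eq_bigr => j _; congr (_ * \1_ _ _).
by rewrite !gridE.
Qed.

End Grid.

(** The piecewise constant processes follow the grid values on half-open cells only, while the
    integrals run over closed intervals; the right end point is a null set. *)
Lemma eq_itg_co {R : realType} (a b : R) (g beta : R -> R) :
  (@lebesgue_measure R).-integrable `[a, b] (EFin \o g) ->
  (@lebesgue_measure R).-integrable `[a, b] (EFin \o beta) ->
  (forall s, a <= s < b -> g s = beta s) -> itg a b g = itg a b beta.
Proof.
move=> ig ib e.
have sub : `[a, b[%classic `<=` `[a, b]%classic by apply: subset_itvl; rewrite bnd_simp.
rewrite /itg -!Rintegral_itv_bndo_bndc.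
- by apply: eq_Rintegral => s; rewrite inE/= in_itv; exact: e.
- exact: integrableS ib.
- exact: integrableS ig.
Qed.

Section InterpolationDistance.
Context {R : realType} {d : measure_display} {Omega : measurableType d}.
Variables (P : probability Omega R) (T : R) (N : nat).
Hypothesis T_gt0 : 0 < T.
Variables (X : R -> Omega -> R) (Xbar : nat -> Omega -> R) (B : R).
Hypothesis X_joint : joint_meas `[0, T] X.
Hypothesis Xbar_meas : forall k, (k <= N)%N -> measurable_fun setT (Xbar k).
Hypothesis X_bound : \forall w \ae P, forall t : R, 0 <= t <= T -> `|X t w| <= B.
Hypothesis Xbar_bound : forall k, (k <= N)%N -> \forall w \ae P, `|Xbar k w| <= B.

Let dist (s : R) (w : Omega) : R := `|X s w - grid_interp T N Xbar s w|.

Definition interp_dist i w : R := itg (grid T N i) T (fun s => dist s w).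

Lemma ae_grid (Q : nat -> Omega -> Prop) :
  (forall k, (k <= N)%N -> \forall w \ae P, Q k w) ->
  \forall w \ae P, forall k, (k <= N)%N -> Q k w.
Proof.
move=> h; apply: ae_foralln => k; have [kN|kN] := leqP k N; last exact: aeW.
by apply: filterS (h k kN) => w.
Qed.

Let interp_le : \forall w \ae P, forall s, `|grid_interp T N Xbar s w| <= N%:R * B.
Proof.
apply: filterS (ae_grid Xbar_bound) => w h s.
apply: le_trans (ler_norm_sum _ _ _) _.
apply: (@le_trans _ _ (\sum_(k < N) B)); last by rewrite sumr_const card_ord mulr_natl.
apply: ler_sum => k _; rewrite normrM.
have hk := h k (ltnW (ltn_ord k)).
rewrite indicE; case: (_ \in _); rewrite ?normr1 ?normr0 ?mulr1// mulr0.
exact: le_trans (normr_ge0 _) hk.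
Qed.

Let dist_path : \forall w \ae P, measurable_fun `[0, T] (fun s => dist s w) /\
  forall s, 0 <= s <= T -> `|dist s w| <= B + N%:R * B.
Proof.
apply: filterS2 X_bound interp_le => w h1 h2; split.
  have mI : measurable_fun setT (fun s : R => grid_interp T N Xbar s w).
    apply: measurable_sum => k; apply: measurable_funM => //; exact: measurable_indic.
  apply: measurableT_comp => //; apply: measurable_funB; first exact: joint_section X_joint.
  exact: measurable_funTS.
move=> s sT; rewrite /dist normr_id; apply: le_trans (ler_normB _ _) _.
by rewrite lerD// h1.
Qed.

Lemma interp_dist_bdd i : (i <= N)%N -> bdd P (interp_dist i).
Proof.
move=> iN; have /andP[g0 gT] := grid_range T_gt0 iN.
split.
  apply: (@joint_itg _ _ _ _ _ dist); last by move=> s w; exact: normr_ge0.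
  apply: (@measurableT_comp _ _ _ _ _ _ (fun x : R => `|x|)) => //.
  apply: measurable_funB.
    apply: measurable_funS X_joint; first by apply: measurableX.
    by move=> p [/= p1 p2]; split => //; move: p1; rewrite /= !in_itv/= => /andP[h1 ->]; rewrite (le_trans g0).
  apply: measurable_sum => k; apply: measurable_funM.
    apply: measurable_funTS; apply: (measurableT_comp _ measurable_snd).
    exact: Xbar_meas (ltnW (ltn_ord k)).
  apply: measurable_funTS; apply: (@measurableT_comp _ _ _ _ _ _
    (\1_`[grid T N k, grid T N k.+1[ : measurableTypeR R -> R) _ fst); last exact: measurable_fst.
  exact: measurable_indic.
exists ((B + N%:R * B) * (T - grid T N i)).
apply: filterS dist_path => w [md db].
apply: itg_norm_le => //.
  by apply: itg_sub (itg_integrable md db) _ _.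
by move=> s /andP[h1 h2]; apply: db; rewrite h2 (le_trans g0).
Qed.

(** Localises the distance on one cell, where the interpolation is frozen at its left value, so that
    it matches the error of a single Euler step. *)
Lemma interp_dist_step k : (k < N)%N -> \forall w \ae P,
  interp_dist k w = itg (grid T N k) (grid T N k.+1) (fun s => `|X s w - Xbar k w|)
    + interp_dist k.+1 w.
Proof.
move=> kN; have /andP[g0 gT] := grid_range T_gt0 (ltnW kN).
have /andP[g0' gT'] := grid_range T_gt0 kN.
have gg := @grid_le R T N T_gt0 _ _ (leqnSn k).
apply: filterS2 dist_path X_bound => w [md db] Xb.
have id_ := itg_integrable md db.
rewrite /interp_dist (@itg_chasles _ (grid T N k) (grid T N k.+1)); last 2 first.
- exact: itg_sub id_ _ _.
- by rewrite gg.
congr (_ + _).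
apply: (@eq_itg_co R).
- exact: itg_sub id_ _ _.
- have sub s : grid T N k <= s <= grid T N k.+1 -> 0 <= s <= T.
    by move=> /andP[a1 a2]; rewrite (le_trans g0 a1) (le_trans a2 gT').
  apply: (@itg_integrable _ _ _ _ (B + `|Xbar k w|)).
    apply: measurableT_comp => //; apply: measurable_funB => //.
    by apply: measurable_funS (joint_section w _ X_joint) => // s; exact: sub.
  move=> s /sub sT; rewrite normr_id; apply: le_trans (ler_normB _ _) _.
  by rewrite lerD2r; exact: Xb.
- by move=> s ks; rewrite /dist (grid_interpE T_gt0 _ w kN ks).
Qed.

End InterpolationDistance.

Section OneStepPath.
Context {R : realType}.
Notation mu := (@lebesgue_measure R).
Variables (s t : R) (f y a l : R -> R) (ab lb yb c lam FK sg : R).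
Hypotheses (s_le_t : s <= t) (ma : measurable_fun `[s, t] a) (ml : measurable_fun `[s, t] l).
Hypotheses (mfy : measurable_fun `[s, t] (fun r => f (y r))).
Hypothesis a_le : forall r, s <= r <= t -> `|a r| <= c.
Hypothesis l_le : forall r, s <= r <= t -> `|l r| <= lam.
Hypothesis fy_le : forall r, s <= r <= t -> `|f (y r)| <= FK.
Hypotheses (ab_ge0 : 0 <= ab).
Hypothesis sg1 : `|sg| <= 1.
Hypothesis sg_sign : sg * (f (y s) - f yb) <= 0.

(* The rates are frozen at the left end point, then f(Y) is frozen there; the
   remaining difference has the sign of minus the error since f is monotone. *)
Lemma one_step_path :
  sg * (itg s t (fun r => a r * f (y r) + l r)
        - ((t - s) * ab * f yb + (t - s) * lb)) <=
  FK * itg s t (fun r => `|a r - ab|) + itg s t (fun r => `|l r - lb|)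
  + sg * ab * itg s t (fun r => f (y r) - f (y s)).
Proof.
have FK0 : 0 <= FK by apply: le_trans (fy_le (r := s) _); rewrite ?lexx.
have ia : mu.-integrable `[s, t] (EFin \o (fun r => `|a r - ab|)).
  apply: (@itg_integrable _ _ _ _ (c + `|ab|)).
    by apply: measurableT_comp => //; exact: measurable_funB.
  by move=> r rt; rewrite normr_id; apply: le_trans (ler_normB _ _) _; rewrite lerD2r a_le.
have il : mu.-integrable `[s, t] (EFin \o (fun r => `|l r - lb|)).
  apply: (@itg_integrable _ _ _ _ (lam + `|lb|)).
    by apply: measurableT_comp => //; exact: measurable_funB.
  by move=> r rt; rewrite normr_id; apply: le_trans (ler_normB _ _) _; rewrite lerD2r l_le.
pose g1 r := (a r - ab) * f (y r) + (l r - lb).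
have mg1 : measurable_fun `[s, t] g1.
  by apply: measurable_funD; [apply: measurable_funM => //|]; exact: measurable_funB.
have g1_le r : s <= r <= t -> `|g1 r| <= FK * `|a r - ab| + `|l r - lb|.
  move=> rt; apply: le_trans (ler_normD _ _) _; rewrite lerD2r normrM mulrC.
  by rewrite ler_wpM2r// fy_le.
have ig1 : mu.-integrable `[s, t] (EFin \o g1).
  apply: (@itg_integrable _ _ _ _ (FK * (c + `|ab|) + (lam + `|lb|))) => // r rt.
  apply: le_trans (g1_le r rt) _; apply: lerD.
    by rewrite ler_wpM2l//; apply: le_trans (ler_normB _ _) _; rewrite lerD2r a_le.
  by apply: le_trans (ler_normB _ _) _; rewrite lerD2r l_le.
have ig2 : mu.-integrable `[s, t] (EFin \o (fun r => f (y r) - f (y s))).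
  apply: (@itg_integrable _ _ _ _ (FK + FK)); first exact: measurable_funB.
  move=> r rt; apply: le_trans (ler_normB _ _) _.
  by rewrite lerD// fy_le// lexx.
have ig2' : mu.-integrable `[s, t] (EFin \o (fun r => ab * (f (y r) - f (y s)))).
  by apply: eq_integrable (integrableZl _ ab ig2).
have -> : itg s t (fun r => a r * f (y r) + l r) =
    itg s t g1 + ab * itg s t (fun r => f (y r) - f (y s)) + (ab * f (y s) + lb) * (t - s).
  rewrite -itgZ// -itgD// -itg_cst// -itgD; last first.
  - exact: itg_cst_integrable.
  - by apply: eq_integrable (integrableD _ ig1 ig2').
  - by apply: eq_itg => r _; rewrite /g1; ring.
have bound : sg * itg s t g1 <=
    FK * itg s t (fun r => `|a r - ab|) + itg s t (fun r => `|l r - lb|).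
  apply: le_trans (ler_norm _) _; rewrite normrM.
  apply: (@le_trans _ _ (1 * `|itg s t g1|)); first by rewrite ler_wpM2r.
  rewrite mul1r; apply: le_trans (le_normr_Rintegral _ ig1) _ => //.
  have iaF : mu.-integrable `[s, t] (EFin \o (fun r => FK * `|a r - ab|)).
    by apply: eq_integrable (integrableZl _ FK ia).
  rewrite -itgZ// -itgD//; apply: itg_le => //; first exact: integrable_norm.
  by apply: eq_integrable (integrableD _ iaF il).
have : (t - s) * ab * (sg * (f (y s) - f yb)) <= 0.
  by rewrite mulr_ge0_le0// mulr_ge0// subr_ge0.
by lra.
Qed.

End OneStepPath.

(** * Error recursion of the implicit scheme *)

Section Euler.
Context {R : realType} {d : measure_display} {Omega : measurableType d}.
Variables (P : probability Omega R) (T : R) (F : R -> set (set Omega)) (N : nat).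
Hypotheses (T_gt0 : 0 < T) (N_gt0 : (0 < N)%N).
Hypothesis F_usual : usual_conditions P T F.
Hypothesis P_complete : P.-negligible `<=` measurable.
Variables (Y M a lambda : R -> Omega -> R) (K lam c : R).
Hypotheses (K_ge0 : 0 <= K) (lam_ge0 : 0 <= lam) (c_ge0 : 0 <= c).
Hypothesis Y_wrt : forall t, 0 <= t <= T -> measurable_wrt (F t) (Y t).
Hypothesis M_L2 : forall t, 0 <= t <= T -> L2 P (M t).
Hypothesis M_orth : forall s t, 0 <= s -> s <= t -> t <= T ->
  orth P (F s) (fun w => M t w - M s w).
Hypothesis a_joint : joint_meas `[0, T] a.
Hypothesis lambda_joint : joint_meas `[0, T] lambda.
Hypothesis a_bounds : \forall w \ae P, forall t : R, 0 <= t <= T -> 0 <= a t w <= c.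
Hypothesis lambda_bounds : \forall w \ae P, forall t : R, 0 <= t <= T ->
  0 <= lambda t w <= lam.
Variable f : R -> R.
Let b t w : R := a t w * f (Y t w) + lambda t w.
Hypothesis Y_path : \forall w \ae P,
  [/\ ucont 0 T (fun t => Y t w),
      measurable_fun `[0, T] (fun t => b t w),
      exists C, forall t, 0 <= t <= T -> `|b t w| <= C &
      forall s t, 0 <= s -> s <= t -> t <= T ->
        Y t w - Y s w = - itg s t (fun r => b r w) + (M t w - M s w)].
Hypothesis Y_bounds : \forall w \ae P, forall t, 0 <= t <= T -> 0 <= Y t w <= K.
Variables (f' : R -> R) (D L : R).
Hypothesis f_continuous : continuous f.
Hypothesis f_nonincreasing : {homo f : x y / x <= y >-> y <= x}.
Hypothesis f0 : f 0 = 0.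
Hypothesis f_taylor : forall x y, 0 <= x <= K -> 0 <= y <= K ->
  `|f y - f x - f' x * (y - x)| <= L / 2 * (y - x) ^+ 2.
Hypothesis f'_le : forall x, 0 <= x <= K -> `|f' x| <= D.
Hypothesis f'_ucont : ucont 0 K f'.
Hypothesis L_ge0 : 0 <= L.
Variables (xi xibar : Omega -> R) (abar lbar Ybar : nat -> Omega -> R).
Hypothesis xi_terminal : \forall w \ae P, Y T w = xi w.
Hypothesis xi_meas : measurable_fun setT xi.
Hypothesis xibar_bdd : bdd P xibar.
Hypothesis abar_adapted : grid_adapted T F N abar.
Hypothesis lbar_adapted : grid_adapted T F N lbar.
Hypothesis abar_bounds : forall i, (i <= N)%N -> \forall w \ae P, 0 <= abar i w <= c.
Hypothesis lbar_bounds : forall i, (i <= N)%N -> \forall w \ae P, 0 <= lbar i w <= lam.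
Hypothesis Ybar_scheme : implicit_euler P T F N f abar lbar xibar Ybar.

Let h := step T N.
Let t_ := grid T N.
Let FK := `|f K|.
Let Cb := c * FK + lam.
Let D_ge0 : 0 <= D.
Proof. by apply: le_trans (f'_le (x := 0) _); rewrite ?lexx. Qed.
Let Cb_ge0 : 0 <= Cb. Proof. by rewrite /Cb /FK addr_ge0// mulr_ge0// normr_ge0. Qed.

Lemma fY_le y : 0 <= y <= K -> `|f y| <= FK /\ f y <= 0.
Proof.
move=> /andP[y0 yK]; have := f_nonincreasing y0; rewrite f0 => fy0.
have := f_nonincreasing yK => fyK.
by split=> //; rewrite /FK !ler0_norm ?lerN2// (le_trans fyK).
Qed.

(** With 0 <= Y <= K the drift gets deterministic bounds: [Cb] from |f(Y)| <= |f(K)|, and the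
    one-sided [lam] from f(Y) <= 0. The second is why only [lam] enters [qvar]. *)
Let Y_path1 : \forall w \ae P,
  [/\ ucont 0 T (fun t => Y t w),
      measurable_fun `[0, T] (fun t => b t w),
      forall t, 0 <= t <= T -> `|b t w| <= Cb /\ b t w <= lam &
      forall s t, 0 <= s -> s <= t -> t <= T ->
        Y t w - Y s w = - itg s t (fun r => b r w) + (M t w - M s w)].
Proof.
have ab : \forall w \ae P, (forall t : R, 0 <= t <= T -> 0 <= a t w <= c) /\
    (forall t : R, 0 <= t <= T -> 0 <= lambda t w <= lam).
  by apply: filterS2 a_bounds lambda_bounds.
apply: filterS3 Y_path Y_bounds ab => w [uY mb _ inc] yb [ha hl]; split => // t tT.
have [f1 f2] := fY_le (yb t tT); have /andP[a0 a1] := ha t tT.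
have /andP[l0 l1] := hl t tT; split.
  apply: le_trans (ler_normD _ _) _; rewrite normrM (ger0_norm a0) (ger0_norm l0).
  by apply: lerD => //; apply: ler_pM.
by have := mulr_ge0_le0 a0 f2; rewrite /b; lra.
Qed.

Let tT k : (k <= N)%N -> 0 <= t_ k <= T.
Proof. exact: grid_range. Qed.

Let sF k : (k <= N)%N -> sigma_algebra setT (F (t_ k)).
Proof. by move=> /tT; exact: (uc_sigma_algebra F_usual). Qed.

Let mF k : (k <= N)%N -> F (t_ k) `<=` measurable.
Proof. by move=> /tT; exact: (uc_measurable F_usual). Qed.

Let wrt_meas k (V : Omega -> R) : (k <= N)%N -> measurable_wrt (F (t_ k)) V ->
  measurable_fun setT V.
Proof. by move=> kN; apply: wrt_measurable; [exact: sF|exact: mF]. Qed.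

Let h_gt0 : 0 < h. Proof. exact: step_gt0. Qed.

Let tS k : t_ k.+1 - t_ k = h.
Proof. by rewrite /t_ gridS addrC addKr. Qed.

Let CE k := cond_exp P (F (t_ k)) (Ybar k.+1).

Lemma Ybar_meas k : (k <= N)%N -> measurable_fun setT (Ybar k).
Proof. by move=> kN; apply: (wrt_meas kN); exact: (euler_adapted Ybar_scheme). Qed.

(** Backward induction: f(Ybar) <= 0 gives 0 <= Ybar_k <= E[Ybar_{k+1} | F_{t_k}] + h lam.
    Integrability ensures that the conditional expectation in the scheme is a genuine one rather
    than the default value. *)
Lemma Ybar_intg k : (k <= N)%N -> intg P (Ybar k).
Proof.
move=> kN; rewrite -(subKn kN); elim: (N - k)%N (leq_subr k N) => [|j IH] jN.
  rewrite subn0; have [_ [C hC]] := xibar_bdd.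
  apply: (intg_le (Ybar_meas (leqnn N)) (intg_cst P C)).
  by apply: filterS2 (euler_terminal Ybar_scheme) hC => w ->.
have lt : (N - j.+1 < N)%N by rewrite ltn_subrL N_gt0.
have eS : (N - j.+1).+1 = (N - j)%N by rewrite subnSK.
have iS : intg P (Ybar (N - j.+1).+1) by rewrite eS; apply: IH; exact: ltnW.
have [_ _ iCE _] := cond_expP (sF (ltnW lt)) (mF (ltnW lt)) iS.
have iB : intg P (fun w => `|CE (N - j.+1) w| + h * lam).
  by apply: intgD; [exact: intg_norm|exact: intg_cst].
have ab : \forall w \ae P, 0 <= abar (N - j.+1) w <= c /\ 0 <= lbar (N - j.+1) w <= lam.
  by apply: filterS2 (abar_bounds (ltnW lt)) (lbar_bounds (ltnW lt)).
apply: (intg_le (Ybar_meas (ltnW lt)) iB).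
apply: filterS3 (euler_ge0 Ybar_scheme (ltnW lt)) (euler_step Ybar_scheme lt) ab.
move=> w y0 e [/andP[a0 _] /andP[_ l1]]; rewrite ger0_norm//.
rewrite [leLHS]e -/h -/t_ -/(CE _).
have fy : f (Ybar (N - j.+1) w) <= 0 by rewrite -f0; exact: f_nonincreasing.
have h1 : h * abar (N - j.+1) w * f (Ybar (N - j.+1) w) <= 0.
  by apply: mulr_ge0_le0 => //; rewrite mulr_ge0// ltW.
have h2 : h * lbar (N - j.+1) w <= h * lam by rewrite ler_wpM2l// ltW.
by have := ler_norm (CE (N - j.+1) w); lra.
Qed.

Definition err k w : R := Y (t_ k) w - Ybar k w.

Let Yk_bdd k : (k <= N)%N -> bdd P (Y (t_ k)).
Proof. move=> kN; exact: (Y_bdd F_usual Y_wrt Y_bounds (tT kN)). Qed.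

Lemma err_intg k : (k <= N)%N -> intg P (err k).
Proof. by move=> kN; apply: intgB; [exact/bdd_intg/Yk_bdd|exact: Ybar_intg]. Qed.

Lemma err_wrt k : (k <= N)%N -> measurable_wrt (F (t_ k)) (err k).
Proof.
move=> kN; apply: measurable_funB; first by apply: Y_wrt; exact: tT.
exact: (euler_adapted Ybar_scheme).
Qed.

(** The value 1 at zero error keeps the modulus equal to 1 everywhere. *)
Let sgn k w : R := if 0 <= err k w then 1 else -1.

Let sgn_wrt k : (k <= N)%N -> measurable_wrt (F (t_ k)) (sgn k).
Proof.
move=> kN; apply: measurable_fun_ifT => //.
by apply: measurable_fun_ler => //; exact: err_wrt.
Qed.

Let sgn_norm k w : `|sgn k w| = 1.
Proof. by rewrite /sgn; case: ifP => _; rewrite ?normrN normr1. Qed.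

Let sgn_bdd k : (k <= N)%N -> bdd P (sgn k).
Proof.
move=> kN; split; first exact: wrt_meas (sgn_wrt kN).
by exists 1; apply: aeW => w; rewrite sgn_norm.
Qed.

Let sgn_err k w : sgn k w * err k w = `|err k w|.
Proof.
rewrite /sgn; case: ifPn => [h0|]; first by rewrite mul1r ger0_norm.
by rewrite -ltNge => h0; rewrite mulN1r ltr0_norm.
Qed.

Let a_norm : \forall w \ae P, forall t : R, 0 <= t <= T -> `|a t w| <= c.
Proof. by apply: filterS a_bounds => w hw t /hw /andP[h0 h1]; rewrite ger0_norm. Qed.

Let lambda_norm : \forall w \ae P, forall t : R, 0 <= t <= T -> `|lambda t w| <= lam.
Proof. by apply: filterS lambda_bounds => w hw t /hw /andP[h0 h1]; rewrite ger0_norm. Qed.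

Let abar_norm k : (k <= N)%N -> \forall w \ae P, `|abar k w| <= c.
Proof. by move=> /abar_bounds; apply: filterS => w /andP[h0 h1]; rewrite ger0_norm. Qed.

Let lbar_norm k : (k <= N)%N -> \forall w \ae P, `|lbar k w| <= lam.
Proof. by move=> /lbar_bounds; apply: filterS => w /andP[h0 h1]; rewrite ger0_norm. Qed.

Let abar_meas k : (k <= N)%N -> measurable_fun setT (abar k).
Proof. by move=> kN; apply: (wrt_meas kN); exact: abar_adapted. Qed.

Let lbar_meas k : (k <= N)%N -> measurable_fun setT (lbar k).
Proof. by move=> kN; apply: (wrt_meas kN); exact: lbar_adapted. Qed.

(** Accumulated over all of [t_k, T], so that the contribution of one step is a difference of
    consecutive terms and telescopes. *)
Definition data_err k w : R :=
  FK * interp_dist T N a abar k w + interp_dist T N lambda lbar k w.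

Lemma data_err_bdd k : (k <= N)%N -> bdd P (data_err k).
Proof.
move=> kN; apply: bddD; last first.
  exact: (interp_dist_bdd T_gt0 lambda_joint lbar_meas lambda_norm lbar_norm kN).
apply: bddM; first exact: bdd_cst.
exact: (interp_dist_bdd T_gt0 a_joint abar_meas a_norm abar_norm kN).
Qed.

Let cum k := cumul Y M (t_ k) (t_ k.+1).
Let win k := window_int Y f (t_ k) (t_ k.+1).
Let qv k := qvar Y K lam (t_ k) (t_ k.+1).

Let one_step_ae k : (k < N)%N -> \forall w \ae P,
  sgn k w * (cum k w - (Ybar k w - CE k w)) <=
  data_err k w - data_err k.+1 w + sgn k w * abar k w * win k w.
Proof.
move=> kN; have kN' := ltnW kN.
have /andP[s0 sT] := tT kN'; have /andP[s0' sT'] := tT kN.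
have st : t_ k <= t_ k.+1 by apply: grid_le.
have cE := cumulE Y_path1.
have sA := interp_dist_step T_gt0 a_joint a_norm abar_norm kN.
have sL := interp_dist_step T_gt0 lambda_joint lambda_norm lbar_norm kN.
have h1 : \forall w \ae P, cum k w = itg (t_ k) (t_ k.+1) (fun r => b r w) /\
    (data_err k w - data_err k.+1 w = FK * itg (t_ k) (t_ k.+1) (fun r => `|a r w - abar k w|)
      + itg (t_ k) (t_ k.+1) (fun r => `|lambda r w - lbar k w|)).
  apply: filterS3 cE sA sL => w e1 e2 e3; split; first exact: e1.
  by rewrite /data_err e2 e3 -/t_; ring.
have h2 : \forall w \ae P, 0 <= abar k w /\
    Ybar k w = CE k w + h * abar k w * f (Ybar k w) + h * lbar k w.
  by apply: filterS2 (abar_bounds kN') (euler_step Ybar_scheme kN) => w /andP[].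
have h3 : \forall w \ae P, [/\ forall t : R, 0 <= t <= T -> `|a t w| <= c,
    forall t : R, 0 <= t <= T -> `|lambda t w| <= lam &
    ucont 0 T (fun t => Y t w) /\ forall t, 0 <= t <= T -> 0 <= Y t w <= K].
  have h4 : \forall w \ae P, ucont 0 T (fun t => Y t w) /\ forall t, 0 <= t <= T -> 0 <= Y t w <= K.
    by apply: filterS2 Y_path1 Y_bounds => w [].
  by apply: filterS3 a_norm lambda_norm h4.
apply: filterS3 h1 h2 h3 => w [e1 e2] [a0 e3] [an ln [uY yb]].
have sub r : t_ k <= r <= t_ k.+1 -> 0 <= r <= T.
  by move=> /andP[r1 r2]; rewrite (le_trans s0 r1) (le_trans r2 sT').
have subI : `[t_ k, t_ k.+1]%classic `<=` `[0, T]%classic.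
  by move=> r; rewrite /= !in_itv/=; exact: sub.
rewrite e1 e2 {1}e3 (_ : CE k w + _ + _ - _ = (t_ k.+1 - t_ k) * abar k w * f (Ybar k w)
  + (t_ k.+1 - t_ k) * lbar k w); last by rewrite tS; ring.
have [r1 r2] : (forall r : R, t_ k <= r <= t_ k.+1 -> `|a r w| <= c) /\
    (forall r : R, t_ k <= r <= t_ k.+1 -> `|lambda r w| <= lam).
  by split=> r /sub; [exact: an|exact: ln].
apply: (@one_step_path _ (t_ k) (t_ k.+1) f (Y^~ w) (a^~ w) (lambda^~ w)
  (abar k w) (lbar k w) (Ybar k w) c lam FK (sgn k w)) => //.
- exact: measurable_funS (joint_section w _ a_joint).
- exact: measurable_funS (joint_section w _ lambda_joint).
- apply: (measurableT_comp (continuous_measurable_fun f_continuous)).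
  by apply: measurable_funS (ucont_meas uY).
- by move=> r /sub/yb/fY_le[].
- by rewrite sgn_norm.
- rewrite /sgn /err; case: ifPn => [|]; rewrite ?subr_ge0 -?ltNge ?subr_lt0 => hh.
    by rewrite mul1r subr_le0; exact: f_nonincreasing.
  by rewrite mulN1r opprB subr_le0; apply: f_nonincreasing; exact: ltW.
Qed.

(** The weight [U], equal to V times the sign of the error, is known at t_k. Tested against it, the
    increment of [Y] reduces to minus its drift integral, and Ybar_{k+1} may be exchanged with its
    conditional expectation; the rest is the pathwise one-step bound. *)
Lemma one_step k (V : Omega -> R) : (k < N)%N -> bdd P V ->
  measurable_wrt (F (t_ k)) V -> (\forall w \ae P, 0 <= V w) ->
  Ex P (fun w => V w * `|err k w|) <=
  Ex P (fun w => V w * `|err k.+1 w|)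
  + Ex P (fun w => V w * (data_err k w - data_err k.+1 w))
  + c * (D * Cb * h ^+ 2 / 2 * Ex P V + L / 2 * h * Ex P (fun w => V w * qv k w)).
Proof.
move=> kN bV wV V0; have kN' := ltnW kN.
have /andP[s0 sT] := tT kN'; have /andP[s0' sT'] := tT kN.
have st : t_ k <= t_ k.+1 by apply: grid_le.
pose U w := V w * sgn k w.
have bU : bdd P U by apply: bddM => //; exact: sgn_bdd.
have wU : measurable_wrt (F (t_ k)) U by apply: measurable_funM => //; exact: sgn_wrt.
have bab : bdd P (abar k) by split; [exact: abar_meas|exists c; exact: abar_norm].
pose U' w := U w * abar k w.
have bU' : bdd P U' by exact: bddM.
have wU' : measurable_wrt (F (t_ k)) U' by apply: measurable_funM => //; exact: abar_adapted.
have bc : bdd P (cum k) := cumul_bdd F_usual Y_wrt M_L2 Y_path1 Y_bounds s0 st sT'.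
have bw : bdd P (win k).
  exact: (window_int_bdd F_usual Y_wrt Y_path1 Y_bounds f_continuous s0 st sT' P_complete).
have bq : bdd P (qv k) := qvar_bdd F_usual lam Y_wrt Y_bounds s0 st sT'.
have [_ wCE iCE tCE] := cond_expP (sF kN') (mF kN') (Ybar_intg kN).
have iYk := Ybar_intg kN'; have iYS := Ybar_intg kN.
have ier := err_intg kN'; have ierS := err_intg kN.
have bde := data_err_bdd kN'; have bdeS := data_err_bdd kN.
have iUc : intg P (fun w => U w * (cum k w - (Ybar k w - CE k w))).
  by apply: intg_bddM => //; apply: intgB; [exact: bdd_intg|exact: intgB].
have iVe X : intg P X -> intg P (fun w => V w * X w) by move=> iX; exact: intg_bddM.
have iVd : intg P (fun w => V w * (data_err k w - data_err k.+1 w)).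
  by apply: iVe; apply: bdd_intg; exact: bddB.
have split1 : Ex P (fun w => V w * `|err k w|) =
    Ex P (fun w => U w * err k.+1 w) + Ex P (fun w => U w * (cum k w - (Ybar k w - CE k w))).
  have z1 := weight_increment F_usual Y_wrt M_L2 M_orth Y_path1 Y_bounds s0 st sT' bU wU.
  have z2 : Ex P (fun w => U w * (CE k w - Ybar k.+1 w)) = 0.
    apply: (orth_mul (sF kN') (mF kN')) => //; last first.
      by apply: intg_bddM => //; exact: intgB.
    split; first exact: intgB.
    move=> A GA; have mA := mF kN' GA.
    rewrite RintegralB//; [|exact: integrableS iCE|exact: integrableS iYS].
    by rewrite /Rintegral tCE// subrr.
  have iUY : intg P (fun w => U w * (Y (t_ k.+1) w - Y (t_ k) w)).
    by apply: intg_bddM => //; apply: bdd_intg; apply: bddB; exact: Yk_bdd.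
  have iUC : intg P (fun w => U w * (CE k w - Ybar k.+1 w)) by apply: intg_bddM => //; exact: intgB.
  have iUcum : intg P (fun w => U w * cum k w) by apply: intg_bddM => //; exact: bdd_intg.
  have e : (fun w => U w * err k.+1 w + U w * (cum k w - (Ybar k w - CE k w))) =
      fun w => V w * `|err k w| + ((U w * (Y (t_ k.+1) w - Y (t_ k) w) + U w * cum k w)
        + U w * (CE k w - Ybar k.+1 w)).
    by apply/funext => w; rewrite -sgn_err /U /err; ring.
  rewrite -ExD; [|exact: intg_bddM|by []].
  rewrite e ExD; last 2 first.
  - by apply: iVe; exact: intg_norm.
  - by apply: intgD => //; exact: intgD.
  rewrite ExD//; last exact: intgD.
  by rewrite ExD// z1 z2 addNr !addr0.
have le1 : Ex P (fun w => U w * err k.+1 w) <= Ex P (fun w => V w * `|err k.+1 w|).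
  apply: Ex_le_ae; [exact: intg_bddM|by apply: iVe; exact: intg_norm|].
  apply: filterS V0 => w v0; rewrite /U -mulrA ler_wpM2l//.
  by apply: le_trans (ler_norm _) _; rewrite normrM sgn_norm mul1r.
have iU'w : intg P (fun w => U' w * win k w) by apply/bdd_intg/bddM.
have le2 : Ex P (fun w => U w * (cum k w - (Ybar k w - CE k w))) <=
    Ex P (fun w => V w * (data_err k w - data_err k.+1 w)) + Ex P (fun w => U' w * win k w).
  rewrite -ExD//; apply: Ex_le_ae => //; first exact: intgD.
  apply: filterS2 V0 (one_step_ae kN) => w v0 hs.
  rewrite /U' /U -mulrA; apply: le_trans (ler_wpM2l v0 hs) _.
  by rewrite le_eqVlt; apply/orP; left; apply/eqP; ring.
have U'le : \forall w \ae P, `|U' w| <= c * V w.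
  apply: filterS2 V0 (abar_norm kN') => w v0 ha.
  by rewrite /U' /U !normrM sgn_norm mulr1 (ger0_norm v0) mulrC ler_wpM2r.
have bnU' := bdd_norm bU'.
have iV := bdd_intg bV.
have le3 : Ex P (fun w => `|U' w|) <= c * Ex P V.
  by rewrite -ExZ//; apply: Ex_le_ae => //; [exact: bdd_intg|exact: intgZ].
have iVq : intg P (fun w => V w * qv k w) by apply/bdd_intg/bddM.
(* [qv] may be negative pointwise, so |U'| <= c V cannot simply be multiplied by it; instead the
   non-negative weight c V - |U'| is tested against [qv]. *)
have le4 : Ex P (fun w => `|U' w| * qv k w) <= c * Ex P (fun w => V w * qv k w).
  have bX : bdd P (fun w => c * V w - `|U' w|).
    by apply: bddB => //; apply: bddM => //; exact: bdd_cst.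
  have wX : measurable_wrt (F (t_ k)) (fun w => c * V w - `|U' w|).
    by apply: measurable_funB; [exact: measurable_funM|exact: measurableT_comp].
  have X0 : \forall w \ae P, 0 <= c * V w - `|U' w|.
    by apply: filterS U'le => w; rewrite subr_ge0.
  have := weight_qvar_ge0 F_usual lam_ge0 Y_wrt M_L2 M_orth Y_path1 Y_bounds s0 st sT' bX wX X0.
  have -> : (fun w => (c * V w - `|U' w|) * qvar Y K lam (t_ k) (t_ k.+1) w) =
      fun w => c * (V w * qv k w) - `|U' w| * qv k w by apply/funext => w; rewrite -/(qv k w); ring.
  by rewrite ExB; [rewrite ExZ// subr_ge0|exact: intgZ|exact/bdd_intg/bddM].
have := weight_window F_usual K_ge0 lam_ge0 Y_wrt M_L2 M_orth Y_path1 Y_bounds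
  f_continuous f_taylor f'_le f'_ucont L_ge0 s0 st sT' bU' wU' P_complete.
rewrite tS -/(win k) -/(qv k) => hw.
have := ler_norm (Ex P (fun w => U' w * win k w)).
have DC : 0 <= D * Cb * h ^+ 2 / 2 by apply: mulr_ge0; [apply: mulr_ge0; [exact: mulr_ge0|exact: sqr_ge0]|rewrite invr_ge0 ler0n].
have Lh : 0 <= L / 2 * h.
  by apply: mulr_ge0; [apply: mulr_ge0 => //; rewrite invr_ge0 ler0n|exact: ltW].
have := ler_wpM2l DC le3; have := ler_wpM2l Lh le4.
by rewrite split1; lra.
Qed.

Let xi_dist_bdd : bdd P (fun w => `|xi w - xibar w|).
Proof.
apply/bdd_norm/bddB => //; split => //; exists K.
apply: filterS2 xi_terminal Y_bounds => w <- yb.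
have TT : 0 <= T <= T by rewrite lexx ltW.
by have /andP[y0 yK] := yb T TT; rewrite ger0_norm.
Qed.

(** Backward induction with [V] fixed, since it remains measurable at later grid times. The N - i
    contributions h^2 / 2 sum to h (T - t_i) / 2, and the [qvar] terms telescope to one over
    [t_i, T]. *)
Lemma error_tested i (V : Omega -> R) : (i <= N)%N -> bdd P V ->
  measurable_wrt (F (t_ i)) V -> (\forall w \ae P, 0 <= V w) ->
  Ex P (fun w => V w * `|err i w|) <=
  Ex P (fun w => V w * (`|xi w - xibar w| + data_err i w))
  + c * (D * Cb * h * (T - t_ i) / 2 * Ex P V
         + L / 2 * h * Ex P (fun w => V w * qvar Y K lam (t_ i) T w)).
Proof.
have bx := xi_dist_bdd.
move=> iN; rewrite -(subKn iN); elim: (N - i)%N (leq_subr i N) V => [|j IH] jN V.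
  rewrite subn0 => bV wV V0.
  have tN : t_ N = T by exact: gridN.
  rewrite tN subrr mulr0 !mul0r add0r (_ : (fun w => _ * qvar _ _ _ _ _ _) = cst 0); last first.
    by apply/funext => w; rewrite /qvar !subrr mulr0 addr0 mulr0.
  rewrite Ex_cst mulr0 mulr0 addr0; apply: Ex_le_ae.
  - by apply: intg_bddM => //; apply: intg_norm; exact: err_intg.
  - by apply/bdd_intg/bddM => //; apply: bddD => //; exact: data_err_bdd.
  apply: filterS3 V0 xi_terminal (euler_terminal Ybar_scheme) => w v0 e1 e2.
  rewrite ler_wpM2l// /err tN e1 e2 lerDl /data_err addr_ge0// ?mulr_ge0 ?normr_ge0//.
  - by rewrite /interp_dist /itg Rintegral_ge0.
  - by rewrite /interp_dist /itg Rintegral_ge0.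
move=> bV wV V0.
have lt : (N - j.+1 < N)%N by rewrite ltn_subrL N_gt0.
have eS : (N - j.+1).+1 = (N - j)%N by rewrite subnSK.
move: (IH (ltnW jN) V bV) (one_step lt bV wV V0); rewrite -eS; set k := (N - j.+1)%N in lt wV *.
have kN := ltnW lt.
have /andP[s0 sT] := tT kN; have /andP[s0' sT'] := tT lt.
have st : t_ k <= t_ k.+1 by apply: grid_le.
have wS : measurable_wrt (F (t_ k.+1)) V.
  by apply: wrt_sub wV; [exact: sF|exact: sF|exact: (uc_nondecreasing F_usual)].
move=> /(_ wS V0) ih os.
have bqS : bdd P (qvar Y K lam (t_ k.+1) T) := qvar_bdd F_usual lam Y_wrt Y_bounds s0' sT' (lexx T).
have bq : bdd P (qv k) := qvar_bdd F_usual lam Y_wrt Y_bounds s0 st sT'.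
have bde := data_err_bdd kN; have bdeS := data_err_bdd lt.
have eq1 : Ex P (fun w => V w * (`|xi w - xibar w| + data_err k w)) =
    Ex P (fun w => V w * (`|xi w - xibar w| + data_err k.+1 w)) +
    Ex P (fun w => V w * (data_err k w - data_err k.+1 w)).
  rewrite -ExD; [|by apply/bdd_intg/bddM => //; exact: bddD|by apply/bdd_intg/bddM => //; exact: bddB].
  by congr (Ex P _); apply/funext => w; ring.
have eq2 : Ex P (fun w => V w * qvar Y K lam (t_ k) T w) =
    Ex P (fun w => V w * qv k w) + Ex P (fun w => V w * qvar Y K lam (t_ k.+1) T w).
  rewrite -ExD; [|exact/bdd_intg/bddM|exact/bdd_intg/bddM].
  by congr (Ex P _); apply/funext => w; rewrite /qv /qvar; ring.
have eT : t_ k.+1 = t_ k + h by rewrite -(tS k) addrC subrK.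
rewrite eq1 eq2; move: ih os; rewrite eT; move: (Ex P (fun w => _ * qvar _ _ _ _ _ _)) => q1 ih os.
apply: le_trans os _; apply: le_trans (lerD (lerD ih (lexx _)) (lexx _)) _.
by rewrite le_eqVlt; apply/orP; left; apply/eqP; field.
Qed.

(** Indicators of sets in [F (t_ i)] serve as weights. The deterministic part [kappa] is moved to
    the left, so that the conditional expectation is compared with |err| - kappa. *)
Lemma error_cond_exp i B : (i <= N)%N ->
  (\forall w \ae P, qvar Y K lam (t_ i) T w <= B) ->
  \forall w \ae P, `|err i w| <=
    cond_exp P (F (t_ i)) (fun w => `|xi w - xibar w| + data_err i w) w
    + c * (D * Cb * h * (T - t_ i) / 2 + L / 2 * h * B).
Proof.
move=> iN qB; set kappa := c * _.
have /andP[s0 sT] := tT iN.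
have bX : bdd P (fun w => `|xi w - xibar w| + data_err i w).
  by apply: bddD => //; exact: data_err_bdd.
have ierr : intg P (fun w => `|err i w|) by apply: intg_norm; exact: err_intg.
have iV : intg P (fun w => `|err i w| - kappa) by apply: intgB => //; exact: intg_cst.
have wV : measurable_wrt (F (t_ i)) (fun w => `|err i w| - kappa).
  apply: measurable_funB; last exact: measurable_cst.
  by apply: measurableT_comp => //; exact: err_wrt.
suff test A : F (t_ i) A -> \int[P]_(w in A) (`|err i w| - kappa) <=
    \int[P]_(w in A) (`|xi w - xibar w| + data_err i w).
  apply: filterS (cond_exp_ge (sF iN) (mF iN) (bdd_intg bX) wV iV test) => w.
  by rewrite lerBlDr.
move=> GA; have mA := mF iN GA; rewrite !Rint_indic//.
have bA : bdd P (\1_A : Omega -> R) by exact: bdd_indic.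
have bq : bdd P (qvar Y K lam (t_ i) T) := qvar_bdd F_usual lam Y_wrt Y_bounds s0 sT (lexx T).
have A0 : \forall w \ae P, 0 <= \1_A w :> R by apply: aeW => w; rewrite indicE ler0n.
have := error_tested iN bA (wrt_indic (sF iN) GA) A0.
have q_le : Ex P (fun w => \1_A w * qvar Y K lam (t_ i) T w) <= B * Ex P (\1_A : Omega -> R).
  rewrite -ExZ; last exact: bdd_intg.
  apply: Ex_le_ae; [exact/bdd_intg/bddM|by apply: intgZ; exact: bdd_intg|].
  by apply: filterS2 A0 qB => w a0 qb; rewrite [leRHS]mulrC ler_wpM2l.
have -> : (fun w => \1_A w * (`|err i w| - kappa)) =
    fun w => \1_A w * `|err i w| - kappa * \1_A w by apply/funext => w; ring.
rewrite ExB; [|exact: intg_bddM|by apply: intgZ; exact: bdd_intg].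
rewrite ExZ; last exact: bdd_intg.
have cL : 0 <= c * (L / 2 * h).
  apply: mulr_ge0 => //; apply: mulr_ge0; last exact: ltW.
  by apply: mulr_ge0 => //; rewrite invr_ge0 ler0n.
have := ler_wpM2l cL q_le; rewrite /kappa.
move: (Ex P (fun w => \1_A w * qvar _ _ _ _ _ _)) (Ex P \1_A) => q v.
by lra.
Qed.

End Euler.

Theorem proposition1 (R : realType) (d : measure_display)
    (Omega : measurableType d) (P : probability Omega R)
    (T : R) (T_gt0 : 0 < T)
    (n : nat) (n_gt0 : (0 < n)%N) (W : 'I_n -> R -> Omega -> R)
    (F : R -> set (set Omega))
    (W_brownian : brownian_motion P T W)
    (F_usual : usual_conditions P T F)
    (F_generated : forall t : R, 0 <= t <= T -> F t = brownian_filtration P W t)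
    (F_terminal : F T = measurable)
    (eta_inf eta_sup lambda_sup : R)
    (eta_inf_gt0 : 0 < eta_inf) (eta_inf_lt_sup : eta_inf < eta_sup)
    (lambda_sup_ge0 : 0 <= lambda_sup)
    (eta lambda : R -> Omega -> R)
    (eta_prog : progressively_measurable T F eta)
    (lambda_prog : progressively_measurable T F lambda)
    (eta_bounds : \forall w \ae P, forall t : R, 0 <= t <= T ->
       eta_inf <= eta t w <= eta_sup)
    (lambda_bounds : \forall w \ae P, forall t : R, 0 <= t <= T ->
       0 <= lambda t w <= lambda_sup)
    (f : R -> R) (f_continuous : continuous f)
    (f_nonincreasing : {homo f : x y / x <= y >-> y <= x})
    (f0 : f 0 = 0)
    (f_concave : convex_function (`[0, +oo[%classic : set R) (fun x => - f x))
    (f_C2 : C2_on `[0, +oo[ f)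
    (xi : Omega -> R) (xi_measurable : measurable_wrt (F T) xi)
    (xi_bounded : exists C, \forall w \ae P, `|xi w| <= C)
    (xi_ge0 : \forall w \ae P, 0 <= xi w)
    (Y : R -> Omega -> R) (Z : 'I_n -> R -> Omega -> R)
    (YZ_solution :
       bsde_solution P T F W f (fun t w => (eta t w)^-1) lambda xi Y Z)
    (N : nat) (N_gt0 : (0 < N)%N)
    (abar lbar : nat -> Omega -> R)
    (abar_adapted : grid_adapted T F N abar)
    (lbar_adapted : grid_adapted T F N lbar)
    (abar_bounds : forall i, (i <= N)%N ->
       \forall w \ae P, 0 <= abar i w <= eta_inf^-1)
    (lbar_bounds : forall i, (i <= N)%N ->
       \forall w \ae P, 0 <= lbar i w <= lambda_sup)
    (xibar : Omega -> R) (xibar_measurable : measurable_wrt (F T) xibar)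
    (xibar_bounds : \forall w \ae P, 0 <= xibar w <= Linfty_norm P xi)
    (Ybar : nat -> Omega -> R)
    (Ybar_scheme : implicit_euler P T F N f abar lbar xibar Ybar) :
  let h := step T N in
  let t_ := grid T N in
  let a := fun s w => (eta s w)^-1 in
  let K := Linfty_norm P xi + T * lambda_sup in
  let f' := derive_in `[0, +oo[ f in
  let f'' := derive_in `[0, +oo[ f' in
  forall i : nat, (i <= N)%N ->
    \forall w \ae P,
      `|Y (t_ i) w - Ybar i w|
      <= cond_exp P (F (t_ i)) (fun v =>
           `|xi v - xibar v|
           + `|f K| * \int[lebesgue_measure]_(s in `[t_ i, T])
                        `|a s v - grid_interp T N abar s v|
           + \int[lebesgue_measure]_(s in `[t_ i, T])
               `|lambda s v - grid_interp T N lbar s v|) w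
         + (`|f' K| * T / (2 * eta_inf) * (eta_inf^-1 * `|f K| + lambda_sup)
            + sup [set `|f'' y| | y in `[0, K]] / (2 * eta_inf)
              * (Linfty_norm P xi ^+ 2 + 2 * (T - t_ i) * K * lambda_sup)) * h.
Proof.
move=> h t_ a K f' f'' i iN.
set x := Linfty_norm P xi in K *.
have x_ge0 : 0 <= x := Linfty_norm_ge0 P xi.
have K_ge0 : 0 <= K by rewrite /K addr_ge0// mulr_ge0// ltW.
have TT : 0 <= T <= T by rewrite lexx ltW.
have T00 : 0 <= (0 : R) <= T by rewrite lexx ltW.
have P_complete : P.-negligible `<=` measurable.
  by apply: subset_trans (uc_complete F_usual) (uc_measurable F_usual T00).
have [M M_ito Y_path] := bsde_path T_gt0 F_usual eta_inf_gt0 eta_prog lambda_prog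
  eta_bounds lambda_bounds f_continuous f_nonincreasing YZ_solution.
have [M_L2 M_orth] := ito_L2_orth W_brownian F_usual F_generated M_ito.
have Y_ge0 := bsde_ge0 T_gt0 W_brownian F_usual F_generated eta_inf_gt0 eta_bounds
  lambda_bounds f_nonincreasing f0 xi_ge0 YZ_solution M_ito Y_path.
have Y_le := bsde_le T_gt0 W_brownian F_usual F_generated eta_inf_gt0 lambda_sup_ge0
  eta_bounds lambda_bounds f_nonincreasing f0 xi_bounded YZ_solution M_ito Y_path.
have Y_bounds : \forall w \ae P, forall t, 0 <= t <= T -> 0 <= Y t w <= K.
  by apply: filterS2 Y_ge0 Y_le => w y0 yK t tT; rewrite y0//; exact: yK.
have a_joint : joint_meas `[0, T] a.
  exact: (joint_comp (@measurable_invr R) (eta_joint T_gt0 F_usual eta_prog)).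
have terminal_meas (X : Omega -> R) : measurable_wrt (F T) X -> measurable_fun setT X.
  exact: wrt_measurable (uc_sigma_algebra F_usual TT) (uc_measurable F_usual TT).
have xibar_bdd : bdd P xibar.
  split; first exact: terminal_meas.
  by exists x; apply: filterS xibar_bounds => w /andP[w0 w1]; rewrite ger0_norm.
have c_ge0 : 0 <= eta_inf^-1 by rewrite invr_ge0 ltW.
(* The term -Y_{t_i}^2 is dropped and the terminal value is bounded by its essential supremum; this
   yields the bracket of the second order constant. *)
have qB : \forall w \ae P, qvar Y K lambda_sup (t_ i) T w <=
    x ^+ 2 + 2 * K * lambda_sup * (T - t_ i).
  apply: filterS2 (bsde_terminal YZ_solution) (Linfty_norm_le xi_bounded) => w e hx.
  rewrite /qvar e lerD2r lerBlDr; apply: ler_wpDr; first exact: sqr_ge0.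
  by rewrite -real_normK ?num_real// lerXn2r// nnegrE.
have := error_cond_exp T_gt0 N_gt0 F_usual P_complete K_ge0 lambda_sup_ge0 c_ge0
  (bsde_adapted YZ_solution) M_L2 M_orth a_joint (lambda_joint T_gt0 F_usual lambda_prog)
  (rate_bounds eta_inf_gt0 eta_bounds) lambda_bounds Y_path Y_bounds f_continuous
  f_nonincreasing f0 (@f_taylor _ _ f_C2 K)
  (@f'_norm_le _ _ f_nonincreasing f_concave f_C2 K K_ge0) (f'_ucont f_C2 K)
  (L_ge0 f_C2 K_ge0) (bsde_terminal YZ_solution) (terminal_meas xi xi_measurable) xibar_bdd
  abar_adapted lbar_adapted abar_bounds lbar_bounds Ybar_scheme iN qB.
have -> : (fun w => `|xi w - xibar w| + data_err T N a lambda K f abar lbar i w) =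
    fun v => `|xi v - xibar v| + `|f K| * itg (t_ i) T (fun s => `|a s v - grid_interp T N abar s v|)
      + itg (t_ i) T (fun s => `|lambda s v - grid_interp T N lbar s v|).
  by apply/funext => v; rewrite /data_err addrA.
apply: filterS => w hw; apply: le_trans hw _; rewrite lerD2l.
have /andP[t0 tT] := grid_range T_gt0 iN.
have h_gt0 : 0 < h by exact: step_gt0.
(* The recursion gives T - t_i in the first order term where the claim has T; this is exactly the
   difference. *)
have slack : 0 <= `|f' K| * (eta_inf^-1 * `|f K| + lambda_sup) * h * t_ i * eta_inf^-1 / 2.
  by rewrite !mulr_ge0// ?addr_ge0// ?mulr_ge0// ?invr_ge0 ?ler0n// ltW.
rewrite -subr_ge0; apply: le_trans slack _; rewrite le_eqVlt; apply/orP; left; apply/eqP.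
rewrite -/f' -/f'' -/h -/(t_ i); field; exact: lt0r_neq0.
Qed.
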